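(* Let $M$ be a differentiable manifold, let $F:TM\to[0,\infty)$ be a $C^0$-Finsler structure on $M$, and let $(F_\varepsilon)_{\varepsilon\in(0,1)}$ be a mollifier smoothing of $F$. Then: (1) $F_\varepsilon$ is a Finsler structure on $M$ for every $\varepsilon\in(0,1)$; (2) $F_\varepsilon\to F$ uniformly on compact subsets of $TM$ as $\varepsilon\to 0$.
   Context: $M$ is a smooth manifold of dimension $n$. An asymmetric norm on a real vector space $\mathbb V$ is a function $N:\mathbb V\to[0,\infty)$ with $N(y)=0$ only if $y=0$, $N(\mu y)=\mu N(y)$ for $\mu\ge 0$, and $N(y+z)\le N(y)+N(z)$. A Minkowski norm on $\mathbb V$ is a function $N:\mathbb V\to\mathbb R$, smooth on $\mathbb V\setminus\{0\}$, with $N(\mu y)=\mu N(y)$ for $\mu>0$ and with positive definite Hessian matrix $\left(\frac12\frac{\partial^2N^2}{\partial y^i\partial y^j}(y)\right)$ at every $y\neq0$ (linear coordinates). A $C^0$-Finsler structure on $M$ is a continuous $F:TM\to\mathbb R$ whose restriction to each $T_xM$ is an asymmetric norm. A Finsler structure on $M$ is a function $F:TM\to\mathbb R$ smooth on $TM\setminus 0=\{(x,y)\in TM: y\ne0\}$ whose restriction to each $T_xM$ is a Minkowski norm. Standard mollifier: $\eta:\mathbb R^n\to\mathbb R$, $\eta(x)=C\exp\left(\frac1{\|x\|^2-1}\right)$ if $\|x\|<1$ and $\eta(x)=0$ otherwise, with $C>0$ such that $\int\eta=1$; $\eta_\varepsilon(x)=\varepsilon^{-n}\eta(x/\varepsilon)$.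 Local vertical smoothing. Let $U_0\subset M$ be open with coordinates $(x^1,\dots,x^n)$ and let $U$ be open with compact closure, $\overline U\subset U_0$. Use natural coordinates $(x,y)=(x^1,\dots,x^n,y^1,\dots,y^n)$ on $TU$, identify $U$ with its image in $\mathbb R^n$ and $TU$ with $U\times\mathbb R^n$; $\|\cdot\|$ is the Euclidean norm in the $y$-coordinates. Put $r_U=\max\{F(x,y):x\in\overline U,\|y\|=1\}$, $r_u=\min\{F(x,y):x\in\overline U,\|y\|=1\}$. Fix an increasing function $u:(0,1)\to(0,\infty)$ with $\lim_{\varepsilon\to0}u(\varepsilon)=0$ and $\tau\in\left(0,\frac{r_u}{16nr_U}\right)$ such that $u(\varepsilon)\in\left(0,\frac{r_u}{16nr_U}\right)$ for all $\varepsilon\in(0,\tau)$. For $\varepsilon\in(0,\tau)$ let $\zeta_\varepsilon=(1-u(\varepsilon))\eta_\varepsilon+u(\varepsilon)\eta_{2r_U/r_u}$ and $(\zeta_\varepsilon\ast_vF)(x,y)=\int_{\mathbb R^n}\zeta_\varepsilon(z)F(x,y-z)\,dz$. For each $x\in U$ the set $(\zeta_\varepsilon\ast_vF)^{-1}(r_U)\cap T_xU$ meets each open ray from the origin of $T_xU$ in exactly one point, and it bounds a convex set containing the origin; $G_\varepsilon:TU\to\mathbb R$ is the function such that $G_\varepsilon(x,\cdot)$ is the asymmetric norm on $T_xU$ whose sphere of radius $r_U$ centered at $0$ is $(\zeta_\varepsilon\ast_vF)^{-1}(r_U)\cap T_xU$. Mollifier smoothing. Choose a locally finite covering of $M$ by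 coordinate open sets $(U_\lambda,(x^i)_\lambda)_{\lambda\in\Lambda}$, each $U_\lambda$ having compact closure contained in an open set to which the coordinate system $(x^i)_\lambda$ extends, and a smooth partition of unity $\{\varphi_\lambda\}$ subordinate to it. For each $\lambda$ put $r_{U_\lambda}=\max\{F(x,y):x\in\overline{U_\lambda},\|y\|=1\}$ and $r_{u_\lambda}=\min\{F(x,y):x\in\overline{U_\lambda},\|y\|=1\}$ (Euclidean norm in the coordinates of $U_\lambda$), and choose an increasing function $u_\lambda:(0,1)\to(0,\infty)$ with $\lim_{\varepsilon\to0}u_\lambda(\varepsilon)=0$ and a number $\tau_\lambda\in\left(0,\frac{r_{u_\lambda}}{16nr_{U_\lambda}}\right)$ such that $u_\lambda(\varepsilon)\in\left(0,\frac{r_{u_\lambda}}{16nr_{U_\lambda}}\right)$ for all $\varepsilon\in(0,\tau_\lambda)$. Let $G_{\varepsilon,\lambda}:TU_\lambda\to\mathbb R$, $\varepsilon\in(0,\tau_\lambda)$, be the function $G_\varepsilon$ given by the local vertical smoothing with $U=U_\lambda$, $u=u_\lambda$, $\tau=\tau_\lambda$. Let $V_\lambda=\mathrm{int}(\mathrm{supp}\,\varphi_\lambda)$, $\nu_\lambda=\mathrm{dist}_{\mathbb R^n}(\partial V_\lambda,\partial U_\lambda)$ (in the coordinates of $U_\lambda$), $\delta_\lambda=\min\{\tau_\lambda,\nu_\lambda\}$, $\psi_\lambda(\varepsilon)=\varepsilon\delta_\lambda$ for $\varepsilon\in(0,1)$. Define $F_{\varepsilon,\lambda}\geq 0$ by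 $F_{\varepsilon,\lambda}^2(x,y)=\int\eta_{\psi_\lambda(\varepsilon)}(x-z)\,G^2_{\psi_\lambda(\varepsilon),\lambda}(z,y)\,dz$ for $(x,y)\in TO_{\varepsilon,\lambda}$, where $O_{\varepsilon,\lambda}\subset U_\lambda$ is an open set containing $\overline{V_\lambda}$ on which this is well defined. A mollifier smoothing of $F$ is a family $F_\varepsilon:TM\to[0,\infty)$, $\varepsilon\in(0,1)$, obtained in this way by $F_\varepsilon^2(x,y)=\sum_{\lambda\in\Lambda}\varphi_\lambda(x)F^2_{\varepsilon,\lambda}(x,y)$ (terms with $\varphi_\lambda(x)=0$ being $0$). *)

(* Defs.v *)
From HB Require Import structures.
From mathcomp Require Import all_boot all_order all_algebra.
From mathcomp Require Import all_classical all_reals all_analysis.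

Set Implicit Arguments.
Unset Strict Implicit.
Unset Printing Implicit Defensive.

Import Order.TTheory GRing.Theory Num.Theory.
Import numFieldNormedType.Exports.

Local Open Scope classical_set_scope.
Local Open Scope ring_scope.

Section Smooth.
Context {R : realType} {V W : normedModType R}.

(* For [D] open in a finite-dimensional [V], [Ck k D f] says that [f] is C^k
   on [D]: the derivatives along all vectors, not only those of a basis, are
   required, which makes the definition independent of coordinates. *)
Fixpoint Ck (k : nat) (D : set V) (f : V -> W) : Prop :=
  match k with
  | 0 => forall x, D x -> {for x, continuous f}
  | k'.+1 => forall v, (forall x, D x -> derivable f x v) /\ Ck k' D ('D_v f)
  end.

Definition smooth_on (D : set V) (f : V -> W) : Prop := forall k, Ck k D f.

End Smooth.

Section Charts.
Context {R : realType} {n : nat} {M : topologicalType}.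

(* [coord] is a homeomorphism from the open set [dom] onto an open set of
   R^n, with inverse [param]; the values of [coord] off [dom] and of [param]
   off [coord @` dom] are irrelevant. *)
Record chart := Chart {
  dom : set M;
  coord : M -> 'rV[R]_n;
  param : 'rV[R]_n -> M;
  dom_open : open dom;
  coord_open : open (coord @` dom);
  coordK : forall x, dom x -> param (coord x) = x;
  coord_continuous : {within dom, continuous coord};
  param_continuous : {within coord @` dom, continuous param} }.

Definition transition (c d : chart) : 'rV[R]_n -> 'rV[R]_n :=
  coord d \o param c.

Definition compatible (c d : chart) : Prop :=
  smooth_on (coord c @` (dom c `&` dom d)) (transition c d) /\
  smooth_on (coord d @` (dom c `&` dom d)) (transition d c).

End Charts.
Arguments chart : clear implicits.

Record smooth_manifold (R : realType) (n : nat) := SmoothManifold {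
  points :> topologicalType;
  points_hausdorff : hausdorff_space points;
  points_second_countable : @second_countable points;
  atlas : set (chart R n points);
  atlas_cover : forall x, exists2 c, atlas c & dom c x;
  atlas_compatible : forall c d, atlas c -> atlas d -> compatible c d;
  atlas_maximal : forall c, (forall d, atlas d -> compatible c d) -> atlas c }.

Definition smooth_function (R : realType) (n : nat) (M : smooth_manifold R n)
    (f : M -> R) : Prop :=
  forall c, @atlas R n M c -> smooth_on (coord c @` dom c) (f \o param c).

(* A fixed choice of a chart around each point.  The tangent space at [x] is
   R^n, a tangent vector being represented by its components in the chart
   [chart_at x]; its components in any other chart are obtained by applying
   the differential of the transition map. *)
Definition chart_at (R : realType) (n : nat) (M : smooth_manifold R n)
    (x : M) : chart R n M :=
  projT1 (cid2 (@atlas_cover R n M x)).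

Record tangent_bundle (R : realType) (n : nat) (M : smooth_manifold R n) :=
  Tangent { base : M; vec : 'rV[R]_n }.
Arguments Tangent {R n M}.

HB.instance Definition _ (R : realType) (n : nat) (M : smooth_manifold R n) :=
  gen_eqMixin (tangent_bundle M).
HB.instance Definition _ (R : realType) (n : nat) (M : smooth_manifold R n) :=
  gen_choiceMixin (tangent_bundle M).

Section TangentBundle.
Context {R : realType} {n : nat} {M : smooth_manifold R n}.

(* Natural coordinates (x, y) on TM associated with the chart [c]. *)
Definition tcoord (c : chart R n M) (p : tangent_bundle M) :
    'rV[R]_n * 'rV[R]_n :=
  let d := chart_at (base p) in
  (coord c (base p), 'd (transition d c) (coord d (base p)) (vec p)).

(* The inverse of [tcoord c]. *)
Definition tparam (c : chart R n M) (q : 'rV[R]_n * 'rV[R]_n) :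
    tangent_bundle M :=
  let x := param c q.1 in
  Tangent x ('d (transition c (chart_at x)) (q.1) (q.2)).

Definition tdom (c : chart R n M) : set ('rV[R]_n * 'rV[R]_n) :=
  [set q | (coord c @` dom c) q.1].

(* The topology of TM, for which the [tcoord c] are homeomorphisms from
   the tangent bundle of [dom c] onto [tdom c]. *)
Definition topen (W : set (tangent_bundle M)) : Prop :=
  forall c, @atlas R n M c -> open (tdom c `&` tparam c @^-1` W).

Lemma tdom_open (c : chart R n M) : open (tdom c).
Proof.
apply: (@open_comp _ _ fst (coord c @` dom c)); last exact: coord_open.
by move=> q _; exact: cvg_fst.
Qed.

Lemma topenT : topen setT.
Proof. by move=> c _; rewrite preimage_setT setIT; exact: tdom_open. Qed.

Lemma topenI : setI_closed topen.
Proof.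
move=> A B oA oB c Ac; rewrite preimage_setI setIIr.
by apply: openI; [exact: oA|exact: oB].
Qed.

Lemma topen_bigU (I : Type) (f : I -> set (tangent_bundle M)) :
  (forall i, topen (f i)) -> topen (\bigcup_i f i).
Proof.
move=> fo c Ac; rewrite preimage_bigcup setI_bigcupr.
by apply: bigcup_open => i _; exact: fo.
Qed.

HB.instance Definition _ := @isOpenTopological.Build (tangent_bundle M)
  topen topenT topenI topen_bigU.

End TangentBundle.

Section Norms.
Context {R : realType}.

Definition asymmetric_norm (V : lmodType R) (N : V -> R) : Prop :=
  [/\ forall y, 0 <= N y,
      forall y, N y = 0 -> y = 0,
      forall (mu : R) y, 0 <= mu -> N (mu *: y) = mu * N y
    & forall y z, N (y + z) <= N y + N z].

Definition hessian (n : nat) (f : 'rV[R]_n -> R) (y : 'rV[R]_n) : 'M[R]_n :=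
  \matrix_(i, j)
    'D_(delta_mx 0 i : 'rV[R]_n) ('D_(delta_mx 0 j : 'rV[R]_n) f) y.

(* Symmetry is not repeated here: it is automatic for the Hessians to which
   this is applied. *)
Definition positive_definite (n : nat) (A : 'M[R]_n) : Prop :=
  forall v : 'rV[R]_n, v != 0 -> 0 < (v *m A *m v^T) 0 0.

Definition minkowski_norm (n : nat) (N : 'rV[R]_n -> R) : Prop :=
  [/\ smooth_on (~` [set 0]) N,
      forall (mu : R) y, 0 < mu -> N (mu *: y) = mu * N y
    & forall y, y != 0 ->
        positive_definite (2^-1 *: hessian (fun y => N y ^+ 2) y)].

End Norms.

Section Finsler.
Context {R : realType} {n : nat} {M : smooth_manifold R n}.
Implicit Type F : tangent_bundle M -> R.

Definition C0_Finsler F : Prop :=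
  continuous F /\ forall x : M, asymmetric_norm (fun v => F (Tangent x v)).

Definition Finsler F : Prop :=
  (forall c, @atlas R n M c ->
     smooth_on (tdom c `&` [set q | q.2 != 0]) (F \o tparam c)) /\
  forall x : M, minkowski_norm (fun v => F (Tangent x v)).

End Finsler.

Section SigmaFiniteProduct.
Context {R : realType} {d1 d2 : measure_display}.
Context {T1 : measurableType d1} {T2 : measurableType d2}.
Variables (m1 : {sigma_finite_measure set T1 -> \bar R})
          (m2 : {sigma_finite_measure set T2 -> \bar R}).

(* [m1 \x m2]; the alias carries the instance for sigma-finite factors, which
   inference does not find on the product measure of the library. *)
Definition prod_measure : set (T1 * T2) -> \bar R := (m1 \x m2)%E.
HB.instance Definition _ := Measure.on prod_measure.

Let prod_measure_sigma_finite : sigma_finite setT prod_measure.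
Proof.
have /sigma_finiteP[A [TA ndA Aoo]] := sigma_finiteT m1.
have /sigma_finiteP[B [TB ndB Boo]] := sigma_finiteT m2.
exists (fun n => A n `*` B n).
  rewrite -setXTT TA TB predeqE => -[x y]; split.
    move=> [/= [n _ Anx] [k _ Bky]]; exists (maxn n k) => //; split.
    - by move: x Anx; exact/subsetPset/ndA/leq_maxl.
    - by move: y Bky; exact/subsetPset/ndB/leq_maxr.
  by move=> [n _ [/= ? ?]]; split; exists n.
move=> k; have [? ?] := Aoo k; have [? ?] := Boo k.
split; first exact: measurableX.
by rewrite /prod_measure product_measure1E// lte_mul_pinfty// ge0_fin_numE.
Qed.

HB.instance Definition _ :=
  Measure_isSigmaFinite.Build _ _ _ prod_measure prod_measure_sigma_finite.

End SigmaFiniteProduct.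
(* Lebesgue measure on R^n as an iterated product of Lebesgue measure on R;
   [to_row] identifies the carrier R * (R * ... ) with row vectors. *)
Record euclidean_measure (R : realType) (n : nat) := EuclideanMeasure {
  em_disp : measure_display;
  em_carrier : measurableType em_disp;
  em_measure : {sigma_finite_measure set em_carrier -> \bar R};
  to_row : em_carrier -> 'rV[R]_n }.

Fixpoint lebesgue_Rn (R : realType) (n : nat) : euclidean_measure R n :=
  match n with
  | 0 => @EuclideanMeasure R 0 _ unit (dirac tt) (fun=> 0)
  | m.+1 =>
      let E := lebesgue_Rn R m in
      EuclideanMeasure (prod_measure (@lebesgue_measure R) (em_measure E))
        (fun t : measurableTypeR R * em_carrier E =>
           row_mx (t.1)%:M (to_row t.2) : 'rV[R]_(1 + m))
  end.

Section Mollifier.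
Context {R : realType} {n : nat}.

Definition integral_Rn (f : 'rV[R]_n -> R) : R :=
  (\int[em_measure (lebesgue_Rn R n)]_t f (to_row t))%R.

(* The norm [`|x|] of the library on ['rV[R]_n] is the sup norm. *)
Definition enorm (x : 'rV[R]_n) : R := Num.sqrt (\sum_i x 0 i ^+ 2).

Definition bump (x : 'rV[R]_n) : R :=
  if enorm x < 1 then expR ((enorm x ^+ 2 - 1)^-1) else 0.

Definition eta (x : 'rV[R]_n) : R := (integral_Rn bump)^-1 * bump x.

Definition eta_scaled (e : R) (x : 'rV[R]_n) : R :=
  (e ^+ n)^-1 * eta (e^-1 *: x).

End Mollifier.

Section VerticalSmoothing.
Context {R : realType} {n : nat} {M : smooth_manifold R n}.
Variables (F : tangent_bundle M -> R) (c : chart R n M) (U : set M).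

Definition unit_sphere_values : set R :=
  [set r | exists x y,
     [/\ closure U x, enorm y = 1 & r = F (tparam c (coord c x, y))]].

(* The supremum and the infimum are attained when [closure U] is a nonempty
   compact subset of [dom c] and [0 < n]. *)
Definition r_max : R := sup unit_sphere_values.
Definition r_min : R := inf unit_sphere_values.

Variable u : R -> R.

Definition zeta (e : R) (z : 'rV[R]_n) : R :=
  (1 - u e) * eta_scaled e z + u e * eta_scaled (2 * r_max / r_min) z.

Definition vconv (e : R) (x y : 'rV[R]_n) : R :=
  integral_Rn (fun z => zeta e z * F (tparam c (x, y - z))).

(* The asymmetric norm whose sphere of radius [r_max] is the level set of
   [vconv e x] at [r_max]; it is meaningful for [x] in [coord c @` U]. *)
Definition vsmooth (e : R) (x : 'rV[R]_n) : 'rV[R]_n -> R :=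
  get [set N : 'rV[R]_n -> R | asymmetric_norm N /\
         [set y | N y = r_max] = [set y | vconv e x y = r_max]].

Definition vertical_parameters (tau : R) : Prop :=
  let b := r_min / (16 * n%:R * r_max) in
  [/\ forall e, 0 < e < 1 -> 0 < u e,
      forall e e', 0 < e -> e <= e' -> e' < 1 -> u e <= u e',
      u e @[e --> 0^'+] --> (0 : R),
      0 < tau < b
    & forall e, 0 < e < tau -> 0 < u e < b].

End VerticalSmoothing.

Definition supp (R : realType) (T : topologicalType) (f : T -> R) : set T :=
  closure [set x | f x != 0].

Definition boundary (T : topologicalType) (A : set T) : set T :=
  closure A `\` interior A.

(* [+oo] when one of the sets is empty. *)
Definition euclidean_dist (R : realType) (n : nat) (A B : set 'rV[R]_n) : \bar R :=
  ereal_inf [set r | exists a b, [/\ A a, B b & r = (enorm (a - b))%:E]].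

(* The choices on which a mollifier smoothing depends.  [chart_of l] is the
   coordinate system of [U l], extended to the open set [dom (chart_of l)]. *)
Record smoothing_data (R : realType) (n : nat) (M : smooth_manifold R n)
    (F : tangent_bundle M -> R) := SmoothingData {
  indices : choiceType;
  chart_of : indices -> chart R n M;
  U : indices -> set M;
  phi : indices -> M -> R;
  u : indices -> R -> R;
  tau : indices -> R;
  chart_of_atlas : forall l, @atlas R n M (chart_of l);
  U_open : forall l, open (U l);
  U_compact : forall l, compact (closure (U l));
  U_dom : forall l, closure (U l) `<=` dom (chart_of l);
  U_cover : forall x, exists l, U l x;
  U_locally_finite : forall x : M, exists2 W : set M, nbhs x W &
    finite_set [set l | U l `&` W !=set0];
  phi_smooth : forall l, smooth_function (phi l);
  phi_ge0 : forall l x, 0 <= phi l x;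
  phi_support : forall l, supp (phi l) `<=` U l;
  phi_sum : forall x, \sum_(l \in [set: indices]) phi l x = 1;
  u_tau : forall l, vertical_parameters F (chart_of l) (U l) (u l) (tau l) }.

Section MollifierSmoothing.
Context {R : realType} {n : nat} {M : smooth_manifold R n}.
Context {F : tangent_bundle M -> R} (S : smoothing_data F).
Implicit Types (l : indices S) (e : R).

Definition V l : set M := interior (supp (phi l)).

Definition nu l : \bar R :=
  euclidean_dist (coord (chart_of l) @` boundary (V l))
        (coord (chart_of l) @` boundary (U l)).

Definition delta l : R := fine (Order.min (tau l)%:E (nu l)).

Definition psi l e : R := e * delta l.

(* [F_{e,l}] in the coordinates of [U l].  For [x] in the closure of the image
   of [V l] the first factor vanishes unless [z] is in the image of [U l]. *)
Definition local_smoothing l e (x y : 'rV[R]_n) : R :=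
  Num.sqrt (integral_Rn (fun z => eta_scaled (psi l e) (x - z) *
    vsmooth F (chart_of l) (U l) (u l) (psi l e) z y ^+ 2)).

Definition mollifier_smoothing e (p : tangent_bundle M) : R :=
  Num.sqrt (\sum_(l \in [set: indices S]) phi l (base p) *
    local_smoothing l e (tcoord (chart_of l) p).1
                        (tcoord (chart_of l) p).2 ^+ 2).

End MollifierSmoothing.

(* Main.v *)
(* In a chart, [F] is a continuous family [N (x, .)] of asymmetric norms.  Its
   vertical average against zeta is smooth and convex in [y], stays within
   [kappa] of [N], and has a positive second derivative at every point where
   the kernel is positive; thanks to the summand of radius [2 r_max / r_min] this
   includes the whole level set at [r_max].  By the implicit function theorem the
   gauge [G] of that level set is smooth off zero with derivatives in [y] that are
   continuous in [(x, y)], its square has a positive definite Hessian, and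
   [G / N] is close to 1 when [kappa / r_max] is small.  The horizontal average of
   [G ^ 2] transfers the derivatives in [x] to the mollifier, so that it is smooth
   in both variables, and it keeps the positivity of the Hessian.  Finally
   [F_e ^ 2] is a locally finite sum of such functions with nonnegative weights of
   sum 1, whence both statements. *)
Require Import Defs.
From mathcomp Require Import all_boot all_order all_algebra.
From mathcomp Require Import all_classical all_reals all_analysis.
From mathcomp Require Import measurable_realfun ring lra.

Set Implicit Arguments.
Unset Strict Implicit.
Unset Printing Implicit Defensive.

Import Order.TTheory GRing.Theory Num.Theory.
Import numFieldNormedType.Exports.

Local Open Scope classical_set_scope.
Local Open Scope ring_scope.


(** * Directional derivatives *)

(** The obstacle is that [F] is merely continuous. Derivatives in [y] can be put on the vertical
    kernel, but derivatives in [x] do not exist before the horizontal average, so the gauge of the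
    level set must be handled with vertical derivatives only, jointly continuous in (x, y).
    [Ck_along] records exactly this, and the chain rule and the implicit function argument are
    proved for directions that need not span the space. The other difficulty is strict convexity: an
    asymmetric norm may be linear on open cones. Its one certain kink is at the origin, where N (t
    v) + N (- t v) > 0. After the reflection z -> y - z the kernel weighs the origin by its value at
    [y], which is why positivity of the kernel on the level set matters. That set lies where N < 2 *
    rU, hence in the Euclidean ball of radius 2 * rU / ru: this is the origin of the second radius.
    Beyond the vertical step everything is done for squares, which average and add linearly; the
    root is taken last, where the sum is positive for smoothness, and by an estimate uniform up to
    the zero section for convergence. *)

Section DirectionalDerivatives.
Context {R : realType} {V : normedModType R}.
Implicit Types (f g : V -> R) (p x v : V).

Lemma continuous_forP (W : normedModType R) (f : V -> W) x :
  {for x, continuous f} <->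
  forall e : R, 0 < e -> exists2 d : R, 0 < d &
    forall y, `|y - x| < d -> `|f y - f x| < e.
Proof.
split => [fx e e0|fx].
  have /cvgrPdist_lt/(_ _ e0) := fx.
  move=> /nbhs_ballP[d /= d0 dP]; exists d => // y yx.
  by rewrite distrC; apply: dP; rewrite -ball_normE /= distrC.
apply/cvgrPdist_lt => e /fx[d d0 dP]; apply/nbhs_ballP; exists d => //= y.
by rewrite -ball_normE /= distrC => /dP; rewrite distrC.
Qed.

Lemma open_normP (D : set V) : open D ->
  forall x, D x -> exists2 d : R, 0 < d & forall y, `|y - x| < d -> D y.
Proof.
move=> oD x Dx; have /nbhs_ballP[d /= d0 dP] : nbhs x D by exact: open_nbhs_nbhs.
by exists d => // y yx; apply: dP; rewrite -ball_normE /= distrC.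
Qed.

(** Stated without a quotient: [h = 0] is allowed, and increments can be added and composed
    directly. *)
Lemma is_deriveP f x v (l : R) : is_derive x v f l <->
  forall e : R, 0 < e -> exists2 d : R, 0 < d &
    forall h : R, `|h| < d -> `|f (h *: v + x) - f x - h * l| <= e * `|h|.
Proof.
split => [[fl <-] e e0|H].
  have /cvgrPdist_le/(_ _ e0) := fl.
  rewrite near_withinE /= => /nbhs_ballP[d /= d0 dP]; exists d => // h hd.
  have [->|h0] := eqVneq h 0.
    by rewrite scale0r add0r mul0r !subrr normr0 mulr0.
  have := dP h; rewrite -ball_normE /= sub0r normrN => /(_ hd h0).
  rewrite -/(derive f x v) -[h^-1 *: _]/(h^-1 * _) => le.
  have -> : f (h *: v + x) - f x - h * 'D_v f x =
     - (h * ('D_v f x - h^-1 * (f (h *: v + x) - f x))).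
    by field.
  by rewrite normrN normrM mulrC ler_wpM2r.
have cv : h^-1 *: ((f \o shift x) (h *: v) - f x) @[h --> 0^'] --> l.
  apply/cvgrPdist_le => e /H[d d0 dP]; rewrite near_withinE /=.
  apply/nbhs_ballP; exists d => //= h; rewrite -ball_normE /= sub0r normrN => hd h0.
  have := dP _ hd => le; rewrite -[h^-1 *: _]/(h^-1 * _).
  have -> : l - h^-1 * (f (h *: v + x) - f x) =
     - (h^-1 * (f (h *: v + x) - f x - h * l)).
    by field.
  by rewrite normrN normrM normfV mulrC ler_pdivrMr ?normr_gt0.
by split; [apply/cvg_ex; exists l|exact/cvg_lim].
Qed.

End DirectionalDerivatives.

Section MeanValue.
Context {R : realType} {V : normedModType R}.
Implicit Types (f : V -> R) (p x v : V).

(** Parametrising the segment by [s * t] with [s] in [0, 1] covers every sign of [t], zero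
    included. *)
Lemma mean_value_line f p v (t : R) :
  (forall s : R, 0 <= s <= 1 -> derivable f ((s * t) *: v + p) v) ->
  exists2 s : R, 0 <= s <= 1 & f (t *: v + p) - f p = t * 'D_v f ((s * t) *: v + p).
Proof.
move=> df; pose g (s : R) := f ((s * t) *: v + p).
have dg (s : R) : 0 <= s <= 1 -> is_derive s 1 g (t * 'D_v f ((s * t) *: v + p)).
  move=> /df/derivableP/is_deriveP H; apply/is_deriveP => e e0.
  have t1 : 0 < `|t| + 1 by rewrite ltr_wpDl.
  have [d d0 dP] := H (e / (`|t| + 1)) (divr_gt0 e0 t1).
  exists (d / (`|t| + 1)); first exact: divr_gt0.
  move=> h; rewrite ltr_pdivlMr// => hd.
  have ht : `|h * t| < d.
    by rewrite normrM; apply: le_lt_trans hd; rewrite ler_wpM2l ?lerDl.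
  have E : ((h + s) * t) *: v + p = (h * t) *: v + ((s * t) *: v + p).
    by rewrite mulrDl scalerDl addrA.
  rewrite /g [h%:A]mulr1 E mulrA; apply: le_trans (dP _ ht) _.
  rewrite normrM mulrCA mulrC ler_wpM2r//.
  by rewrite mulrAC ler_pdivrMr// ler_pM2l// lerDl.
have gc : {within `[0, 1], continuous g}.
  by apply: derivable_within_continuous => s /[!in_itv]/= /dg[].
have dg' (s : R) : s \in `]0, 1[ -> is_derive s 1 g (t * 'D_v f ((s * t) *: v + p)).
  by rewrite in_itv/= => /andP[s0 s1]; apply: dg; rewrite !ltW.
have [s] := @MVT_segment R g (fun s => t * 'D_v f ((s * t) *: v + p)) 0 1 ler01 dg' gc.
rewrite in_itv /= /g => s01; rewrite mul1r mul0r scale0r add0r subr0 mulr1.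
by exists s.
Qed.

(** The increment is made one direction at a time; on each piece the mean value theorem gives a
    derivative at a nearby point, compared with the one at [p] by continuity. The [a i] need not
    span [V], so the estimate applies when only vertical derivatives exist. *)
Lemma increment_estimate (I : finType) (a : I -> V) (D : set V) f p :
  open D -> D p ->
  (forall i x, D x -> derivable f x (a i)) ->
  (forall i, {for p, continuous ('D_(a i) f)}) ->
  forall e : R, 0 < e -> exists2 d : R, 0 < d & forall t : I -> R,
    (forall i, `|t i| < d) ->
    `|f (\sum_i t i *: a i + p) - f p - \sum_i t i * 'D_(a i) f p|
      <= e * \sum_i `|t i|.
Proof.
move=> oD Dp df cf e e0; elim: (index_enum I) => [|i s [d d0 dP]].
  exists 1 => // t _; rewrite !big_nil add0r !subrr normr0 mulr0 //.
have [r1 r10 r1P] := open_normP oD Dp.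
have [r2 r20 r2P] := (continuous_forP _ _).1 (cf i) e e0.
(* [C] exceeds the total length of the directions treated so far, so coefficients of size at most
   [r / C] keep all intermediate points within [r] of [p]. *)
pose C := 1 + (`|a i| + \sum_(j <- s) `|a j|).
have C0 : 0 < C by rewrite /C ltr_wpDr// addr_ge0// sumr_ge0.
pose r := Order.min r1 r2; have r0 : 0 < r by rewrite lt_min r10.
have rr1 : r <= r1 by rewrite ge_min lexx.
have rr2 : r <= r2 by rewrite ge_min lexx orbT.
exists (Order.min d (r / C)); first by rewrite lt_min d0 divr_gt0.
move=> t ht; set S := \sum_(j <- s) t j *: a j.
have htd j : `|t j| < d by move: (ht j); rewrite lt_min => /andP[].
have htr j : `|t j| <= r / C.
  by apply: ltW; move: (ht j); rewrite lt_min => /andP[].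
have small (u : R) : 0 <= u <= 1 -> `|(u * t i) *: a i + (S + p) - p| < r.
  move=> /andP[u0 u1]; rewrite addrA addrK.
  apply: (@le_lt_trans _ _ (r / C * (`|a i| + \sum_(j <- s) `|a j|))).
    rewrite mulrDr (le_trans (ler_normD _ _))// lerD//.
      rewrite normrZ ler_wpM2r// normrM (ger0_norm u0).
      by rewrite (le_trans _ (htr i))// ler_piMl.
    rewrite /S (le_trans (ler_norm_sum _ _ _))// mulr_sumr ler_sum// => j _.
    by rewrite normrZ ler_wpM2r.
  by rewrite mulrAC -mulrA -ltr_pdivlMl// mulVf ?gt_eqF// ltr_pdivrMr// mul1r /C ltrDr.
have [u u01 uE] := @mean_value_line f (S + p) (a i) (t i)
  (fun u u01 => df i _ (r1P _ (lt_le_trans (small u u01) rr1))).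
rewrite !big_cons -/S -(addrA (t i *: a i) S p).
have -> : f (t i *: a i + (S + p)) - f p -
    (t i * 'D_(a i) f p + \sum_(j <- s) t j * 'D_(a j) f p) =
  (f (t i *: a i + (S + p)) - f (S + p) - t i * 'D_(a i) f p) +
  (f (S + p) - f p - \sum_(j <- s) t j * 'D_(a j) f p) by ring.
rewrite (le_trans (ler_normD _ _))// mulrDr lerD ?dP//.
rewrite uE -mulrBr normrM mulrC ler_wpM2r// ltW// r2P//.
exact: lt_le_trans (small u u01) rr2.
Qed.

End MeanValue.

Section ChainRule.
Context {R : realType} {V W : normedModType R}.

(** Nothing is known of [f] outside the directions [a i]; it is enough that, on the line through [x]
    along [v], the map [T] moves by combinations of these vectors. *)
Lemma is_derive_chain (I : finType) (a : I -> W) (D : set W) (f : W -> R)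
    (T : V -> W) (c : I -> V -> R) (x v : V) :
  open D -> D (T x) ->
  (forall i y, D y -> derivable f y (a i)) ->
  (forall i, {for T x, continuous ('D_(a i) f)}) ->
  (forall i, derivable (c i) x v) ->
  (\forall h \near (0:R), T (h *: v + x) =
     \sum_i (c i (h *: v + x) - c i x) *: a i + T x) ->
  is_derive x v (f \o T) (\sum_i 'D_v (c i) x * 'D_(a i) f (T x)).
Proof.
move=> oD DT df cf dc TE; apply/is_deriveP => e e0.
pose M := 1 + \sum_i (`|'D_v (c i) x| + 1).
have M0 : 0 < M by rewrite /M ltr_wpDr// sumr_ge0// => i _; rewrite addr_ge0.
pose N := 1 + \sum_i `|'D_(a i) f (T x)|.
have N0 : 0 < N by rewrite /N ltr_wpDr// sumr_ge0.
have [d d0 dP] := increment_estimate oD DT df cf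
  (divr_gt0 (divr_gt0 e0 (@ltr0n R 2)) M0).
(* The bound 1 makes the coefficient increments at most linear in [h]; the bound [e / 2 / N]
   controls their linearisation error after multiplication by the derivatives of [f]. *)
pose e2 := Order.min 1 (e / 2 / N).
have e20 : 0 < e2 by rewrite lt_min ltr01 !divr_gt0.
have [d2 d20 d2P] : exists2 d2, 0 < d2 & forall h : R, `|h| < d2 ->
  (forall i, `|c i (h *: v + x) - c i x - h * 'D_v (c i) x| <= e2 * `|h|) /\
   T (h *: v + x) = \sum_i (c i (h *: v + x) - c i x) *: a i + T x.
  have: \forall h \near (0:R), (forall i,
     `|c i (h *: v + x) - c i x - h * 'D_v (c i) x| <= e2 * `|h|) /\
     T (h *: v + x) = \sum_i (c i (h *: v + x) - c i x) *: a i + T x.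
    near=> h; split; last by near: h.
    near: h; apply: filter_forall => i.
    have [d' d'0 d'P] := (is_deriveP _ _ _ _).1 (derivableP (dc i)) e2 e20.
    apply/nbhs_ballP; exists d' => //= h; rewrite -ball_normE /= sub0r normrN.
    exact: d'P.
  move=> /nbhs_ballP[d' /= d'0 d'P]; exists d' => // h hd.
  by apply: d'P; rewrite -ball_normE /= sub0r normrN.
exists (Order.min d2 (d / M)); first by rewrite lt_min d20 divr_gt0.
move=> h; rewrite lt_min => /andP[/d2P[hc hT]].
rewrite ltr_pdivlMr// => hd.
pose t i := c i (h *: v + x) - c i x.
have tle i : `|t i| <= (`|'D_v (c i) x| + 1) * `|h|.
  rewrite -[t i](subrK (h * 'D_v (c i) x)) (le_trans (ler_normD _ _))//.
  rewrite mulrDl addrC normrM [_ * `|h|]mulrC lerD2l (le_trans (hc i))//.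
  by rewrite ler_wpM2r// ge_min lexx.
have td i : `|t i| < d.
  apply: le_lt_trans (tle i) _; apply: le_lt_trans hd.
  rewrite mulrC ler_wpM2l// /M (bigD1 i)//= addrCA lerDl addr_ge0// sumr_ge0//.
have := dP t td; rewrite -hT => le.
have -> : (f \o T) (h *: v + x) - (f \o T) x -
    h * (\sum_i 'D_v (c i) x * 'D_(a i) f (T x)) =
  (f (T (h *: v + x)) - f (T x) - \sum_i t i * 'D_(a i) f (T x)) +
  \sum_i (t i - h * 'D_v (c i) x) * 'D_(a i) f (T x).
  have -> : \sum_i (t i - h * 'D_v (c i) x) * 'D_(a i) f (T x) =
    \sum_i t i * 'D_(a i) f (T x) - h * \sum_i 'D_v (c i) x * 'D_(a i) f (T x).
    rewrite mulr_sumr -sumrB; apply: eq_bigr => i _; ring.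
  by rewrite /=; ring.
rewrite (le_trans (ler_normD _ _))// [leRHS](_ : _ = e / 2 * `|h| + e / 2 * `|h|); last field.
rewrite lerD//.
  set E := e / 2 in le *; have E0 : 0 < E by rewrite divr_gt0.
  rewrite (le_trans le)// -mulrA ler_pM2l// ler_pdivrMl//.
  rewrite (@le_trans _ _ (\sum_i (`|'D_v (c i) x| + 1) * `|h|))//.
    by apply: ler_sum => i _; exact: tle.
  by rewrite -mulr_suml ler_wpM2r// /M lerDr.
rewrite (le_trans (ler_norm_sum _ _ _))//.
rewrite (@le_trans _ _ (\sum_i (e / 2 / N * `|h|) * `|'D_(a i) f (T x)|))//.
  apply: ler_sum => i _; rewrite normrM ler_wpM2r// (le_trans (hc i))//.
  by rewrite ler_wpM2r// ge_min lexx orbT.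
rewrite -mulr_sumr mulrAC ler_wpM2r// mulrAC ler_pdivrMr// ler_pM2l ?divr_gt0//.
by rewrite /N lerDr.
Unshelve. all: by end_near. Qed.

End ChainRule.

(** * Calculus of functions that are C^k along a set of directions *)

Section CkAlong.
Context {R : realType} {V : normedModType R}.
Implicit Types (E D : set V) (f g : V -> R) (x v : V).

(* The variant of [Ck] in which only the directions in [E] are used; every
   derivative involved is required to be continuous in all variables. *)
Fixpoint Ck_along E (k : nat) D f : Prop :=
  (forall x, D x -> {for x, continuous f}) /\
  if k is k'.+1 then
    forall v, E v -> (forall x, D x -> derivable f x v) /\ Ck_along E k' D ('D_v f)
  else True.

Lemma Ck_along_continuous E k D f :
  Ck_along E k D f -> forall x, D x -> {for x, continuous f}.
Proof. by case: k => [|k] []. Qed.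

Lemma Ck_along_derivable E k D f v : Ck_along E k.+1 D f -> E v ->
  forall x, D x -> is_derive x v f ('D_v f x).
Proof. by move=> [_ H] /H[df _] x /df /derivableP. Qed.

Lemma Ck_along_derive E k D f v : Ck_along E k.+1 D f -> E v ->
  Ck_along E k D ('D_v f).
Proof. by move=> [_ H] /H[]. Qed.

Lemma Ck_along_sub E D E' D' k f : E' `<=` E -> D' `<=` D ->
  Ck_along E k D f -> Ck_along E' k D' f.
Proof.
move=> EE DD; elim: k f => [|k IH] f [cf H]; split => //.
- by move=> x /DD /cf.
- by move=> x /DD /cf.
- by move=> v /EE /H[df Cf]; split; [move=> x /DD /df|exact: IH].
Qed.

Lemma Ck_along_pred E D k f : Ck_along E k.+1 D f -> Ck_along E k D f.
Proof.
elim: k f => [|k IH] f; first by move=> [].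
move=> [cf H]; split=> // v /H[df Cf]; split => //; exact: IH.
Qed.

(** All conditions in [Ck_along] are pointwise conditions on [f] and its iterated derivatives, so
    they can be checked on a different set around each point. *)
Lemma Ck_along_local E D k f :
  (forall x, D x -> exists2 D', D' x & Ck_along E k D' f) -> Ck_along E k D f.
Proof.
elim: k f => [|k IH] f H; split => //.
- by move=> x /H[D' D'x /Ck_along_continuous]; apply.
- by move=> x /H[D' D'x /Ck_along_continuous]; apply.
- move=> v Ev; split; first by move=> x /H[D' D'x [_ /(_ v Ev)[+ _]]]; apply.
  by apply: IH => x /H[D' D'x [_ /(_ v Ev)[_ ?]]]; exists D'.
Qed.

Lemma Ck_along_eq E D k f g : open D -> (forall x, D x -> f x = g x) ->
  Ck_along E k D f -> Ck_along E k D g.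
Proof.
move=> oD; have nD x : D x -> \forall y \near x, D y by move=> ?; exact: open_nbhs_nbhs.
elim: k f g => [|k IH] f g fg.
  move=> [cf _]; split => // x Dx; suff: g y @[y --> x] --> g x by []; rewrite -(fg x Dx).
  by apply: cvg_trans (cf _ Dx); apply: near_eq_cvg; near=> y; apply: fg; near: y; exact: nD.
move=> [cf H]; split.
  move=> x Dx; suff: g y @[y --> x] --> g x by []; rewrite -(fg x Dx).
  by apply: cvg_trans (cf _ Dx); apply: near_eq_cvg; near=> y; apply: fg; near: y; exact: nD.
have nfg x : D x -> \forall y \near x, f y = g y.
  by move=> Dx; near=> y; apply: fg; near: y; exact: nD.
move=> v /H[df Cf]; split.
  by move=> x Dx; apply: near_eq_derivable (df _ Dx); exact: nfg.
by apply: IH Cf => x Dx; apply: near_eq_derive; exact: nfg.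
Unshelve. all: by end_near. Qed.

Lemma Ck_alongS E D k f : open D ->
  (forall x, D x -> {for x, continuous f}) ->
  (forall v, E v -> exists2 f', (forall x, D x -> is_derive x v f (f' x)) &
                             Ck_along E k D f') ->
  Ck_along E k.+1 D f.
Proof.
move=> oD cf H; split=> // v /H[f' df Cf]; split; first by move=> x /df[].
by apply: Ck_along_eq Cf => // x /df[_ ->].
Qed.

(** This is how a merely continuous factor enters a C^k integrand: it does not move in the chosen
    directions, so its derivatives along them vanish. *)
Lemma Ck_along_invariant E D k f : open D ->
  (forall x, D x -> {for x, continuous f}) ->
  (forall v x, E v -> D x -> \forall h \near (0:R), f (h *: v + x) = f x) ->
  Ck_along E k D f.
Proof.
move=> oD cf H; elim: k f cf H => [//|k IH] f cf H.
apply: Ck_alongS => // v Ev; exists (cst 0); last first.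
  apply: IH; first by move=> x _; exact: cvg_cst.
  by move=> w x _ _; apply: filterE.
move=> x Dx; apply/is_deriveP => e e0.
have /nbhs_ballP[d /= d0 dP] := H _ _ Ev Dx.
exists d => // h hd; have -> : f (h *: v + x) = f x.
  by apply: dP; rewrite -ball_normE /= sub0r normrN.
by rewrite mulr0 subr0 subrr normr0 mulr_ge0// ltW.
Qed.

Lemma Ck_along_cst E D k (c : R) : open D -> Ck_along E k D (fun=> c).
Proof.
by move=> oD; apply: Ck_along_invariant => // [x _|w x _ _]; [exact: cvg_cst|apply: filterE].
Qed.

Lemma Ck_along_add E D k f g : open D ->
  Ck_along E k D f -> Ck_along E k D g -> Ck_along E k D (fun x => f x + g x).
Proof.
move=> oD; elim: k f g => [|k IH] f g Cf Cg.
  by split=> // x Dx; apply: cvgD; [apply: Cf.1|apply: Cg.1].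
apply: Ck_alongS => //.
  by move=> x Dx; apply: cvgD; [apply: Cf.1|apply: Cg.1].
move=> v Ev; exists (fun x => 'D_v f x + 'D_v g x); last first.
  by apply: IH; apply: Ck_along_derive Ev.
move=> x Dx; have Df := Ck_along_derivable Cf Ev Dx.
by have Dg := Ck_along_derivable Cg Ev Dx; exact: is_deriveD.
Qed.

Lemma Ck_along_mul E D k f g : open D ->
  Ck_along E k D f -> Ck_along E k D g -> Ck_along E k D (fun x => f x * g x).
Proof.
move=> oD; elim: k f g => [|k IH] f g Cf Cg.
  by split=> // x Dx; apply: cvgM; [apply: Cf.1|apply: Cg.1].
apply: Ck_alongS => //.
  by move=> x Dx; apply: cvgM; [apply: Cf.1|apply: Cg.1].
move=> v Ev; exists (fun x => f x * 'D_v g x + g x * 'D_v f x); last first.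
  by apply: Ck_along_add => //; apply: IH;
    by [exact: Ck_along_pred|exact: Ck_along_derive Ev].
move=> x Dx; have Df := Ck_along_derivable Cf Ev Dx.
by have Dg := Ck_along_derivable Cg Ev Dx; exact: is_deriveM.
Qed.

Lemma Ck_along_opp E D k f : open D ->
  Ck_along E k D f -> Ck_along E k D (fun x => - f x).
Proof.
move=> oD Cf; apply: (@Ck_along_eq _ _ _ (fun x => -1 * f x)) => //.
  by move=> x _; rewrite mulN1r.
by apply: Ck_along_mul => //; exact: Ck_along_cst.
Qed.

Lemma Ck_along_sum (I : Type) (r : seq I) E D k (F : I -> V -> R) : open D ->
  (forall i, Ck_along E k D (F i)) -> Ck_along E k D (fun x => \sum_(i <- r) F i x).
Proof.
move=> oD CF; elim: r => [|i r IH].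
  apply: (@Ck_along_eq _ _ _ (fun=> 0)) => //; last exact: Ck_along_cst.
  by move=> x _; rewrite big_nil.
apply: (@Ck_along_eq _ _ _ (fun x => F i x + \sum_(j <- r) F j x)) => //.
  by move=> x _; rewrite big_cons.
exact: Ck_along_add.
Qed.

Lemma is_derive_comp1 (phi : R -> R) f x v (a b : R) :
  is_derive (f x) 1 phi a -> is_derive x v f b ->
  is_derive x v (fun x => phi (f x)) (a * b).
Proof.
move=> Dphi Df.
have Df' : is_derive (0:R) 1 (fun h : R => f (h *: v + x)) b.
  apply/is_deriveP => e e0; have [d d0 dP] := (is_deriveP _ _ _ _).1 Df e e0.
  by exists d => // h hd; rewrite [h%:A]mulr1 addr0 scale0r add0r; exact: dP.
have Dphi' : is_derive (f (0 *: v + x)) 1 phi a by rewrite scale0r add0r.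
have /is_deriveP D := is_derive1_comp Dphi' Df'.
apply/is_deriveP => e e0; have [d d0 dP] := D e e0; exists d => // h hd.
by have := dP h hd; rewrite [h%:A]mulr1 addr0 /= scale0r add0r.
Qed.

Lemma Ck_along_inv E D k f : open D -> (forall x, D x -> f x != 0) ->
  Ck_along E k D f -> Ck_along E k D (fun x => (f x)^-1).
Proof.
move=> oD f0; elim: k => [|k IH] Cf.
  by split => // x Dx; apply: cvgV; [exact: f0|exact: Cf.1].
apply: Ck_alongS => //.
  by move=> x Dx; apply: cvgV; [exact: f0|exact: Cf.1].
move=> v Ev; exists (fun x => - ((f x)^-1 * (f x)^-1) * 'D_v f x); last first.
  apply: Ck_along_mul => //; last exact: Ck_along_derive Ev.
  by apply: Ck_along_opp => //; apply: Ck_along_mul => //; apply: IH; exact: Ck_along_pred.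
move=> x Dx; have Df := Ck_along_derivable Cf Ev Dx.
apply: (is_derive_comp1 (phi := GRing.inv)) => //.
have := @is_deriveV R id (f x) 1 1 (f0 _ Dx) (is_derive_id _ _).
by move=> /is_derive_eq; apply; rewrite /= [_%:A]mulr1 expr2 invfM.
Qed.

Lemma Ck_along_sqrt E D k f : open D -> (forall x, D x -> 0 < f x) ->
  Ck_along E k D f -> Ck_along E k D (fun x => Num.sqrt (f x)).
Proof.
move=> oD f0; elim: k => [|k IH] Cf.
  by split => // x Dx; apply: continuous_comp; [exact: Cf.1|exact: sqrt_continuous].
apply: Ck_alongS => //.
  by move=> x Dx; apply: continuous_comp; [exact: Cf.1|exact: sqrt_continuous].
move=> v Ev; exists (fun x => (2 * Num.sqrt (f x))^-1 * 'D_v f x); last first.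
  apply: Ck_along_mul => //; last exact: Ck_along_derive Ev.
  apply: Ck_along_inv => //.
    by move=> x Dx; rewrite mulf_neq0// gt_eqF// sqrtr_gt0 f0.
  apply: Ck_along_mul => //; first exact: Ck_along_cst.
  by apply: IH; exact: Ck_along_pred.
move=> x Dx; have Df := Ck_along_derivable Cf Ev Dx.
by apply: (is_derive_comp1 (phi := Num.sqrt)) => //; apply: is_derive1_sqrt; exact: f0.
Qed.

(** [Ck] asks for continuity at the last order only, [Ck_along] at every order; smoothness supplies
    the intermediate ones. *)
Lemma smooth_on_Ck_along E D k f : smooth_on D f -> Ck_along E k D f.
Proof.
elim: k f => [|k IH] f sf; split => //; try exact: (sf 0).
move=> v _; split; first by have [] := sf 1 v.
by apply: IH => m; have [] := sf m.+1 v.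
Qed.

Lemma Ck_along_smooth_on D f : (forall k, Ck_along setT k D f) -> smooth_on D f.
Proof.
move=> Cf k; elim: k f Cf => [|k IH] f Cf; first exact: (Cf 0).1.
move=> v; split; first by have [_ /(_ v I)[]] := Cf 1.
by apply: IH => m; exact: Ck_along_derive (Cf m.+1) _.
Qed.

End CkAlong.

Section CkAlongComp.
Context {R : realType} {V W : normedModType R}.

Lemma Ck_along_affine (E : set V) (E' D' : set W) (L l : V -> W) k (f : W -> R) :
  open D' -> continuous L ->
  (forall v, E v -> E' (l v)) ->
  (forall v x (h : R), E v -> L (h *: v + x) = h *: l v + L x) ->
  Ck_along E' k D' f -> Ck_along E k (L @^-1` D') (f \o L).
Proof.
move=> oD cL El LE.
have oL : open (L @^-1` D') by apply: open_comp => // x _; exact: cL.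
elim: k f => [|k IH] f Cf.
  by split => // x Dx; apply: continuous_comp; [exact: cL|exact: Cf.1].
apply: Ck_alongS => //.
  by move=> x Dx; apply: continuous_comp; [exact: cL|exact: Cf.1].
move=> v Ev; exists ('D_(l v) f \o L); last first.
  by apply: IH; exact: Ck_along_derive Cf (El _ Ev).
move=> x Dx; have /is_deriveP Df := Ck_along_derivable Cf (El _ Ev) Dx.
apply/is_deriveP => e /Df[d d0 dP]; exists d => // h /dP.
by rewrite /= LE.
Qed.

Lemma is_derive_affine (L : V -> W) (x v : V) (w : W) (f : W -> R) (y : R) :
  (forall h : R, L (h *: v + x) = h *: w + L x) ->
  is_derive (L x) w f y -> is_derive x v (f \o L) y.
Proof.
move=> LE /is_deriveP Df; apply/is_deriveP => e /Df[d d0 dP]; exists d => // h /dP.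
by rewrite /= LE.
Qed.

Lemma Ck_along_comp (I : finType) (a : I -> W) (E D : set V) (E' D' : set W) k
    (f : W -> R) (T : V -> W) (c : I -> V -> R) :
  open D -> open D' -> (forall x, D x -> D' (T x)) ->
  (forall i, E' (a i)) ->
  (forall x, D x -> {for x, continuous T}) ->
  (forall v x, E v -> D x -> \forall h \near (0:R), T (h *: v + x) =
     \sum_i (c i (h *: v + x) - c i x) *: a i + T x) ->
  (forall i, Ck_along E k D (c i)) ->
  Ck_along E' k D' f -> Ck_along E k D (f \o T).
Proof.
move=> oD oD' DT Ea cT TE; elim: k f => [|k IH] f Cc Cf.
  split => // x Dx; apply: continuous_comp; first exact: cT.
  by apply: Cf.1; exact: DT.
apply: Ck_alongS => //.
  move=> x Dx; apply: continuous_comp; first exact: cT.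
  by apply: Cf.1; exact: DT.
move=> v Ev; exists (fun x => \sum_i 'D_v (c i) x * 'D_(a i) f (T x)); last first.
  apply: Ck_along_sum => // i; apply: Ck_along_mul => //.
    exact: Ck_along_derive Ev.
  apply: (IH ('D_(a i) f)); last exact: Ck_along_derive Cf _.
  by move=> j; exact: Ck_along_pred.
move=> x Dx; apply: (is_derive_chain oD') => //.
- exact: DT.
- by move=> i y Dy; have [] := Ck_along_derivable Cf (Ea i) Dy.
- by move=> i; apply: (Ck_along_continuous (Ck_along_derive Cf (Ea i))); exact: DT.
- by move=> i; have [] := Ck_along_derivable (Cc i) Ev Dx.
- exact: TE.
Qed.

(** Linearity of the directional derivative in the direction is not automatic; it comes from the
    continuity of the derivatives along the [a i]. *)
Lemma is_derive_lincomb (I : finType) (a : I -> W) (b : I -> R) (D : set W)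
    (f : W -> R) x : open D -> D x ->
  (forall i y, D y -> derivable f y (a i)) ->
  (forall i, {for x, continuous ('D_(a i) f)}) ->
  is_derive x (\sum_i b i *: a i) f (\sum_i b i * 'D_(a i) f x).
Proof.
move=> oD Dx df cdf; apply/is_deriveP => e e0.
have S0 : 0 < 1 + \sum_i `|b i| by rewrite ltr_pwDl// sumr_ge0.
have [d d0 dP] := increment_estimate oD Dx df cdf (divr_gt0 e0 S0).
exists (d / (1 + \sum_i `|b i|)); first by rewrite divr_gt0.
move=> h; rewrite ltr_pdivlMr// => hd.
have E1 : \sum_i (h * b i) *: a i = h *: \sum_i b i *: a i.
  by rewrite scaler_sumr; apply: eq_bigr => i _; rewrite scalerA.
have E2 : \sum_i h * b i * 'D_(a i) f x = h * \sum_i b i * 'D_(a i) f x.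
  by rewrite mulr_sumr; apply: eq_bigr => i _; rewrite mulrA.
have E3 : \sum_i `|h * b i| = `|h| * \sum_i `|b i|.
  by rewrite mulr_sumr; apply: eq_bigr => i _; rewrite normrM.
have := dP (fun i => h * b i); rewrite E1 E2 E3.
move=> H; apply: le_trans (H _) _.
  move=> i; rewrite normrM; apply: le_lt_trans hd; rewrite ler_wpM2l//.
  by rewrite (bigD1 i)//= addrCA lerDl addr_ge0// sumr_ge0.
rewrite mulrCA mulrC ler_wpM2r// mulrAC ler_pdivrMr// ler_pM2l//.
by rewrite lerDr.
Qed.

End CkAlongComp.

Section SecondDifference.
Context {R : realType} {V : normedModType R}.

(** The second difference is the increment of the first difference [h]. A first mean value turns it
    into an increment of ['D_v f], a second one into a second derivative. *)
Lemma second_difference (f : V -> R) (y v : V) (t : R) :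
  (forall s : R, `|s| <= `|t| -> derivable f (s *: v + y) v) ->
  (forall s : R, `|s| <= `|t| -> derivable ('D_v f) (s *: v + y) v) ->
  exists2 s : R, `|s| <= `|t| &
    f (t *: v + y) + f (- t *: v + y) - 2 * f y = t ^+ 2 * 'D_v ('D_v f) (s *: v + y).
Proof.
move=> df ddf; pose h p := f (t *: v + p) - f p.
have ht (s : R) : 0 <= s <= 1 -> `|s * t - t| <= `|t| /\ `|s * t| <= `|t|.
  move=> /andP[s0 s1]; split; last by rewrite normrM (ger0_norm s0) ler_piMl.
  have -> : s * t - t = - ((1 - s) * t) by ring.
  by rewrite normrN normrM ger0_norm ?subr_ge0// ler_piMl// gerBl.
have E (s : R) : (s * t) *: v + (- t *: v + y) = (s * t - t) *: v + y.
  by rewrite addrA -scalerDl.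
have E2 (s : R) : t *: v + ((s * t) *: v + (- t *: v + y)) = (s * t) *: v + y.
  by rewrite E addrA -scalerDl addrCA subrr addr0.
have dh (s : R) : 0 <= s <= 1 -> is_derive ((s * t) *: v + (- t *: v + y)) v h
    ('D_v f ((s * t) *: v + y) - 'D_v f ((s * t) *: v + (- t *: v + y))).
  move=> s01; have [s1 s2] := ht s s01.
  have d1 : is_derive ((s * t) *: v + (- t *: v + y)) v f
      ('D_v f ((s * t) *: v + (- t *: v + y))).
    by rewrite E; apply/derivableP; exact: df.
  have d2 : is_derive ((s * t) *: v + (- t *: v + y)) v (f \o (fun p => t *: v + p))
      ('D_v f ((s * t) *: v + y)).
    apply: (is_derive_affine (w := v)); first by move=> k; rewrite addrCA.
    by rewrite E2; apply/derivableP; exact: df.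
  exact: is_deriveB.
have [s s01 sE] : exists2 s : R, 0 <= s <= 1 &
    h (t *: v + (- t *: v + y)) - h (- t *: v + y) =
    t * 'D_v h ((s * t) *: v + (- t *: v + y)).
  by apply: mean_value_line => s /dh[].
move: sE; rewrite (@derive_val _ _ _ _ _ _ _ (dh s s01)) => sE.
have [s' s'01 s'E] : exists2 s' : R, 0 <= s' <= 1 &
    'D_v f (t *: v + ((s * t) *: v + (- t *: v + y))) -
    'D_v f ((s * t) *: v + (- t *: v + y)) =
    t * 'D_v ('D_v f) ((s' * t) *: v + ((s * t) *: v + (- t *: v + y))).
  apply: mean_value_line => s' s'01; rewrite E addrA -scalerDl; apply: ddf.
  have /andP[? ?] := s01; have /andP[? ?] := s'01.
  have -> : s' * t + (s * t - t) = (s' + s - 1) * t by ring.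
  rewrite normrM ler_piMl// ler_norml; lra.
exists (s' * t + (s * t - t)).
  have /andP[? ?] := s01; have /andP[? ?] := s'01.
  have -> : s' * t + (s * t - t) = (s' + s - 1) * t by ring.
  rewrite normrM ler_piMl// ler_norml; lra.
move: s'E sE; rewrite E2 E [(s' * t) *: v + _]addrA -scalerDl => -> .
have E3 : t *: v + (- t *: v + y) = y by rewrite addrA -scalerDl subrr scale0r add0r.
rewrite /h !E3; by move=> H; rewrite expr2 -mulrA -H; ring.
Qed.

(** Arbitrarily small [t] suffice: the intermediate points of [second_difference] tend to [y], where
    the second derivative is continuous. *)
Lemma second_derivative_ge (D : set V) (f : V -> R) (y v : V) (k : R) :
  open D -> D y -> (forall x, D x -> derivable f x v) ->
  (forall x, D x -> derivable ('D_v f) x v) ->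
  {for y, continuous ('D_v ('D_v f))} ->
  (forall r : R, 0 < r -> exists2 t : R, 0 < `|t| < r &
     k * t ^+ 2 <= f (t *: v + y) + f (- t *: v + y) - 2 * f y) ->
  k <= 'D_v ('D_v f) y.
Proof.
move=> oD Dy df ddf cf H; rewrite leNgt; apply/negP => lt.
have gap : 0 < k - 'D_v ('D_v f) y by rewrite subr_gt0.
have [d d0 dP] := (continuous_forP _ _).1 cf _ gap.
have [d' d'0 d'P] := open_normP oD Dy.
have v1 : 0 < `|v| + 1 by rewrite ltr_wpDl.
have m0 : 0 < Num.min d d' by rewrite lt_min d0.
have [t /andP[t0 tr] tk] := H _ (divr_gt0 m0 v1).
have near_y (s : R) : `|s| <= `|t| -> `|s *: v + y - y| < Num.min d d'.
  move=> st; rewrite addrK normrZ; rewrite ltr_pdivlMr// in tr.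
  by apply: le_lt_trans tr; rewrite ler_pM// lerDl.
have Ds (s : R) : `|s| <= `|t| -> D (s *: v + y).
  by move=> /near_y; rewrite lt_min => /andP[_ /d'P].
have [s st sE] := second_difference (fun s st => df _ (Ds s st)) (fun s st => ddf _ (Ds s st)).
have /dP : `|s *: v + y - y| < d by have := near_y s st; rewrite lt_min => /andP[].
rewrite ltr_norml => /andP[_]; rewrite ltrD2r => lt'.
move: tk; rewrite sE mulrC ler_pM2l; last by rewrite exprn_even_gt0//= -normr_gt0.
by rewrite leNgt lt'.
Qed.

End SecondDifference.

(** * Integration over R^n *)

Section RowVectors.
Context {R : realType}.

Lemma rV_norm_leP n (v : 'rV[R]_n) (r : R) : 0 <= r ->
  reflect (forall i, `|v 0 i| <= r) (`|v| <= r).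
Proof.
move=> r0; have -> : `|v| = \big[Num.max/0]_ij `|v ij.1 ij.2| := mx_normrE v.
apply: (iffP (bigmax_leP _ _ _ _)).
  by move=> [_ H] i; exact: (H (0, i)).
by move=> H; split=> // -[i j] _ /=; rewrite ord1.
Qed.

Lemma rV_norm_coord n (v : 'rV[R]_n) i : `|v 0 i| <= `|v|.
Proof. exact: (rV_norm_leP v (normr_ge0 v) (lexx _)). Qed.

Lemma norm_row_mx_le n (x : R) (s : 'rV[R]_n) (r : R) : 0 <= r ->
  (`|row_mx x%:M s : 'rV_(1 + n)| <= r) = (`|x| <= r) && (`|s| <= r).
Proof.
move=> r0; apply/idP/andP.
  move=> /(rV_norm_leP _ r0) H; split.
    by have := H (lshift n 0); rewrite row_mxEl mxE eqxx mulr1n.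
  by apply/rV_norm_leP => // i; have := H (rshift 1 i); rewrite row_mxEr.
move=> [xr /(rV_norm_leP _ r0) sr]; apply/rV_norm_leP => // i.
case: (splitP i) => j ij.
  have -> : i = lshift n j by apply: val_inj.
  by rewrite row_mxEl ord1 mxE eqxx mulr1n.
have -> : i = rshift 1 j by apply: val_inj.
by rewrite row_mxEr.
Qed.

Lemma row_mx_sub n (x : R) (s : 'rV[R]_n) (c : 'rV[R]_(1 + n)) :
  row_mx x%:M s - c = row_mx (x - lsubmx c 0 0)%:M (s - rsubmx c) :> 'rV_(1 + n).
Proof.
rewrite -[in LHS](hsubmxK c) opp_row_mx add_row_mx; congr row_mx.
by apply/matrixP => i j; rewrite !ord1 !mxE eqxx !mulr1n.
Qed.

(** A countable union of boxes: boxes have measurable preimages under [to_row] because the sup norm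
    makes them products of intervals, and countability extends this to open sets. *)
Lemma open_rational_boxes n (A : set 'rV[R]_n) : open A ->
  A = \bigcup_(c in [set c : 'rV[rat]_n * rat |
        [set x : 'rV[R]_n | `|x - map_mx ratr c.1| <= ratr c.2] `<=` A])
        [set x : 'rV[R]_n | `|x - map_mx ratr c.1| <= ratr c.2].
Proof.
move=> oA; apply/seteqP; split; last by move=> x [c /= cA] /cA.
move=> x Ax; have [d d0 dA] := open_normP oA Ax.
have [q] := @rat_in_itvoo R 0 (d / 2) (divr_gt0 d0 (@ltr0n R 2)).
rewrite in_itv /= => /andP[q0 qd].
have ex i : exists c : rat, `|x 0 i - ratr c| <= ratr q.
  have [c] := @rat_in_itvoo R (x 0 i) (x 0 i + ratr q) ltac:(by rewrite ltrDl).
  rewrite in_itv /= => /andP[c1 c2]; exists c.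
  rewrite ler_norml; apply/andP; split; lra.
pose c : 'rV[rat]_n := \row_i xchoose (ex i).
have xc : `|x - map_mx ratr c| <= ratr q.
  apply/rV_norm_leP; first exact: ltW.
  by move=> i; rewrite !mxE; exact: (xchooseP (ex i)).
exists (c, q) => //= y yc; apply: dA.
rewrite -(subrK (map_mx ratr c) y) -addrA (le_lt_trans (ler_normD _ _))//.
rewrite [ltRHS]splitr (le_lt_trans (lerD yc (lexx _)))//.
by rewrite ltr_leD// -opprB normrN (le_trans xc)// ltW.
Qed.

End RowVectors.

Section LebesgueBoxes.
Context {R : realType}.
Local Notation T n := (em_carrier (lebesgue_Rn R n)).
Local Notation mu n := (em_measure (lebesgue_Rn R n)).

Definition box n (c : 'rV[R]_n) (r : R) : set (T n) :=
  [set t | `|to_row t - c| <= r].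

Lemma boxS n (c : 'rV[R]_n.+1) (r : R) : 0 <= r ->
  box c r = `[lsubmx (c : 'rV_(1 + n)) 0 0 - r, lsubmx (c : 'rV_(1 + n)) 0 0 + r]%classic
    `*` box (rsubmx (c : 'rV_(1 + n))) r.
Proof.
move=> r0; apply/predeqP => -[x s].
change ((`|(row_mx x%:M (to_row s) : 'rV_(1 + n)) - c| <= r) <->
  (x \in `[lsubmx (c : 'rV_(1 + n)) 0 0 - r, lsubmx (c : 'rV_(1 + n)) 0 0 + r]
   /\ `|to_row s - rsubmx (c : 'rV_(1 + n))| <= r)).
rewrite (row_mx_sub x (to_row s) c) norm_row_mx_le// ler_distl in_itv /=.
by split=> [/andP|[-> ->]].
Qed.

Lemma measurable_box n (c : 'rV[R]_n) (r : R) : 0 <= r -> measurable (box c r).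
Proof.
move=> r0; elim: n c => [|n IH] c; last first.
  by rewrite boxS//; apply: measurableX => //; exact: IH.
suff -> : box c r = setT by exact: measurableT.
apply/seteqP; split=> // t _; rewrite /box /=.
by apply/rV_norm_leP => // -[].
Qed.

Lemma measure_box n (c : 'rV[R]_n) (r : R) : 0 < r ->
  mu n (box c r) = ((r *+ 2) ^+ n)%:E.
Proof.
move=> r0; elim: n c => [|n IH] c.
  have -> : box c r = setT.
    apply/seteqP; split=> // t _; rewrite /box /=.
    by apply/rV_norm_leP => [|[]//]; exact: ltW.
  by rewrite /= diracT expr0.
rewrite boxS ?ltW//; set c0 := lsubmx _ 0 0.
have mB := @measurable_box n (rsubmx (c : 'rV_(1 + n))) r (ltW r0).
have -> : mu n.+1 (`[c0 - r, c0 + r]%classic `*` box (rsubmx (c : 'rV_(1 + n))) r) =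
    (@lebesgue_measure R [set` `[(c0 - r)%R, (c0 + r)%R]%R] *
     mu n (box (rsubmx (c : 'rV_(1 + n))) r))%E.
  exact: product_measure1E.
rewrite IH (@lebesgue_measure_itv R) /= lte_fin ltrD2l gtrN//.
by rewrite -EFinB -EFinM exprS; congr (_ * _)%:E; ring.
Qed.

Lemma measurable_to_row_open n (A : set 'rV[R]_n) : open A ->
  measurable ((@to_row R n (lebesgue_Rn R n)) @^-1` A).
Proof.
move=> /open_rational_boxes ->; rewrite preimage_bigcup bigcup_mkcond.
apply: countable_bigcupT_measurable; first exact: countableP.
move=> c; case: ifPn => // _; have [c0|c0] := leP 0 (ratr c.2 : R).
  exact: measurable_box.
rewrite (_ : _ @^-1` _ = set0)//; apply/seteqP; split=> // t /= H.
by have := le_trans (normr_ge0 _) H; rewrite leNgt c0.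
Qed.

Lemma measurable_fun_to_row n (f : 'rV[R]_n -> R) : continuous f ->
  measurable_fun setT (fun t : T n => f (to_row t)).
Proof.
move=> cf; apply: (measurability _ (RGenOpens.measurableE R)).
move=> _ [_ [a [b ->] <-]]; rewrite setTI.
have oA : open (f @^-1` `]a, b[%classic).
  by apply: open_comp => [x _|]; [exact: cf|exact: interval_open].
exact: (measurable_to_row_open oA).
Qed.

End LebesgueBoxes.

Section CompactSupport.
Context {R : realType}.
Local Notation T n := (em_carrier (lebesgue_Rn R n)).
Local Notation mu n := (em_measure (lebesgue_Rn R n)).

Definition cont_csupp n (f : 'rV[R]_n -> R) : Prop :=
  continuous f /\ exists r, forall z, r < `|z| -> f z = 0.

Lemma compact_box n (c : 'rV[R]_n) (r : R) : compact [set z | `|z - c| <= r].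
Proof.
apply: bounded_closed_compact.
  exists (`|c| + r); split; first exact: num_real.
  move=> M ltM z /= zr; apply: le_trans (ltW ltM).
  by rewrite -(subrK c z) addrC (le_trans (ler_normD _ _))// lerD2l.
rewrite (_ : [set _ | _] = (fun z => `|z - c|) @^-1` [set x | x <= r])//.
have cN : continuous (fun z : 'rV[R]_n => `|z - c|).
  move=> z; apply/continuous_forP => e e0; exists e => // y; apply: le_lt_trans.
  by rewrite (le_trans (ler_dist_dist _ _))// opprB addrA subrK.
by have /continuous_closedP/(_ _ (@closed_le R r)) := cN.
Qed.

Lemma integrable_csupp n (f : 'rV[R]_n -> R) : cont_csupp f ->
  (mu n).-integrable setT (fun t => (f (to_row t))%:E).
Proof.
(* The given bound may be negative, while a box of finite known measure needs a positive radius. *)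
move=> [cf [r0 fr0]]; pose r := `|r0| + 1.
have r_gt0 : 0 < r by rewrite /r ltr_wpDl.
have fr z : r < `|z| -> f z = 0.
  move=> rz; apply: fr0; apply: le_lt_trans rz.
  by rewrite /r (le_trans (ler_norm _))// lerDl.
have mB := @measurable_box R n 0 r (ltW r_gt0).
have mBlt : (mu n (box 0%R r) < +oo)%E by rewrite measure_box// ltry.
have : (mu n).-integrable (box 0 r) (EFin \o (fun t => f (to_row t))).
  apply: measurable_bounded_integrable => //.
  - by apply: measurable_funTS; exact: measurable_fun_to_row.
  - have /compact_bounded[M [Mr MP]] : compact (f @` [set z : 'rV[R]_n | `|z - 0| <= r]).
      apply: continuous_compact; last exact: compact_box.
      exact: continuous_subspaceT.
    by exists M; split => // x /MP H t tB; apply: H; exists (to_row t).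
move=> /(integrable_mkcond _ mB); congr (integrable _ _ _).
apply/funext => t; rewrite patchE; case: ifPn => //.
move=> /negP tB; rewrite fr// ltNge; apply/negP => tr; apply: tB.
by rewrite inE /box /= subr0.
Qed.

End CompactSupport.

Section PointwiseContinuity.
Context {R : realType} {X : topologicalType}.
Implicit Types (f g : X -> R) (x : X).

Lemma cont_cst x (c : R) : continuous_at x (fun=> c).
Proof. exact: cvg_cst. Qed.

Lemma cont_add f g x : continuous_at x f -> continuous_at x g ->
  continuous_at x (fun x => f x + g x).
Proof. exact: cvgD. Qed.

Lemma cont_sub f g x : continuous_at x f -> continuous_at x g ->
  continuous_at x (fun x => f x - g x).
Proof. exact: cvgB. Qed.

Lemma cont_mul f g x : continuous_at x f -> continuous_at x g ->
  continuous_at x (fun x => f x * g x).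
Proof. exact: cvgM. Qed.

Lemma cont_max f g x : continuous_at x f -> continuous_at x g ->
  continuous_at x (fun x => Num.max (f x) (g x)).
Proof. exact: continuous_max. Qed.

End PointwiseContinuity.

Section IntegralRn.
Context {R : realType}.
Local Notation T n := (em_carrier (lebesgue_Rn R n)).
Local Notation mu n := (em_measure (lebesgue_Rn R n)).
Implicit Types (n : nat).

Lemma cont_csupp_comb n (f g : 'rV[R]_n -> R) (a b : R) :
  cont_csupp f -> cont_csupp g -> cont_csupp (fun z => a * f z + b * g z).
Proof.
move=> [cf [r fr]] [cg [r' gr]]; split.
  move=> z; apply: cont_add; apply: cont_mul; try exact: cont_cst.
    exact: cf.
  exact: cg.
exists (Order.max r r') => z; rewrite gt_max => /andP[/fr -> /gr ->].
by rewrite !mulr0 addr0.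
Qed.

Lemma cont_csupp_mul n (f g : 'rV[R]_n -> R) :
  continuous f -> cont_csupp g -> cont_csupp (fun z => f z * g z).
Proof.
move=> cf [cg [r' gr]]; split; last by exists r' => z /gr ->; rewrite mulr0.
by move=> z; apply: cont_mul; [exact: cf|exact: cg].
Qed.

Lemma cont_csupp_max0 n (f : 'rV[R]_n -> R) (a : R) :
  cont_csupp f -> cont_csupp (fun z => Num.max (a * f z) 0).
Proof.
move=> [cf [r fr]]; split; last by exists r => z /fr ->; rewrite mulr0 maxxx.
move=> z; have cg : continuous_at z (fun z => a * f z).
  by apply: cont_mul; [exact: cont_cst|exact: cf].
by apply: cont_max => //; exact: cont_cst.
Qed.

Lemma integral_Rn_comb n (f g : 'rV[R]_n -> R) (a b : R) :
  cont_csupp f -> cont_csupp g ->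
  integral_Rn (fun z => a * f z + b * g z) = a * integral_Rn f + b * integral_Rn g.
Proof.
move=> sf sg; rewrite /integral_Rn.
have Zi (h : 'rV[R]_n -> R) c : cont_csupp h ->
    (mu n).-integrable setT (EFin \o (fun t => c * h (to_row t))).
  by move=> /integrable_csupp /(integrableZl measurableT c).
rewrite RintegralD//; [|exact: Zi|exact: Zi].
by rewrite !RintegralZl//; exact: integrable_csupp.
Qed.

Lemma integral_RnZ n (f : 'rV[R]_n -> R) (a : R) :
  cont_csupp f -> integral_Rn (fun z => a * f z) = a * integral_Rn f.
Proof. by move=> sf; rewrite /integral_Rn RintegralZl//; exact: integrable_csupp. Qed.

Lemma integral_Rn_ge0 n (f : 'rV[R]_n -> R) :
  (forall z, 0 <= f z) -> 0 <= integral_Rn f.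
Proof. by move=> f0; apply: Rintegral_ge0 => t _. Qed.

Lemma le_integral_Rn n (f g : 'rV[R]_n -> R) : cont_csupp f -> cont_csupp g ->
  (forall z, f z <= g z) -> integral_Rn f <= integral_Rn g.
Proof.
move=> sf sg fg; apply: le_Rintegral => //; exact: integrable_csupp.
Qed.

Lemma integrable_cst_box n (c : 'rV[R]_n) (r k : R) : 0 < r ->
  (mu n).-integrable (box c r) (EFin \o cst k).
Proof.
move=> r0; have mB := @measurable_box R n c r (ltW r0).
have mBlt : (mu n (box c r) < +oo)%E by rewrite measure_box// ltry.
apply: measurable_bounded_integrable => //.
by exists `|k|; split; [exact: num_real|move=> M kM t _; exact: ltW].
Qed.

Lemma integral_Rn_bound n (f : 'rV[R]_n -> R) (r M : R) : 0 < r ->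
  continuous f -> (forall z, r < `|z| -> f z = 0) ->
  (forall z, `|z| <= r -> `|f z| <= M) ->
  `|integral_Rn f| <= M * (r *+ 2) ^+ n.
Proof.
move=> r0 cf fr fM.
have sf : cont_csupp f by split => //; exists r.
have mB := @measurable_box R n 0 r (ltW r0).
have muB : mu n (box 0%R r) = ((r *+ 2) ^+ n)%:E by rewrite measure_box.
have fB : (fun t => f (to_row t)) \_ (box 0%R r) = (fun t : T n => f (to_row t)).
  apply/funext => t; rewrite patchE; case: ifPn => // /negP tB.
  rewrite fr// ltNge; apply/negP => tr; apply: tB.
  by rewrite inE /box /= subr0.
have If := integrable_csupp sf.
have IfB : (mu n).-integrable (box 0%R r) (EFin \o (fun t => f (to_row t))).
  exact: integrableS If.
have -> : integral_Rn f = (\int[mu n]_(t in box 0%R r) f (to_row t))%R.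
  by rewrite [RHS]Rintegral_mkcond fB.
apply: le_trans (le_normr_Rintegral mB IfB) _.
rewrite -[X in M * X](_ : fine (mu n (box 0%R r)) = _); last by rewrite muB.
rewrite -Rintegral_cst//; apply: le_Rintegral => //.
- exact: integrable_norm.
- exact: integrable_cst_box.
- by move=> t; rewrite /box /= subr0 => /fM.
Qed.

Lemma integral_Rn_gt0 n (f : 'rV[R]_n -> R) (z0 : 'rV[R]_n) :
  cont_csupp f -> (forall z, 0 <= f z) -> 0 < f z0 -> 0 < integral_Rn f.
Proof.
move=> sf f0 fz0; have [cf _] := sf.
have [d d0 dP] := (continuous_forP _ _).1 (cf z0) _ (divr_gt0 fz0 (@ltr0n R 2)).
pose r := d / 2; have r0 : 0 < r by rewrite divr_gt0.
have mB := @measurable_box R n z0 r (ltW r0).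
have muB : mu n (box z0 r) = ((r *+ 2) ^+ n)%:E by rewrite measure_box.
have If := integrable_csupp sf.
apply: (@lt_le_trans _ _ (f z0 / 2 * (r *+ 2) ^+ n)).
  by rewrite mulr_gt0 ?divr_gt0// exprn_gt0// pmulrn_lgt0.
rewrite -[X in _ * X](_ : fine (mu n (box z0 r)) = _); last by rewrite muB.
rewrite -Rintegral_cst// Rintegral_mkcond.
apply: le_Rintegral => //.
  have -> : EFin \o (cst (f z0 / 2) \_ (box z0 r)) =
      (EFin \o cst (f z0 / 2)) \_ (box z0 r).
    by apply/funext => t; rewrite /= !patchE; case: ifP.
  apply/(integrable_mkcond _ mB).1; exact: integrable_cst_box.
move=> t _; rewrite patchE; case: ifPn => // /set_mem tB.
have /dP : `|to_row t - z0| < d by rewrite (le_lt_trans tB)// /r ltr_pdivrMr// ltr_pMr// ltr1n.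
by rewrite ltr_norml => /andP[+ _] /=; lra.
Qed.

Lemma cont_csupp_slice n (f : 'rV[R]_(1 + n) -> R) (x : R) : cont_csupp f ->
  cont_csupp (fun s : 'rV[R]_n => f (row_mx x%:M s)).
Proof.
move=> [cf [r fr]]; split.
  move=> s; apply: continuous_comp; last exact: cf.
  apply/continuous_forP => e e0; exists e => // s' ss'.
  apply: le_lt_trans ss'; rewrite opp_row_mx add_row_mx.
  have -> : x%:M - x%:M = (0 : R)%:M :> 'M[R]_(1).
    by rewrite subrr; apply/matrixP => i j; rewrite !mxE mul0rn.
  by rewrite norm_row_mx_le// normr0 normr_ge0 lexx.
exists r => s rs; apply: fr; apply: lt_le_trans rs _.
have := @norm_row_mx_le R n x s _ (normr_ge0 (row_mx x%:M s)).
by rewrite lexx => /esym/andP[].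
Qed.

(** Fubini: splitting off the first coordinate reduces changes of variables to dimension one by
    induction on [n]. *)
Lemma integral_RnS n (f : 'rV[R]_(1 + n) -> R) : cont_csupp f ->
  @integral_Rn R n.+1 f =
  (\int[lebesgue_measure]_(x in setT) integral_Rn (fun s : 'rV[R]_n => f (row_mx x%:M s)))%R.
Proof.
move=> sf; have If := @integrable_csupp R n.+1 f sf.
rewrite /integral_Rn /Rintegral; congr fine.
transitivity (\int[@lebesgue_measure R]_(x in setT)
   (\int[mu n]_(s in setT) (f (row_mx x%:M (to_row s)))%:E))%E.
  symmetry.
  exact: (@integral12_prod_meas1 _ _ _ _ R lebesgue_measure (mu n)
    (fun t => (f (row_mx t.1%:M (to_row t.2)))%:E) If).
apply: eq_integral => x _; rewrite fineK//.
apply: integrable_fin_num => //.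
exact: (integrable_csupp (cont_csupp_slice x sf)).
Qed.

End IntegralRn.

(** * Continuity and differentiation under the integral sign *)

Section ParametricIntegral.
Context {R : realType}.

Lemma prod_norm_lt (V W : normedModType R) (p : V * W) (d : R) :
  (`|p| < d) = (`|p.1| < d) && (`|p.2| < d).
Proof. by rewrite prod_normE gt_max. Qed.

(** The tube lemma: near covering by compactness makes continuity at the points [(p, z)] uniform in
    [z]. *)
Lemma near_uniform_compact (V W : normedModType R) (K : V * W -> R)
    (A : set W) (p : V) : compact A ->
  (forall z, A z -> continuous_at (p, z) K) ->
  forall e : R, 0 < e ->
    \forall p' \near p, forall z, A z -> `|K (p', z) - K (p, z)| < e.
Proof.
move=> /compact_near_coveringP cA cK e e0.
apply: (cA V (nbhs p) (fun p' z => `|K (p', z) - K (p, z)| < e)) => z Az.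
have [d d0 dP] := (continuous_forP _ _).1 (cK z Az) _ (divr_gt0 e0 (@ltr0n R 2)).
exists (ball z d, ball p d); first by split; exact: nbhsx_ballx.
move=> [z' p'] [/= zz' pp'].
rewrite -ball_normE /= distrC in zz'; rewrite -ball_normE /= distrC in pp'.
have K1 : `|K (p', z') - K (p, z)| < e / 2.
  by apply: dP; rewrite prod_norm_lt /= pp' zz'.
have K2 : `|K (p, z') - K (p, z)| < e / 2.
  by apply: dP; rewrite prod_norm_lt /= subrr normr0 d0 zz'.
have -> : K (p', z') - K (p, z') =
  (K (p', z') - K (p, z)) - (K (p, z') - K (p, z)) by ring.
by rewrite (le_lt_trans (ler_normB _ _))// [ltRHS]splitr ltrD.
Qed.

Lemma near_line (V : normedModType R) (p v : V) (P : V -> Prop) :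
  (\forall p' \near p, P p') -> \forall h \near (0:R), P (h *: v + p).
Proof.
move=> /nbhs_ballP[d /= d0 dP]; apply/nbhs_ballP.
have v1 : 0 < `|v| + 1 by rewrite ltr_wpDl.
exists (d / (`|v| + 1)); first by rewrite /= divr_gt0.
move=> h; rewrite -ball_normE /= sub0r normrN ltr_pdivlMr// => hd.
apply: dP; rewrite -ball_normE /= distrC addrK normrZ.
by apply: le_lt_trans hd; rewrite ler_wpM2l// lerDl.
Qed.

Lemma continuous_pair_slice (V W : normedModType R) (K : V * W -> R) p z :
  continuous_at (p, z) K -> continuous_at z (fun z => K (p, z)).
Proof.
move=> cK; apply/continuous_forP => e e0.
have [d d0 dP] := (continuous_forP _ _).1 cK e e0.
exists d => // z' zz'; apply: dP.
by rewrite prod_norm_lt /= subrr normr0 d0 zz'.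
Qed.

(** The radius is uniform near each parameter, so that nearby integrals live on one box of finite
    measure and the property passes to derivatives. *)
Definition locally_csupp (V : normedModType R) n (D : set V) (K : V * 'rV[R]_n -> R) :=
  forall p, D p -> exists2 r : R, 0 < r &
    \forall p' \near p, forall z, r < `|z| -> K (p', z) = 0.

Lemma continuous_integral_Rn (V : normedModType R) n (D : set V)
    (K : V * 'rV[R]_n -> R) : open D ->
  (forall p z, D p -> continuous_at (p, z) K) -> locally_csupp D K ->
  forall p, D p -> continuous_at p (fun p => integral_Rn (fun z => K (p, z))).
Proof.
move=> oD cK sK p Dp; apply/cvgrPdist_lt => e e0.
have [r r0 rP] := sK p Dp.
pose C := (r *+ 2) ^+ n; have C0 : 0 < C by rewrite exprn_gt0// pmulrn_lgt0.
have cB := @compact_box R n 0 r.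
have := near_uniform_compact cB (fun z _ => cK p z Dp)
  (divr_gt0 e0 (mulr_gt0 (@ltr0n R 2) C0)).
have Dn : \forall p' \near p, D p' by exact: open_nbhs_nbhs.
move: (nbhs_singleton rP) => rp Kn; near=> p'.
have Kp' z : r < `|z| -> K (p', z) = 0 by move: z; near: p'.
have Dp' : D p' by near: p'.
have cs p0 : D p0 -> continuous (fun z => K (p0, z)).
  by move=> Dp0 z; apply: continuous_pair_slice; exact: cK.
have cspt p0 : D p0 -> (forall z, r < `|z| -> K (p0, z) = 0) ->
    cont_csupp (fun z => K (p0, z)).
  by move=> Dp0 K0; split; [exact: cs|exists r].
have := integral_Rn_comb 1 (-1) (cspt _ Dp rp) (cspt _ Dp' Kp').
rewrite mul1r mulN1r => <-.
apply: (@le_lt_trans _ _ (e / (2 * C) * C)).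
  apply: integral_Rn_bound => //.
  - move=> z; apply: cont_add; apply: cont_mul; try exact: cont_cst; exact: cs.
  - by move=> z rz; rewrite rp// Kp'// !mulr0 addr0.
  - move=> z zr; rewrite mul1r mulN1r distrC ltW//.
    have zr' : [set z | `|z - 0| <= r] z by rewrite /= subr0.
    by move: z zr' {zr}; near: p'.
by rewrite invfM mulrA mulfVK ?gt_eqF// ltr_pdivrMr// ltr_pMr// ltr1n.
Unshelve. all: by end_near. Qed.

Lemma derive_along_eq0 (V : normedModType R) (f : V -> R) (p v : V) :
  (\forall h \near (0:R), f (h *: v + p) = 0) -> 'D_v f p = 0.
Proof.
move=> /nbhs_ballP[d /= d0 dP].
have fp : f p = 0.
  have : f (0 *: v + p) = 0 by apply: dP; exact: ballxx.
  by rewrite scale0r add0r.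
suff [] : is_derive p v f 0 by [].
apply/is_deriveP => e e0; exists d => // h hd.
have -> : f (h *: v + p) = 0.
  by apply: dP; rewrite -ball_normE /= sub0r normrN.
by rewrite fp mulr0 !subr0 normr0 mulr_ge0// ltW.
Qed.

Lemma locally_csupp_derive (V : normedModType R) n (D : set V)
    (K : V * 'rV[R]_n -> R) (v : V) :
  locally_csupp D K -> locally_csupp D ('D_(v, 0) K).
Proof.
move=> sK p /sK[r r0 rP]; exists r => //.
(* The derivative at [p'] vanishes only if the function vanishes around [p'], hence the passage to
   the interior. *)
have /nbhs_interior : nbhs p (fun p' => forall z, r < `|z| -> K (p', z) = 0) by [].
apply: filterS => p' rp' z rz; apply: derive_along_eq0.
have := near_line v rp'; apply: filterS => h H.
by rewrite -[_ + (p', z)]/(h *: v + p', h *: 0 + z) scaler0 add0r H.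
Qed.

(** The mean value theorem replaces the increment of the integrand by its derivative at a parameter
    between [p] and [h *: v + p]; this derivative is uniformly close to the one at [p] over the box,
    so the error can be integrated. *)
Lemma is_derive_integral_Rn (V : normedModType R) n (E D : set V)
    (K : V * 'rV[R]_n -> R) (v p : V) : open D ->
  Ck_along [set w | E w.1 /\ w.2 = 0] 1 [set q | D q.1] K -> locally_csupp D K ->
  E v -> D p ->
  is_derive p v (fun p => integral_Rn (fun z => K (p, z)))
    (integral_Rn (fun z => 'D_(v, 0) K (p, z))).
Proof.
move=> oD CK sK Ev Dp.
have Ew : [set w : V * 'rV[R]_n | E w.1 /\ w.2 = 0] (v, 0) by [].
have CdK := Ck_along_derive CK Ew.
have sdK := locally_csupp_derive v sK.
apply/is_deriveP => e e0.
have [r r0 rP] := sK p Dp; have [r' r'0 r'P] := sdK p Dp.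
pose s := Order.max r r'; have s0 : 0 < s by rewrite lt_max r0.
pose C := (s *+ 2) ^+ n; have C0 : 0 < C by rewrite exprn_gt0// pmulrn_lgt0.
have cB := @compact_box R n 0 s.
have cdK z : [set z | `|z - 0| <= s] z -> continuous_at (p, z) ('D_(v, 0) K).
  by move=> _; exact: (Ck_along_continuous CdK).
have Kn := near_uniform_compact cB cdK (divr_gt0 e0 C0).
have Dn : \forall p' \near p, D p' by exact: open_nbhs_nbhs.
have : \forall p' \near p, [/\ D p', forall z, s < `|z| -> K (p', z) = 0 &
   forall z, [set z | `|z - 0| <= s] z ->
     `|'D_(v, 0) K (p', z) - 'D_(v, 0) K (p, z)| < e / C].
  near=> p'; split; [by near: p'| |by near: p'].
  move=> z; rewrite gt_max => /andP[rz _]; move: z rz; near: p'; exact: rP.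
move=> /(near_line v) /nbhs_ballP[d /= d0 dP]; exists d => // h hd.
have segm (u : R) : 0 <= u <= 1 -> [/\ D ((u * h) *: v + p),
   forall z, s < `|z| -> K ((u * h) *: v + p, z) = 0 &
   forall z, [set z | `|z - 0| <= s] z ->
     `|'D_(v, 0) K ((u * h) *: v + p, z) - 'D_(v, 0) K (p, z)| < e / C].
  move=> /andP[u0 u1]; apply: dP; rewrite -ball_normE /= sub0r normrN.
  by rewrite normrM (ger0_norm u0) (le_lt_trans _ hd)// ler_piMl.
have i1 : 0 <= (1:R) <= 1 by rewrite ler01 lexx.
have [Dh Kh _] := segm 1 i1; rewrite mul1r in Dh Kh.
have i0 : 0 <= (0:R) <= 1 by rewrite ler01 lexx.
have [D0 K0 _] := segm 0 i0; rewrite mul0r scale0r add0r in D0 K0.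
have dK0 z : s < `|z| -> 'D_(v, 0) K (p, z) = 0.
  by rewrite gt_max => /andP[_ r'z]; exact: (nbhs_singleton r'P).
have cKs p0 : D p0 -> continuous (fun z => K (p0, z)).
  move=> Dp0 z; apply: continuous_pair_slice; exact: (Ck_along_continuous CK).
have cdKs : continuous (fun z => 'D_(v, 0) K (p, z)).
  move=> z; apply: (continuous_pair_slice (K := 'D_(v, 0) K)).
  exact: (Ck_along_continuous CdK).
have sh : cont_csupp (fun z => K (h *: v + p, z)) by split; [exact: cKs|exists s].
have s00 : cont_csupp (fun z => K (p, z)) by split; [exact: cKs|exists s].
have sd : cont_csupp (fun z => 'D_(v, 0) K (p, z)) by split; [exact: cdKs|exists s].
have sc := cont_csupp_comb 1 (-1) sh s00.
have := integral_Rn_comb 1 (- h) sc sd.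
rewrite (integral_Rn_comb 1 (-1) sh s00) !mul1r mulN1r mulNr => <-.
have -> : e * `|h| = (e / C * `|h|) * C by rewrite mulrAC divfK ?gt_eqF.
apply: integral_Rn_bound => //.
- by have [] := cont_csupp_comb 1 (- h) sc sd.
- by move=> z sz; rewrite Kh// K0// dK0//; ring.
move=> z zs; have zs' : [set z | `|z - 0| <= s] z by rewrite /= subr0.
have E1 (t : R) : t *: (v, 0) + (p, z) = (t *: v + p, z) :> V * 'rV[R]_n.
  by rewrite -[LHS]/(t *: v + p, t *: 0 + z) scaler0 add0r.
have dK (u : R) : 0 <= u <= 1 -> derivable K ((u * h) *: (v, 0) + (p, z)) (v, 0).
  move=> u01; rewrite E1; have [Du _ _] := segm u u01.
  have Dq : [set q : V * 'rV[R]_n | D q.1] ((u * h) *: v + p, z) by [].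
  by have [] := Ck_along_derivable CK Ew Dq.
have [u u01 uE] := mean_value_line dK.
rewrite !E1 in uE; rewrite !mul1r mulN1r uE mulNr -mulrBr normrM mulrC.
by rewrite ler_wpM2r//; have [_ _ /(_ z zs')/ltW] := segm u u01.
Unshelve. all: by end_near. Qed.

Lemma Ck_along_integral_Rn (V : normedModType R) n (E D : set V) k
    (K : V * 'rV[R]_n -> R) : open D ->
  Ck_along [set w | E w.1 /\ w.2 = 0] k [set q | D q.1] K -> locally_csupp D K ->
  Ck_along E k D (fun p => integral_Rn (fun z => K (p, z))).
Proof.
move=> oD; elim: k K => [|k IH] K CK sK.
  split=> // p Dp; apply: (continuous_integral_Rn oD) => // p' z Dp'.
  exact: (Ck_along_continuous CK).
apply: Ck_alongS => //.
  move=> p Dp; apply: (continuous_integral_Rn oD) => // p' z Dp'.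
  exact: (Ck_along_continuous CK).
move=> v Ev.
have Ew : [set w : V * 'rV[R]_n | E w.1 /\ w.2 = 0] (v, 0) by [].
exists (fun p => integral_Rn (fun z => 'D_(v, 0) K (p, z))); last first.
  by apply: (IH ('D_(v, 0) K)); [exact: (Ck_along_derive CK Ew)|exact: locally_csupp_derive].
move=> p Dp; have CK1 : Ck_along [set w | E w.1 /\ w.2 = 0] 1 [set q | D q.1] K.
  by elim: k CK {IH} => // k IH /Ck_along_pred.
exact: (is_derive_integral_Rn oD CK1 sK Ev Dp).
Qed.

End ParametricIntegral.

(** * Affine changes of variables *)

Section AffineChange.
Context {R : realType}.

Lemma integral_opp (g : R -> R) : continuous g -> (forall x, 0 <= g x) ->
  (\int[@lebesgue_measure R]_x g x = \int[@lebesgue_measure R]_x g (- x))%R.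
Proof.
move=> cg g0; rewrite /Rintegral; congr fine.
have mg := continuous_measurable_fun cg.
transitivity (\int[pushforward (@lebesgue_measure R) (-%R : _ -> measurableTypeR R)]_x (g x)%:E)%E.
  by apply: eq_measure_integral => //= A mA AS; exact/esym/lebesgue_measureN.
rewrite ge0_integral_pushforward//=.
- exact/measurable_EFinP.
- by move=> x _; rewrite lee_fin.
Qed.

Lemma integral_affine_pos (g : R -> R) (a b : R) : 0 < a ->
  continuous g -> (forall x, 0 <= g x) ->
  (\int[@lebesgue_measure R]_x g x =
   \int[@lebesgue_measure R]_x (a * g (a * x + b)))%R.
Proof.
move=> a0 cg g0; rewrite /Rintegral; congr fine.
pose F x := a * x + b.
have dF (x : R) : is_derive x 1 F a.
  apply/is_deriveP => e e0; exists 1 => // h _; rewrite [h%:A]mulr1 /F.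
  have -> : a * (h + x) + b - (a * x + b) - h * a = 0 by ring.
  by rewrite normr0 mulr_ge0// ltW.
have F' : F^`()%classic = cst a by apply/funext => x; rewrite derive1E; case: (dF x).
rewrite (@increasing_ge0_integration_by_substitutionT R F g) //.
- by apply: eq_integral => x _; rewrite F' /= mulrC.
- by move=> x y xy; rewrite /F ltrD2r ltr_pM2l.
- by rewrite F' => x; exact: cvg_cst.
- by rewrite F'; exact: is_cvg_cst.
- by rewrite F'; exact: is_cvg_cst.
- apply/cvgrNyPle => A; exists ((A - b) / a); split; first exact: num_real.
  by move=> x; rewrite ltr_pdivlMr// => /ltW; rewrite /F -lerBrDr mulrC.
- apply/cvgryPge => A; exists ((A - b) / a); split; first exact: num_real.
  by move=> x; rewrite ltr_pdivrMr// => /ltW; rewrite /F -lerBlDr mulrC.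
Qed.

Lemma integral_affine (g : R -> R) (a b : R) : a != 0 ->
  continuous g -> (forall x, 0 <= g x) ->
  (\int[@lebesgue_measure R]_x g x =
   \int[@lebesgue_measure R]_x (`|a| * g (a * x + b)))%R.
Proof.
move=> a0 cg g0; have [a_gt0|a_lt0|a_eq0] := ltgtP 0 a; last 1 first.
- by rewrite -a_eq0 eqxx in a0.
- by rewrite gtr0_norm//; exact: integral_affine_pos.
rewrite ltr0_norm// (integral_opp cg g0) (@integral_affine_pos _ (- a) (- b)) ?oppr_gt0//.
- apply: eq_Rintegral => x _; congr (_ * g _); ring.
- move=> x; apply: continuous_comp; last exact: cg.
  exact: oppr_continuous.
Qed.

Lemma row_mx_continuous n : continuous (fun p : R * 'rV[R]_n => row_mx p.1%:M p.2 : 'rV[R]_(1 + n)).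
Proof.
move=> p; apply/continuous_forP => e e0; exists (e / 2); first by rewrite divr_gt0.
move=> q; rewrite prod_norm_lt /= => /andP[q1 q2].
apply: (@le_lt_trans _ _ (e / 2)); last by rewrite ltr_pdivrMr// ltr_pMr// ltr1n.
rewrite opp_row_mx add_row_mx.
have -> : (q.1)%:M - (p.1)%:M = (q.1 - p.1)%:M :> 'M[R]_(1).
  by apply/matrixP => i j; rewrite !mxE !ord1 eqxx !mulr1n.
by rewrite norm_row_mx_le ?divr_ge0 1?ltW//= !ltW.
Qed.

Lemma cont_csupp_affine n (f : 'rV[R]_n -> R) (a : R) (b : 'rV[R]_n) : a != 0 ->
  cont_csupp f -> cont_csupp (fun z => f (a *: z + b)).
Proof.
move=> a0 [cf [r fr]]; split.
  move=> z; apply: continuous_comp; last exact: cf.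
  apply/continuous_forP => e e0; exists (e / `|a|).
    by rewrite divr_gt0 ?normr_gt0.
  move=> y; rewrite ltr_pdivlMr ?normr_gt0// => yz.
  by rewrite opprD addrACA subrr addr0 -scalerBr normrZ mulrC.
exists ((r + `|b|) / `|a|) => z; rewrite ltr_pdivrMr ?normr_gt0// => rz.
apply: fr; rewrite -ltrBrDr in rz; apply: lt_le_trans rz _.
by rewrite mulrC -normrZ lerB_normD.
Qed.

Lemma integral_Rn_affine_ge0 n (f : 'rV[R]_n -> R) (a : R) (b : 'rV[R]_n) : a != 0 ->
  cont_csupp f -> (forall z, 0 <= f z) ->
  integral_Rn f = integral_Rn (fun z => `|a| ^+ n * f (a *: z + b)).
Proof.
move=> a0; elim: n f b => [|n IH] f b sf f0.
  rewrite /integral_Rn; apply: eq_Rintegral => t _; rewrite expr0 mul1r.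
  by congr (f _); apply/matrixP => i -[].
rewrite (integral_RnS (sf : cont_csupp (f : 'rV_(1 + n) -> R))).
pose b0 := lsubmx (b : 'rV_(1 + n)) 0 0; pose b1 := rsubmx (b : 'rV_(1 + n)).
pose h x := integral_Rn (fun s : 'rV[R]_n => f (row_mx x%:M s)).
(* The one-dimensional substitution is available for continuous integrands, so the inner integral
   must depend continuously on the first coordinate. *)
have ch : continuous h.
  move=> x; pose K (p : R * 'rV[R]_n) := f (row_mx p.1%:M p.2).
  apply: (@continuous_integral_Rn R R^o n setT K) => //.
  - exact: openT.
  - move=> p z _; apply: continuous_comp; last exact: sf.1.
    exact: row_mx_continuous.
  move=> p _; have [_ [r fr]] := sf; exists (`|r| + 1); first by rewrite ltr_wpDl.
  near=> p' => z rz; apply: fr; rewrite ltNge; apply/negP.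
  move=> /(le_trans)/(_ (ler_norm r)); rewrite norm_row_mx_le// => /andP[_ zr].
  by have := lt_le_trans rz zr; rewrite ltNge lerDl ler01.
rewrite (_ : \int[_]_(_ in _) _ = \int[lebesgue_measure]_x h x)%R//.
rewrite (integral_affine b0 a0 ch); last by move=> x; apply: integral_Rn_ge0 => s.
have sg := cont_csupp_affine b a0 sf.
have sZ : cont_csupp (fun z : 'rV[R]_(1 + n) => `|a| ^+ n.+1 * f (a *: z + b)).
  have := @cont_csupp_comb R n.+1 _ _ (`|a| ^+ n.+1) 0 sg sg.
  by under eq_fun do rewrite mul0r addr0.
rewrite (integral_RnS sZ); apply: eq_Rintegral => x _.
rewrite /h (IH _ b1); [|exact: (cont_csupp_slice _ (sf : cont_csupp (f : 'rV_(1 + n) -> R)))|by []].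
rewrite -integral_RnZ; last first.
  have s1 := cont_csupp_affine b1 a0 (cont_csupp_slice (a * x + b0) (sf : cont_csupp (f : 'rV_(1 + n) -> R))).
  have := cont_csupp_comb (`|a| ^+ n) 0 s1 s1.
  by under eq_fun do rewrite mul0r addr0.
rewrite /integral_Rn; apply: eq_Rintegral => s _.
rewrite mulrA -exprS; congr (_ * f _).
rewrite -[in RHS](hsubmxK (b : 'rV_(1 + n))) scale_row_mx add_row_mx.
suff -> : a *: x%:M + lsubmx (b : 'rV_(1 + n)) = (a * x + b0)%:M by [].
by apply/matrixP => i j; rewrite !ord1 /b0 !mxE /= !mulr1n.
Unshelve. all: by end_near. Qed.

(** The positive and negative parts stay continuous with bounded support, and the nonnegative case
    applies to each. *)
Lemma integral_Rn_affine n (f : 'rV[R]_n -> R) (a : R) (b : 'rV[R]_n) : a != 0 ->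
  cont_csupp f ->
  integral_Rn f = `|a| ^+ n * integral_Rn (fun z => f (a *: z + b)).
Proof.
move=> a0 sf; pose fp z := Num.max (1 * f z) 0; pose fm z := Num.max (-1 * f z) 0.
have fE z : f z = 1 * fp z + (-1) * fm z.
  rewrite /fp /fm !mul1r !mulN1r; case: (leP (f z) 0) => f0.
    by rewrite max_l ?oppr_ge0// add0r opprK.
  by rewrite max_r ?oppr_le0 1?ltW// subr0.
have sp : cont_csupp fp by exact: cont_csupp_max0.
have sm : cont_csupp fm by exact: cont_csupp_max0.
have p0 z : 0 <= fp z by rewrite /fp le_max lexx orbT.
have m0 z : 0 <= fm z by rewrite /fm le_max lexx orbT.
have Z (g : 'rV[R]_n -> R) : cont_csupp g -> (forall z, 0 <= g z) ->
    integral_Rn g = `|a| ^+ n * integral_Rn (fun z => g (a *: z + b)).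
  move=> sg g0; rewrite -integral_RnZ; last exact: cont_csupp_affine.
  exact: integral_Rn_affine_ge0.
rewrite (_ : f = fun z => 1 * fp z + (-1) * fm z); last exact/funext.
rewrite integral_Rn_comb// (integral_Rn_comb _ _ (cont_csupp_affine b a0 sp) (cont_csupp_affine b a0 sm)).
by rewrite (Z _ sp p0) (Z _ sm m0); ring.
Qed.

End AffineChange.

(** * The mollifier *)

Section FlatFunction.
Context {R : realType}.
Implicit Types (p : {poly R}) (t s : R).

(** For positive [k], raise [s / k <= exp (s / k)] to the power [k]. *)
Lemma expr_le_expR (k : nat) s : 0 <= s -> s ^+ k <= k%:R ^+ k * expR s.
Proof.
move=> s0; case: k => [|k].
  by rewrite !expr0 mul1r; apply: le_trans (expR_ge1Dx s); rewrite lerDl.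
have k0 : 0 < k.+1%:R :> R by rewrite ltr0n.
have -> : expR s = expR (s / k.+1%:R) ^+ k.+1.
  by rewrite -expRM_natl mulrC divfK// gt_eqF.
have le : s <= k.+1%:R * expR (s / k.+1%:R).
  by rewrite mulrC -ler_pdivrMr//; apply: le_trans (expR_ge1Dx _); rewrite lerDr.
by rewrite -exprMn lerXn2r// nnegrE (le_trans s0).
Qed.

Lemma poly_expR_bounded p : exists2 C : R, 0 < C &
  forall s, 0 <= s -> `|p.[s] * expR (- s)| <= C.
Proof.
(* Coefficientwise from s ^ i <= i ^ i * exp s; the 1 makes the constant positive for the zero
   polynomial too. *)
exists (1 + \sum_(i < size p) `|p`_i| * i%:R ^+ i).
  by rewrite ltr_pwDl// sumr_ge0.
move=> s s0; rewrite expRN normrM normfV (gtr0_norm (expR_gt0 s)) ler_pdivrMr ?expR_gt0//.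
rewrite horner_coef (le_trans (ler_norm_sum _ _ _))// mulrDl mul1r.
apply: (@le_trans _ _ (\sum_(i < size p) `|p`_i| * i%:R ^+ i * expR s)).
  apply: ler_sum => i _; rewrite normrM -mulrA ler_wpM2l// ger0_norm ?exprn_ge0//.
  exact: expr_le_expR.
by rewrite -mulr_suml lerDr expR_ge0.
Qed.

(* Closed under differentiation, and vanishing to infinite order at 0. *)
Definition flat p t : R := if 0 < t then p.[t^-1] * expR (- t^-1) else 0.

(** A factor [t ^ 2] is traded for a larger polynomial; with the boundedness of the remaining factor
    this gives derivative 0 at 0. *)
Lemma flat_sqr p t : flat p t = t ^+ 2 * flat (p * 'X^2) t.
Proof.
rewrite /flat; case: ifPn => t0; last by rewrite mulr0.
rewrite hornerM hornerXn exprVn; field.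
by rewrite gt_eqF.
Qed.

(** With s = 1 / t, the derivative in t of p(s) exp(- s) is s ^ 2 (p(s) - p'(s)) exp(- s), which has
    the same form. *)
Lemma is_derive_flat p t : is_derive t 1 (flat p) (flat ('X^2 * (p - p^`())) t).
Proof.
have [t0|t0|t0] := ltgtP t 0.
- rewrite [X in is_derive _ _ _ X]/flat ltNge (ltW t0)/=.
  apply: near_eq_is_derive (is_derive_cst 0 t 1).
  near=> x; rewrite /flat ltNge ifF//; apply/negbTE; rewrite negbK ltW//.
  by near: x; exact: lt_nbhsl.
- rewrite [X in is_derive _ _ _ X]/flat t0.
  have Dinv : is_derive t 1 (fun y : R => y^-1) (- t ^- 2).
    have := @is_deriveV R id t 1 1 (lt0r_neq0 t0) (is_derive_id _ _).
    by move=> /is_derive_eq; apply; rewrite /= [_%:A]mulr1.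
  have Dp : is_derive t 1 (fun y : R => p.[y^-1]) (p^`().[t^-1] * (- t ^- 2)).
    exact: (is_derive_comp1 (phi := horner p) (is_derive_poly p t^-1) Dinv).
  have De : is_derive t 1 (fun y : R => expR (- y^-1)) (expR (- t^-1) * - (- t ^- 2)).
    have Dn : is_derive t 1 (fun y : R => - y^-1) (- (- t ^- 2)) by exact: is_deriveN.
    exact: (@is_derive_comp1 R R^o expR _ t 1 _ _ (is_derive_expR (- t^-1)) Dn).
  have D := is_deriveM Dp De.
  apply: (@near_eq_is_derive _ _ _ ((fun y : R => p.[y^-1]) * (fun y => expR (- y^-1)))).
    near=> x; rewrite /flat ifT//; near: x; exact: lt_nbhsr.
  apply: is_derive_eq D _; rewrite !hornerE; rewrite -!exprVn -[_ *: _]/(_ * _) -[X in _ + X]/(_ * _); ring.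
- rewrite t0 [X in is_derive _ _ _ X]/flat ltxx.
  have [C C0 CP] := poly_expR_bounded (p * 'X^2).
  have fb h : `|flat (p * 'X^2) h| <= C.
    rewrite /flat; case: ifPn => h0; last by rewrite normr0 ltW.
    by apply: CP; rewrite invr_ge0 ltW.
  apply/is_deriveP => e e0; exists (e / C); first exact: divr_gt0.
  move=> h he; rewrite [h%:A]mulr1 addr0 mulr0 subr0.
  have -> : flat p 0 = 0 by rewrite /flat ltxx.
  rewrite subr0 flat_sqr expr2 -mulrA normrM mulrC ler_wpM2r// normrM.
  apply: (@le_trans _ _ (e / C * C)); last by rewrite divfK ?gt_eqF.
  by apply: ler_pM => //; exact: ltW.
Unshelve. all: by end_near. Qed.

Lemma flat_continuous p : continuous (flat p).
Proof.
move=> t; apply: differentiable_continuous; apply/derivable1_diffP.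
by case: (is_derive_flat p t).
Qed.

Lemma Ck_along_flat (V : normedModType R) (E D : set V) k p (f : V -> R) :
  open D -> Ck_along E k D f -> Ck_along E k D (fun x => flat p (f x)).
Proof.
move=> oD; elim: k p f => [|k IH] p f Cf.
  split => // x Dx; apply: continuous_comp; first exact: Cf.1.
  exact: flat_continuous.
apply: Ck_alongS => //.
  move=> x Dx; apply: continuous_comp; first exact: Cf.1.
  exact: flat_continuous.
move=> v Ev; exists (fun x => flat ('X^2 * (p - p^`())) (f x) * 'D_v f x); last first.
  apply: Ck_along_mul => //; last exact: Ck_along_derive Ev.
  by apply: IH; exact: Ck_along_pred.
move=> x Dx; have Df := Ck_along_derivable Cf Ev Dx.
exact: (is_derive_comp1 (is_derive_flat p (f x)) Df).
Qed.

End FlatFunction.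

Section LinearFunctionals.
Context {R : realType} {V : normedModType R}.

Lemma Ck_along_linear (E D : set V) k (L : V -> R) : open D ->
  (forall x, continuous_at x L) ->
  (forall v x (h : R), L (h *: v + x) = h * L v + L x) -> Ck_along E k D L.
Proof.
move=> oD cL LE; case: k => [|k]; first by split => // x _; exact: cL.
apply: Ck_alongS => //; first by move=> x _; exact: cL.
move=> v Ev; exists (fun=> L v); last exact: Ck_along_cst.
move=> x _; apply/is_deriveP => e e0; exists 1 => // h _.
by rewrite LE addrK subrr normr0 mulr_ge0// ltW.
Qed.

End LinearFunctionals.

Section EuclideanNorm.
Context {R : realType} {n : nat}.
Implicit Types (x y : 'rV[R]_n).

Lemma sqr_enorm x : enorm x ^+ 2 = \sum_i x 0 i ^+ 2.
Proof. by rewrite sqr_sqrtr// sumr_ge0// => i _; rewrite sqr_ge0. Qed.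

Lemma enorm_ge0 x : 0 <= enorm x. Proof. exact: sqrtr_ge0. Qed.

Lemma norm_le_enorm x : `|x| <= enorm x.
Proof.
apply/rV_norm_leP => [|i]; first exact: enorm_ge0.
rewrite -sqrtr_sqr ler_sqrt; last by rewrite sumr_ge0// => j _; rewrite sqr_ge0.
by rewrite (bigD1 i)//= lerDl sumr_ge0// => j _; rewrite sqr_ge0.
Qed.

Lemma enormZ (a : R) x : enorm (a *: x) = `|a| * enorm x.
Proof.
rewrite /enorm -sqrtr_sqr -sqrtrM ?sqr_ge0// mulr_sumr; congr Num.sqrt.
by apply: eq_bigr => i _; rewrite mxE exprMn.
Qed.

Lemma enormN x : enorm (- x) = enorm x.
Proof. by rewrite -scaleN1r enormZ normrN1 mul1r. Qed.

Lemma enorm_eq0 x : (enorm x == 0) = (x == 0).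
Proof.
apply/eqP/eqP => [x0|->]; last by rewrite -(scale0r 0) enormZ normr0 mul0r.
by apply/eqP; rewrite -normr_le0 -x0 norm_le_enorm.
Qed.

Lemma enorm_gt0 x : (0 < enorm x) = (x != 0).
Proof. by rewrite lt_neqAle enorm_ge0 andbT eq_sym enorm_eq0. Qed.

Lemma coord_continuous_at i x : continuous_at x (fun y : 'rV[R]_n => y 0 i).
Proof. exact: coord_continuous. Qed.

Lemma Ck_along_sqr_enorm (E D : set 'rV[R]_n) k : open D ->
  Ck_along E k D (fun x => enorm x ^+ 2).
Proof.
move=> oD; apply: (@Ck_along_eq _ _ _ _ _ (fun x => \sum_i x 0 i * x 0 i)) => //.
  by move=> x _; rewrite sqr_enorm; apply: eq_bigr => i _; rewrite expr2.
apply: Ck_along_sum => // i.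
have C : Ck_along E k D (fun x : 'rV[R]_n => x 0 i).
  apply: Ck_along_linear => // [x|v x h]; first exact: coord_continuous_at.
  by rewrite !mxE.
exact: Ck_along_mul.
Qed.

Lemma enorm_continuous : continuous (@enorm R n).
Proof.
move=> x; have : continuous_at x (fun y => enorm y ^+ 2).
  exact: (Ck_along_continuous (Ck_along_sqr_enorm setT 0 (@openT _))).
move=> c2; have -> : @enorm R n = fun y => Num.sqrt (enorm y ^+ 2).
  by apply/funext => y; rewrite sqrtr_sqr ger0_norm// enorm_ge0.
by apply: continuous_comp; [exact: c2|exact: sqrt_continuous].
Qed.

End EuclideanNorm.

Section Bump.
Context {R : realType} {n : nat}.
Implicit Types (x : 'rV[R]_n) (e : R).

(** Writes the bump as a smooth function of the polynomial 1 - |x|^2, so that the singularity of the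
    norm at 0 never appears. *)
Lemma bumpE x : Defs.bump x = flat 1 (1 - enorm x ^+ 2).
Proof.
rewrite /Defs.bump /flat subr_gt0 expr_lt1// ?enorm_ge0// hornerC mul1r.
by case: ifP => // _; rewrite -invrN opprB.
Qed.

Lemma Ck_along_bump (E D : set 'rV[R]_n) k : open D -> Ck_along E k D (@Defs.bump R n).
Proof.
move=> oD; apply: (@Ck_along_eq _ _ _ _ _ (fun x => flat 1 (1 - enorm x ^+ 2))) => //.
  by move=> x _; rewrite bumpE.
apply: Ck_along_flat => //; apply: Ck_along_add => //; first exact: Ck_along_cst.
by apply: Ck_along_opp => //; exact: Ck_along_sqr_enorm.
Qed.

Lemma bump_ge0 x : 0 <= Defs.bump x.
Proof. by rewrite /Defs.bump; case: ifP => // _; exact: expR_ge0. Qed.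

Lemma cont_csupp_bump : cont_csupp (@Defs.bump R n).
Proof.
split; first by move=> x; exact: (Ck_along_continuous (Ck_along_bump setT 0 (@openT _))).
exists 1 => x x1; rewrite /Defs.bump ltNge (le_trans (ltW x1))//; exact: norm_le_enorm.
Qed.

Lemma integral_bump_gt0 : 0 < integral_Rn (@Defs.bump R n).
Proof.
apply: (integral_Rn_gt0 (z0 := 0) cont_csupp_bump bump_ge0).
have e0 : enorm (0 : 'rV[R]_n) = 0 by apply/eqP; rewrite enorm_eq0.
by rewrite /Defs.bump e0 ltr01 expR_gt0.
Qed.

Lemma integral_eta : integral_Rn (@eta R n) = 1.
Proof.
rewrite /eta integral_RnZ ?mulVf//; first exact: lt0r_neq0 integral_bump_gt0.
exact: cont_csupp_bump.
Qed.

Lemma eta_scaled_ge0 e x : 0 < e -> 0 <= eta_scaled e x.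
Proof.
move=> e0; rewrite /eta_scaled /eta; apply: mulr_ge0.
  by rewrite invr_ge0 exprn_ge0// ltW.
by rewrite mulr_ge0 ?bump_ge0// invr_ge0 ltW// integral_bump_gt0.
Qed.

Lemma eta_scaled_gt0 e x : 0 < e -> enorm x < e -> 0 < eta_scaled e x.
Proof.
move=> e0 xe; rewrite /eta_scaled /eta; apply: mulr_gt0.
  by rewrite invr_gt0 exprn_gt0.
apply: mulr_gt0; first by rewrite invr_gt0 integral_bump_gt0.
rewrite /Defs.bump enormZ ger0_norm ?invr_ge0 ?(ltW e0)// ltr_pdivrMl// mulr1 xe.
exact: expR_gt0.
Qed.

Lemma eta_scaled_eq0 e x : 0 < e -> e <= enorm x -> eta_scaled e x = 0.
Proof.
move=> e0 xe; rewrite /eta_scaled /eta /Defs.bump enormZ ger0_norm ?invr_ge0 ?(ltW e0)//.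
by rewrite ltr_pdivrMl// mulr1 ltNge xe/= !mulr0.
Qed.

Lemma Ck_along_eta_scaled (E : set 'rV[R]_n) k e : Ck_along E k setT (@eta_scaled R n e).
Proof.
apply: Ck_along_mul; [exact: openT|exact/Ck_along_cst/openT|].
apply: Ck_along_mul; [exact: openT|exact/Ck_along_cst/openT|].
have -> : setT = (fun x : 'rV[R]_n => e^-1 *: x) @^-1` setT by rewrite preimage_setT.
apply: (Ck_along_affine (E' := setT) (l := fun v : 'rV[R]_n => e^-1 *: v)) => //.
- exact: openT.
- exact: scaler_continuous.
- by move=> v x h _; rewrite scalerDr !scalerA mulrC.
- exact/Ck_along_bump/openT.
Qed.

Lemma eta_scaled_continuous e : continuous (@eta_scaled R n e).
Proof. by move=> x; exact: (Ck_along_continuous (Ck_along_eta_scaled setT 0 e)). Qed.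

Lemma cont_csupp_eta_scaled e : 0 < e -> cont_csupp (@eta_scaled R n e).
Proof.
move=> e0; split; first exact: eta_scaled_continuous.
exists e => x /ltW ex; apply: eta_scaled_eq0 => //.
by rewrite (le_trans ex)// norm_le_enorm.
Qed.

Lemma integral_eta_scaled e : 0 < e -> integral_Rn (@eta_scaled R n e) = 1.
Proof.
move=> e0; have e0' : e^-1 != 0 by rewrite invr_eq0 gt_eqF.
have s_eta : cont_csupp (@eta R n).
  have := cont_csupp_comb (integral_Rn (@Defs.bump R n))^-1 0 cont_csupp_bump cont_csupp_bump.
  by under eq_fun do rewrite mul0r addr0.
have := integral_Rn_affine 0 e0' s_eta; rewrite integral_eta => ->.
rewrite -integral_RnZ; last exact: cont_csupp_affine.
congr integral_Rn; apply/funext => z.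
by rewrite /eta_scaled addr0 gtr0_norm ?invr_gt0// exprVn.
Qed.

End Bump.

(** * Vertical smoothing *)

Section Gauge.
Context {R : realType} {n : nat}.
Implicit Types (y z : 'rV[R]_n) (N M f : 'rV[R]_n -> R).

Lemma asymmetric_norm0 N : asymmetric_norm N -> N 0 = 0.
Proof. by move=> [_ _ NZ _]; rewrite -(scale0r 0) NZ// mul0r. Qed.

Lemma asymmetric_norm_gt0 N y : asymmetric_norm N -> y != 0 -> 0 < N y.
Proof.
move=> [N0 N00 _ _] y0; rewrite lt_neqAle N0 andbT eq_sym.
by apply/eqP => /N00 /eqP; exact/negP.
Qed.

Definition convex_fun f : Prop := forall (t : R) y z, 0 <= t <= 1 ->
  f (t *: y + (1 - t) *: z) <= t * f y + (1 - t) * f z.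

Lemma asymmetric_norm_convex N : asymmetric_norm N -> convex_fun N.
Proof.
move=> [_ _ NZ ND] t y z /andP[t0 t1].
by rewrite (le_trans (ND _ _))// !NZ// subr_ge0.
Qed.

(** Since [f 0 < r], a convex [f] that is at most [r] at one point of a ray is strictly below [r]
    before it; hence each ray meets the level [r] at most once. *)
Lemma convex_ray_lt f y (s t r : R) : convex_fun f -> f 0 < r ->
  0 <= t < s -> f (s *: y) <= r -> f (t *: y) < r.
Proof.
move=> cf f0 /andP[t0 ts] fs; have s0 : 0 < s by exact: le_lt_trans ts.
have u01 : 0 <= t / s <= 1.
  by apply/andP; split; [rewrite divr_ge0// ltW|rewrite ler_pdivrMr// mul1r ltW].
have u1 : t / s < 1 by rewrite ltr_pdivrMr// mul1r.
have := cf (t / s) (s *: y) 0 u01; rewrite scaler0 addr0 scalerA divfK ?gt_eqF//.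
have /andP[u0 _] := u01 => le; apply: le_lt_trans le _.
have -> : r = t / s * r + (1 - t / s) * r by ring.
by rewrite ler_ltD ?ler_wpM2l// ltr_pM2l// subr_gt0.
Qed.

(** On each ray [f] starts below [r] and, being within [k] of the norm [M], reaches [r]; the
    crossing is unique by convexity. [N] is the Minkowski functional of the sublevel set, scaled by
    [r]. *)
Lemma gauge_exists f M (k r : R) : continuous f -> convex_fun f ->
  asymmetric_norm M -> (forall y, `|f y - M y| <= k) -> k < r ->
  exists N, asymmetric_norm N /\ [set y | N y = r] = [set y | f y = r].
Proof.
move=> cf vf hM fM kr.
have k0 : 0 <= k by apply: le_trans (fM 0).
have r0 : 0 < r by exact: le_lt_trans kr.
have f0 : f 0 < r.
  apply: le_lt_trans kr; have := fM 0; rewrite (asymmetric_norm0 hM) subr0.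
  exact: le_trans (ler_norm _).
have ex y : y != 0 -> exists s : R, 0 < s /\ f (s *: y) = r.
  move=> y0; have My := asymmetric_norm_gt0 hM y0.
  (* At the multiple [S] the norm [M] equals [r + k], so [f] is at least [r] there. *)
  pose S := (r + k) / M y; have S0 : 0 < S by rewrite divr_gt0// ltr_wpDr.
  have fS : r <= f (S *: y).
    have E : S * M y = r + k by rewrite /S divfK// gt_eqF.
    have [_ _ MZ _] := hM; have := fM (S *: y); rewrite (MZ _ _ (ltW S0)) E.
    by rewrite ler_distl => /andP[+ _]; rewrite addrK.
  have cg : {within `[0, S], continuous (fun s : R => f (s *: y))}.
    apply: continuous_subspaceT => s; apply: continuous_comp; last exact: cf.
    exact: scalel_continuous.
  have mi : Num.min (f (0 *: y)) (f (S *: y)) <= r <= Num.max (f (0 *: y)) (f (S *: y)).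
    by rewrite ge_min le_max scale0r (ltW f0) fS orbT.
  have [s] := IVT (ltW S0) cg mi.
  rewrite in_itv /= => /andP[s0 _] fs; exists s; split => //.
  rewrite lt_neqAle s0 andbT; apply/eqP => s_eq.
  by move: fs; rewrite -s_eq scale0r => f0r; rewrite f0r ltxx in f0.
have uniq y (s t : R) : 0 < s -> f (s *: y) = r -> 0 < t -> f (t *: y) <= r -> t <= s.
  move=> s0 fs t0 ft; rewrite leNgt; apply/negP => st.
  have := convex_ray_lt vf f0 (_ : 0 <= s < t) ft.
  by rewrite ltW//= => /(_ st); rewrite fs ltxx.
pose s y : R := get [set s | 0 < s /\ f (s *: y) = r].
have sP y : y != 0 -> 0 < s y /\ f (s y *: y) = r by move=> /ex; exact: getPex.
pose N y : R := if y == 0 then 0 else r / s y.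
have Nle y (a : R) : y != 0 -> 0 < a -> f (a *: y) <= r -> N y <= r / a.
  move=> y0 a0 fa; rewrite /N (negbTE y0) ler_pM2l// lef_pV2 ?posrE//.
    by have [? ?] := sP y y0; exact: (uniq y).
  by have [] := sP y y0.
have Neq y (a : R) : y != 0 -> 0 < a -> f (a *: y) = r -> N y = r / a.
  move=> y0 a0 fa; rewrite /N (negbTE y0); congr (_ / _).
  have [s0 fs] := sP y y0; apply/eqP; rewrite eq_le.
  by rewrite (uniq y _ _ a0 fa s0) ?fs// (uniq y _ _ s0 fs a0) ?fa.
have N_gt0 y : y != 0 -> 0 < N y.
  by move=> y0; rewrite /N (negbTE y0) divr_gt0//; have [] := sP y y0.
have N00 : N 0 = 0 by rewrite /N eqxx.
have fN y : y != 0 -> f ((r / N y) *: y) = r.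
  move=> y0; have [s0 fs] := sP y y0.
  by rewrite /N (negbTE y0) invf_div mulrC divfK ?gt_eqF.
exists N; split; first split.
- by move=> y; have [->|/N_gt0/ltW//] := eqVneq y 0; rewrite N00.
- by move=> y; have [->//|/N_gt0 Ny Ny0] := eqVneq y 0; rewrite Ny0 ltxx in Ny.
- move=> mu y; rewrite le_eqVlt => /orP[/eqP <-|mu0]; first by rewrite scale0r mul0r.
  have [->|y0] := eqVneq y 0; first by rewrite scaler0 N00 mulr0.
  rewrite (Neq (mu *: y) (r / N y / mu)).
  + by rewrite !invf_div; field; rewrite !gt_eqF// N_gt0.
  + by rewrite scaler_eq0 (negbTE y0) gt_eqF.
  + by rewrite !divr_gt0// N_gt0.
  + by rewrite scalerA divfK ?gt_eqF// fN.
- move=> y z; have [->|y0] := eqVneq y 0; first by rewrite add0r N00 add0r.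
  have [->|z0] := eqVneq z 0; first by rewrite addr0 N00 addr0.
  have [->|yz0] := eqVneq (y + z) 0; first by rewrite N00 addr_ge0// ltW// N_gt0.
  have a0 := N_gt0 _ y0; have b0 := N_gt0 _ z0.
  have ab0 : 0 < N y + N z by rewrite addr_gt0.
  rewrite -[leRHS](_ : r / (r / (N y + N z)) = _); last first.
    by rewrite invf_div mulrC divfK// gt_eqF.
  apply: Nle => //; first by rewrite divr_gt0.
  (* The point (r / (N y + N z)) (y + z) is the convex combination, with this weight, of the level
     points (r / N y) y and (r / N z) z. *)
  have t01 : 0 <= N y / (N y + N z) <= 1.
    apply/andP; split; first by rewrite divr_ge0// ltW.
    by rewrite ler_pdivrMr// mul1r lerDl ltW.
  have := vf (N y / (N y + N z)) ((r / N y) *: y) ((r / N z) *: z) t01.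
  rewrite !fN// !scalerA.
  have -> : N y / (N y + N z) * r + (1 - N y / (N y + N z)) * r = r by ring.
  have -> : N y / (N y + N z) * (r / N y) = r / (N y + N z) by field; rewrite !gt_eqF.
  have -> : (1 - N y / (N y + N z)) * (r / N z) = r / (N y + N z) by field; rewrite !gt_eqF.
  by rewrite -scalerDr addrC.
apply/seteqP; split => y /=.
  have [->|y0 Ny] := eqVneq y 0; first by rewrite N00 => rE; rewrite -rE ltxx in r0.
  by have := fN y y0; rewrite Ny divff ?gt_eqF// scale1r.
have [->|y0 fy] := eqVneq y 0; first by move=> f0r; rewrite f0r ltxx in f0.
by rewrite (Neq y 1)// ?scale1r// divr1.
Qed.

End Gauge.

Section ImplicitArith.
Context {R : realType}.

(** The arithmetic of implicit differentiation: [A] is the derivative of the equation in the unknown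
    [s], [B] its derivative in the moving direction, and the hypothesis is its first-order expansion
    between two solutions. Taking [ep <= A / 2] absorbs the term [ep * |s - s0|] and gives |s - s0|
    <= C |h|; then the expansion error and the mixed term (s - s0) h B are each at most A e / 2
    times |h|. *)
Lemma implicit_estimate (A B s0 e : R) : 0 < A -> 0 < s0 -> 0 < e ->
  exists2 ep : R, 0 < ep & exists2 d : R, 0 < d & forall s h : R,
    0 < s -> s <= 2 * s0 -> `|h| < d ->
    `|(s - s0) * A + (s * h) * B| <= ep * (`|s - s0| + `|s * h|) ->
    `|s - s0 - h * (- (s0 * B / A))| <= e * `|h|.
Proof.
move=> A0 s00 e0; pose C := 4 * s0 * (A / 2 + `|B|) / A.
have C0 : 0 < C by rewrite divr_gt0// !mulr_gt0// ltr_wpDr// divr_gt0.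
have K0 : 0 < C + 2 * s0 by rewrite addr_gt0// mulr_gt0.
have L0 : 0 < C * `|B| + 1 by rewrite ltr_wpDl// mulr_ge0// ltW.
pose ep := Num.min (A / 2) (A * e / 2 / (C + 2 * s0)).
have ep0 : 0 < ep by rewrite lt_min !divr_gt0// mulr_gt0.
exists ep => //; exists (A * e / 2 / (C * `|B| + 1)).
  by rewrite !divr_gt0// mulr_gt0.
move=> s h sp s2; rewrite ltr_pdivlMr// => hd H.
have ep1 : ep <= A / 2 by rewrite ge_min lexx.
have ep2 : ep * (C + 2 * s0) <= A * e / 2 by rewrite -ler_pdivlMr// ge_min lexx orbT.
have shE : `|s * h| = s * `|h| by rewrite normrM gtr0_norm.
rewrite shE in H.
set x := `|s - s0| in H *; set y := `|h| in H shE hd *; set b := `|B| in hd C0 L0 *.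
have x0 : 0 <= x by exact: normr_ge0.
have y0 : 0 <= y by exact: normr_ge0.
have b0 : 0 <= b by exact: normr_ge0.
have sy : s * y <= 2 * s0 * y by rewrite ler_wpM2r.
have H1 : x * A <= ep * (x + s * y) + s * y * b.
  have -> : x * A = `|((s - s0) * A + s * h * B) - s * h * B|.
    by rewrite addrK normrM (gtr0_norm A0).
  by rewrite (le_trans (ler_normB _ _))// lerD// normrM shE.
have H2 : x <= C * y.
  rewrite /C mulrAC ler_pdivlMr//.
  have e1 : ep * (x + s * y) <= A / 2 * (x + 2 * s0 * y).
    apply: ler_pM => //; first exact: ltW.
      by rewrite addr_ge0// mulr_ge0// ltW.
    by rewrite lerD.
  have e2 : s * y * b <= 2 * s0 * y * b by rewrite ler_wpM2r.
  rewrite -/b; move: H1 e1 e2; lra.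
rewrite -(ler_pM2l A0) -{1}(gtr0_norm A0) -normrM.
have -> : A * (s - s0 - h * - (s0 * B / A)) =
    ((s - s0) * A + s * h * B) - (s - s0) * h * B by field; rewrite gt_eqF.
rewrite (le_trans (ler_normB _ _))//.
have e3 : `|(s - s0) * h * B| <= C * y * (y * b).
  by rewrite -mulrA normrM normrM ler_wpM2r// mulr_ge0.
have e4 : ep * (x + s * y) <= A * e / 2 * y.
  apply: (@le_trans _ _ (ep * ((C + 2 * s0) * y))); last by rewrite mulrA ler_wpM2r.
  by rewrite ler_pM2l// mulrDl lerD.
have e5 : C * y * (y * b) <= A * e / 2 * y.
  have -> : C * y * (y * b) = (y * (C * b)) * y by ring.
  rewrite ler_wpM2r// (le_trans _ (ltW hd))// ler_wpM2l// lerDl//.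
have := lerD (le_trans H e4) (le_trans e3 e5); rewrite mulrA => le.
by apply: le_trans le _; rewrite -mulrDl; lra.
Qed.

Lemma vertical_sum n (v : 'rV[R]_n) :
  \sum_i v 0 i *: ((0, delta_mx 0 i) : 'rV[R]_n * 'rV[R]_n) = (0, v).
Proof.
rewrite [in RHS](row_sum_delta v).
rewrite (big_morph (fun w : 'rV[R]_n => (0, w) : 'rV[R]_n * 'rV[R]_n)
  (id1 := 0) (op1 := +%R)) //.
  by apply: eq_bigr => i _; rewrite -[LHS]/(v 0 i *: 0, v 0 i *: delta_mx 0 i) scaler0.
by move=> x y; rewrite -[RHS]/(0 + 0, x + y) addr0.
Qed.

End ImplicitArith.

Section Vertical.
Context {R : realType} {n : nat}.
Variables (X O : set 'rV[R]_n) (N : 'rV[R]_n * 'rV[R]_n -> R) (rU ru e w : R).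
Hypotheses (oX : open X) (OX : O `<=` X)
  (cN : forall q, X q.1 -> continuous_at q N)
  (hN : forall x, X x -> asymmetric_norm (fun y => N (x, y)))
  (Nlb : forall x y, O x -> ru * enorm y <= N (x, y))
  (Nub : forall x y, O x -> N (x, y) <= rU * enorm y)
  (ru0 : 0 < ru) (ruU : ru <= rU) (e0 : 0 < e) (e16 : e < 1 / 16)
  (w0 : 0 < w) (w16 : w < ru / (16 * rU)).
Implicit Types (x y z v : 'rV[R]_n).

Let rU0 : 0 < rU. Proof. exact: lt_le_trans ru0 ruU. Qed.

Let w1 : w < 1.
Proof.
apply: lt_le_trans w16 _; rewrite ler_pdivrMr ?mulr_gt0// mul1r.
by rewrite (le_trans ruU)// ler_peMl ?ltW// ltr1n.
Qed.

Let B : R := 2 * rU / ru.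

Let B0 : 0 < B. Proof. by rewrite /B divr_gt0// mulr_gt0. Qed.

Definition vkernel z : R := (1 - w) * eta_scaled e z + w * eta_scaled B z.

(** A bound for the integral of [rU * enorm z] against the kernel, which has mass [1 - w] within
    distance [e] and mass [w] within distance [B]. *)
Definition kappa : R := rU * (e + w * B).

Definition vaverage x y : R := integral_Rn (fun z => vkernel z * N (x, y - z)).

Lemma kappa_ge0 : 0 <= kappa.
Proof.
by apply: mulr_ge0; [exact: ltW|apply: addr_ge0; [exact: ltW|apply: mulr_ge0; exact: ltW]].
Qed.

(** The assumptions on [e] and [w] contribute 1/16 and 2/16 respectively, the 2 coming from [B]. *)
Lemma kappa_lt : kappa < 3 / 16 * rU.
Proof.
rewrite /kappa mulrC ltr_pM2r//.
have : w * B < 2 / 16.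
  rewrite /B mulrA ltr_pdivrMr// mulrCA mulrC.
  move: w16; rewrite ltr_pdivlMr ?mulr_gt0//; lra.
move: e16; lra.
Qed.

Lemma vkernel_ge0 z : 0 <= vkernel z.
Proof.
by rewrite /vkernel addr_ge0// mulr_ge0 ?eta_scaled_ge0// ?subr_ge0 ltW.
Qed.

Lemma cont_csupp_vkernel : cont_csupp vkernel.
Proof. by apply: cont_csupp_comb; apply: cont_csupp_eta_scaled. Qed.

Lemma integral_vkernel : integral_Rn vkernel = 1.
Proof.
rewrite integral_Rn_comb; [|exact: cont_csupp_eta_scaled..].
by rewrite !integral_eta_scaled//; ring.
Qed.

Lemma Ck_along_vkernel E k : Ck_along E k setT vkernel.
Proof.
have oT := @openT 'rV[R]_n.
by apply: Ck_along_add => //; apply: Ck_along_mul => //;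
  by [exact: Ck_along_cst|exact: Ck_along_eta_scaled].
Qed.

Lemma vkernel_gt0 z : enorm z < B -> 0 < vkernel z.
Proof.
move=> zB; rewrite /vkernel ltr_wpDl//; last by rewrite mulr_gt0// eta_scaled_gt0.
by rewrite mulr_ge0 ?eta_scaled_ge0// subr_ge0 ltW.
Qed.

Lemma csupp_vkernel_mul (h : 'rV[R]_n -> R) : continuous h -> cont_csupp (fun z => vkernel z * h z).
Proof.
move=> ch; have := cont_csupp_mul ch cont_csupp_vkernel.
by under eq_fun do rewrite mulrC.
Qed.

Lemma moment_vkernel (h : 'rV[R]_n -> R) : continuous h ->
  (forall z, h z <= rU * enorm z) -> integral_Rn (fun z => vkernel z * h z) <= kappa.
Proof.
move=> ch hub.
have -> : kappa = (1 - w) * (rU * e) * 1 + w * (rU * B) * 1 + w * rU * e.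
  by rewrite /kappa; ring.
have H (a : R) : 0 < a -> forall z, eta_scaled a z * h z <= rU * a * eta_scaled a z.
  move=> a0 z; rewrite mulrC; have [az|za] := leP a (enorm z).
    by rewrite eta_scaled_eq0// !mulr0.
  rewrite ler_wpM2r ?eta_scaled_ge0// (le_trans (hub z))// ler_wpM2l ?ltW//.
apply: (@le_trans _ _ ((1 - w) * (rU * e) * 1 + w * (rU * B) * 1)); last first.
  by rewrite lerDl; apply: mulr_ge0; [apply: mulr_ge0; exact: ltW|exact: ltW].
have -> : (1 - w) * (rU * e) * 1 + w * (rU * B) * 1 = integral_Rn (fun z : 'rV[R]_n =>
    (1 - w) * (rU * e) * eta_scaled e z + w * (rU * B) * eta_scaled B z).
  rewrite integral_Rn_comb; [|exact: cont_csupp_eta_scaled..].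
  by rewrite !integral_eta_scaled.
apply: le_integral_Rn.
- exact: csupp_vkernel_mul.
- by apply: cont_csupp_comb; exact: cont_csupp_eta_scaled.
move=> z; rewrite /vkernel mulrDl; apply: lerD.
  by rewrite -2!mulrA ler_wpM2l ?subr_ge0 ?(ltW w1)// H.
by rewrite -2!mulrA ler_wpM2l ?(ltW w0)// H.
Qed.

Lemma N_slice x : X x -> continuous (fun y => N (x, y)).
Proof. by move=> Xx y; apply: continuous_pair_slice; exact: cN. Qed.

Lemma N_sub_slice x y : X x -> continuous (fun z => N (x, y - z)).
Proof.
move=> Xx z; apply: (@continuous_comp _ _ _ (fun z => y - z) (fun y => N (x, y))).
  apply/continuous_forP => d d0; exists d => // z' zz.
  by rewrite opprB addrC addrA subrK distrC.
exact: N_slice.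
Qed.

(** Both inequalities average the triangle inequality against a kernel of mass one. As [N] is
    asymmetric, the moments of N (x, z) and N (x, - z) are estimated separately. *)
Lemma vaverage_dist x y : O x -> `|vaverage x y - N (x, y)| <= kappa.
Proof.
move=> Ox; have Xx := OX Ox; have [_ _ _ ND] := hN Xx.
have cNy : cont_csupp (fun z => N (x, y) * vkernel z).
  have := cont_csupp_comb (N (x, y)) 0 cont_csupp_vkernel cont_csupp_vkernel.
  by under eq_fun do rewrite mul0r addr0.
have cI := csupp_vkernel_mul (N_sub_slice (y := y) Xx).
have E : N (x, y) = integral_Rn (fun z => N (x, y) * vkernel z).
  by rewrite integral_RnZ ?integral_vkernel ?mulr1//; exact: cont_csupp_vkernel.
rewrite ler_distl; apply/andP; split.
  rewrite lerBlDr {1}E.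
  have cNz := csupp_vkernel_mul (N_slice Xx).
  apply: (@le_trans _ _ (vaverage x y + integral_Rn (fun z => vkernel z * N (x, z)))).
    rewrite -[vaverage x y]mul1r -[X in _ + X]mul1r -integral_Rn_comb//.
    apply: le_integral_Rn => //; first exact: cont_csupp_comb.
    move=> z; rewrite !mul1r -mulrDr mulrC ler_wpM2l ?vkernel_ge0//.
    by have := ND (y - z) z; rewrite subrK.
  by rewrite lerD2l moment_vkernel//; [exact: N_slice|move=> z; exact: Nub].
have cNz := csupp_vkernel_mul (N_sub_slice (y := 0) Xx).
apply: (@le_trans _ _ (N (x, y) + integral_Rn (fun z => vkernel z * N (x, 0 - z)))).
  rewrite {1}E -[X in X + _]mul1r -[X in _ + X]mul1r -integral_Rn_comb//.
  apply: le_integral_Rn => //; first exact: cont_csupp_comb.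
  move=> z; rewrite !mul1r [N (x, y) * _]mulrC -mulrDr ler_wpM2l ?vkernel_ge0//.
  by have := ND y (0 - z); rewrite sub0r.
rewrite lerD2l moment_vkernel//; first exact: N_sub_slice.
by move=> z; rewrite sub0r (le_trans (Nub _ Ox))// enormN.
Qed.

Lemma vaverage_convex x : X x -> convex_fun (vaverage x).
Proof.
move=> Xx t y z t01; rewrite /vaverage -integral_Rn_comb; [|exact/csupp_vkernel_mul/N_sub_slice..].
apply: le_integral_Rn.
- exact/csupp_vkernel_mul/N_sub_slice.
- by apply: cont_csupp_comb; exact/csupp_vkernel_mul/N_sub_slice.
move=> s; have -> : t * (vkernel s * N (x, y - s)) + (1 - t) * (vkernel s * N (x, z - s)) =
    vkernel s * (t * N (x, y - s) + (1 - t) * N (x, z - s)) by ring.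
rewrite ler_wpM2l ?vkernel_ge0//.
have := asymmetric_norm_convex (hN Xx) (y - s) (z - s) t01.
rewrite !scalerBr addrACA -opprD -scalerDl.
have -> : t + (1 - t) = 1 by ring.
by rewrite scale1r.
Qed.

(** The reflection about [y] puts [y] into the kernel and leaves the offset [a] in [N]; thus a
    second difference of the average at [y] is an integral of second differences of [N] against a
    single kernel. *)
Lemma vaverage_shift x y a : X x ->
  vaverage x (y + a) = integral_Rn (fun z => vkernel (y - z) * N (x, z + a)).
Proof.
move=> Xx; have n1 : (-1 : R) != 0 by rewrite oppr_eq0 oner_eq0.
rewrite /vaverage (integral_Rn_affine y n1); last exact/csupp_vkernel_mul/N_sub_slice.
rewrite normrN1 expr1n mul1r; congr integral_Rn; apply/funext => z.
have -> : y + a - (-1 *: z + y) = z + a.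
  by rewrite scaleN1r opprD opprK addrC addrA subrK.
by rewrite scaleN1r addrC.
Qed.

Lemma vaverageE x y : X x -> vaverage x y = integral_Rn (fun z => vkernel (y - z) * N (x, z)).
Proof.
by move=> Xx; rewrite -{1}[y]addr0 vaverage_shift//; under eq_fun do rewrite addr0.
Qed.

Definition vertical : set ('rV[R]_n * 'rV[R]_n) := [set v | v.1 = 0].

Lemma open_fst (Y : set 'rV[R]_n) : open Y -> open [set q : 'rV[R]_n * 'rV[R]_n | Y q.1].
Proof. by move=> oY; apply: open_comp => // q _; exact: cvg_fst. Qed.

Lemma vkernel_supp : exists2 r : R, 0 < r & forall z, r < `|z| -> vkernel z = 0.
Proof.
have [_ [r rP]] := cont_csupp_vkernel; exists (`|r| + 1); first by rewrite ltr_wpDl.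
move=> z rz; apply: rP; apply: le_lt_trans rz.
by rewrite (le_trans (ler_norm _))// lerDl.
Qed.

(** After the reflection, [y] occurs only in the smooth kernel and [x] only in [N]; vertical
    directions leave the latter fixed. *)
Lemma Ck_along_vaverage k :
  Ck_along vertical k [set q | X q.1] (fun q => vaverage q.1 q.2).
Proof.
have oX2 := open_fst oX.
pose K (p : ('rV[R]_n * 'rV[R]_n) * 'rV[R]_n) := vkernel (p.1.2 - p.2) * N (p.1.1, p.2).
apply: (@Ck_along_eq _ _ _ _ _ (fun q => integral_Rn (fun z => K (q, z)))) => //.
  by move=> q Xq; rewrite vaverageE.
apply: Ck_along_integral_Rn => //.
  have oX3 : open [set p : ('rV[R]_n * 'rV[R]_n) * 'rV[R]_n | X p.1.1].
    apply: (@open_comp _ _ (fun p : ('rV[R]_n * 'rV[R]_n) * 'rV[R]_n => p.1.1) X) => // p _.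
    exact: (cvg_comp _ _ cvg_fst cvg_fst).
  apply: Ck_along_mul => //.
    apply: (@Ck_along_sub _ _ setT ((fun p => p.1.2 - p.2) @^-1` setT)) => //.
    apply: (Ck_along_affine (E' := setT)
      (l := fun v : ('rV[R]_n * 'rV[R]_n) * 'rV[R]_n => v.1.2 - v.2)) => //.
    - exact: openT.
    - move=> p; apply: cvgB; last exact: cvg_snd.
      exact: (cvg_comp _ _ cvg_fst cvg_snd).
    - move=> v p h _; rewrite -[(h *: v + p).1.2]/(h *: v.1.2 + p.1.2).
      rewrite -[(h *: v + p).2]/(h *: v.2 + p.2) opprD addrACA.
      by rewrite scalerBr.
    - exact: Ck_along_vkernel.
  apply: Ck_along_invariant => //.
    move=> p Xp; apply: (@continuous_comp _ _ _
      (fun p : ('rV[R]_n * 'rV[R]_n) * 'rV[R]_n => (p.1.1, p.2)) N); last exact: cN.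
    apply/continuous_forP => d d0; exists d => // q.
    by rewrite !prod_norm_lt /= => /andP[/andP[-> _] ->].
  move=> v p [v1 v2] _; apply: filterE => h.
  rewrite -[(h *: v + p).1.1]/(h *: v.1.1 + p.1.1) -[(h *: v + p).2]/(h *: v.2 + p.2).
  by rewrite v2 (v1 : v.1.1 = 0) !scaler0 !add0r.
move=> q Xq; have [r r0 rP] := vkernel_supp; exists (r + `|q.2| + 1).
  by rewrite ltr_wpDl// addr_ge0// ltW.
near=> q' => z rz; rewrite /K rP ?mul0r//=.
have qq : `|q' - q| < 1.
  near: q'; apply/nbhs_ballP; exists 1 => //= q'.
  by rewrite -ball_normE /= distrC.
have q2 : `|q'.2| <= `|q.2| + 1.
  rewrite -[q'.2](subrK q.2) addrC (le_trans (ler_normD _ _))// lerD2l.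
  by move: qq; rewrite prod_norm_lt => /andP[_ /ltW].
rewrite distrC; apply: lt_le_trans (lerB_dist _ _).
by rewrite ltrBrDr (le_lt_trans _ rz)// -addrA lerD2l.
Unshelve. all: by end_near. Qed.

Lemma vaverage_continuous x : X x -> continuous (vaverage x).
Proof.
move=> Xx y; apply: (continuous_pair_slice (K := fun q => vaverage q.1 q.2)).
exact: (Ck_along_continuous (Ck_along_vaverage 0)).
Qed.

Lemma integral_shift (h : 'rV[R]_n -> R) (b : 'rV[R]_n) : cont_csupp h ->
  integral_Rn h = integral_Rn (fun z => h (z + b)).
Proof.
move=> sh; rewrite (integral_Rn_affine b (oner_neq0 _) sh) normr1 expr1n mul1r.
by under eq_fun do rewrite scale1r.
Qed.

Lemma vertical_shift (h : R) v (q : 'rV[R]_n * 'rV[R]_n) :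
  h *: (0, v) + q = (q.1, h *: v + q.2).
Proof. by rewrite -[LHS]/(h *: 0 + q.1, h *: v + q.2) scaler0 add0r. Qed.

(* The second differences [Dl t] of [N] need not be bounded below by a multiple of
   [t ^ 2], but their averages [A t] do: by [A_double] a bound [b] on [A t] around
   a point yields the bound [4 ^ m * b] on [A (2 ^ m * t)], which is positive. *)
Section StrictConvexity.
Variables (x y v : 'rV[R]_n).
Hypotheses (Xx : X x) (zy0 : 0 < vkernel y) (v0 : v != 0).

Let Dl (t : R) z : R := N (x, z + t *: v) + N (x, z - t *: v) - 2 * N (x, z).

Let N_add_slice b : continuous (fun z => N (x, z + b)).
Proof.
move=> z; apply: (@continuous_comp _ _ _ (fun z => z + b) (fun y => N (x, y))).
  apply/continuous_forP => d d0; exists d => // z' zz.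
  by rewrite opprD addrACA subrr addr0.
exact: N_slice.
Qed.

Let Dl_continuous t : continuous (Dl t).
Proof.
move=> z; apply: cont_sub; first by apply: cont_add; exact: N_add_slice.
by apply: cont_mul; [exact: cont_cst|exact: N_slice].
Qed.

Let Dl_ge0 t z : 0 <= Dl t z.
Proof.
have h12 : 0 <= (1 / 2 : R) <= 1 by lra.
have := asymmetric_norm_convex (hN Xx) (z + t *: v) (z - t *: v) h12.
have -> : (1 - 1 / 2) = 1 / 2 :> R by field.
rewrite -scalerDr addrACA subrr addr0 -mulr2n -[z *+ 2]scaler_nat scalerA.
have -> : 1 / 2 * 2 = 1 :> R by field.
by rewrite scale1r /Dl; lra.
Qed.

Variable d : R.
Hypothesis d0 : 0 < d.

Let th z : R := Defs.bump (d^-1 *: z).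

Let th_csupp : cont_csupp th.
Proof.
have d1 : d^-1 != 0 by rewrite invr_eq0 gt_eqF.
have := cont_csupp_affine 0 d1 (@cont_csupp_bump R n).
by under eq_fun do rewrite addr0.
Qed.

(** The average uses a bump around [a *: v]; the centre is a parameter because doubling the step
    shifts it. *)
Let A t (a : R) : R := integral_Rn (fun z => th (z - a *: v) * Dl t z).

Let th_mul_csupp (a : R) (h : 'rV[R]_n -> R) : continuous h ->
  cont_csupp (fun z => th (z - a *: v) * h z).
Proof.
move=> ch; have s1 := cont_csupp_affine (- (a *: v)) (oner_neq0 R) th_csupp.
have := cont_csupp_mul ch s1.
by under eq_fun do rewrite mulrC scale1r.
Qed.

(** The same identity holds pointwise for [Dl], with [z] shifted by [t *: v] and [- t *: v]; a
    translation of the variable moves these shifts to the centre of the bump. *)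
Let A_double t a : A (2 * t) a = A t (a + t) + 2 * A t a + A t (a - t).
Proof.
have cD b : continuous (fun z => Dl t (z + b)).
  move=> z; apply: (@continuous_comp _ _ _ (fun z => z + b) (Dl t)); last exact: Dl_continuous.
  apply/continuous_forP => r r0; exists r => // z' zz.
  by rewrite opprD addrACA subrr addr0.
have S b : A t (a + b) = integral_Rn (fun z => th (z - a *: v) * Dl t (z + b *: v)).
  have := integral_shift (b *: v) (th_mul_csupp (a + b) (@Dl_continuous t)).
  rewrite -/(A t (a + b)) => ->; apply: (congr1 (@integral_Rn R n)); apply/funext => z.
  have -> : z + b *: v - (a + b) *: v = z - a *: v.
    by rewrite scalerDl opprD addrACA subrr addr0.
  by [].
rewrite (S t) (S (- t)) /A.
have s0 := th_mul_csupp a (@Dl_continuous t).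
have s1 := th_mul_csupp a (cD (t *: v)); have s_1 := th_mul_csupp a (cD (- t *: v)).
have s2 := cont_csupp_comb 1 2 s1 s0.
transitivity (1 * (1 * integral_Rn (fun z => th (z - a *: v) * Dl t (z + t *: v)) +
    2 * integral_Rn (fun z => th (z - a *: v) * Dl t z)) +
    1 * integral_Rn (fun z => th (z - a *: v) * Dl t (z + - t *: v))); last by rewrite !mul1r.
rewrite -(integral_Rn_comb 1 2 s1 s0) -(integral_Rn_comb 1 1 s2 s_1).
apply: (congr1 (@integral_Rn R n)); apply/funext => z; rewrite /Dl.
have -> : z + (2 * t) *: v = z + t *: v + t *: v by rewrite mulr2n mulrDl mul1r scalerDl addrA.
have -> : z - (2 * t) *: v = z + (- t) *: v - t *: v.
  by rewrite mulr2n mulrDl mul1r scalerDl opprD addrA scaleNr.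
have -> : z + t *: v - t *: v = z by rewrite addrK.
have -> : z + - t *: v + t *: v = z by rewrite scaleNr subrK.
by rewrite scaleNr; ring.
Qed.

(** Each doubling costs the factor 1 + 2 + 1 = 4 and moves the centre by the current step, in total
    by at most (2 ^ m - 1) |t|. *)
Let A_iter m t a (b : R) :
  (forall a', `|a' - a| <= (2 ^+ m - 1) * `|t| -> A t a' <= b) ->
  A (2 ^+ m * t) a <= 4 ^+ m * b.
Proof.
elim: m t a b => [|m IH] t a b H.
  by rewrite !expr0 !mul1r; apply: H; rewrite !subrr normr0 mul0r.
rewrite exprSr -mulrA exprSr -mulrA; apply: IH => a' a'a; rewrite A_double.
rewrite normrM ger0_norm// in a'a.
have bnd : `|a' - a| + `|t| <= (2 ^+ m.+1 - 1) * `|t|.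
  rewrite (le_trans (lerD a'a (lexx _)))// exprS.
  by have -> : (2 ^+ m - 1) * (2 * `|t|) + `|t| = (2 * 2 ^+ m - 1) * `|t| by ring.
have H1 : A t (a' + t) <= b.
  by apply: H; rewrite addrAC (le_trans (ler_normD _ _)).
have H2 : A t a' <= b by apply: H; rewrite (le_trans _ bnd)// lerDl.
have H3 : A t (a' - t) <= b.
  by apply: H; rewrite addrAC (le_trans (ler_normB _ _)).
move: H1 H2 H3; clear H bnd a'a.
move: (A t (a' + t)) (A t a') (A t (a' - t)) => p q r; lra.
Qed.

(** The source of strict convexity: at the origin the second difference is N (x, t v) + N (x, - t
    v), which is positive. *)
Let A_gt0 t : t != 0 -> 0 < A t 0.
Proof.
move=> t0; apply: (integral_Rn_gt0 (z0 := 0)).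
- exact/th_mul_csupp/Dl_continuous.
- by move=> z; rewrite mulr_ge0// bump_ge0.
rewrite scale0r subrr; apply: mulr_gt0.
  have e0' : enorm (0 : 'rV[R]_n) = 0 by apply/eqP; rewrite enorm_eq0.
  by rewrite /th scaler0 /Defs.bump e0' ltr01 expR_gt0.
rewrite /Dl sub0r add0r (asymmetric_norm0 (hN Xx)) mulr0 subr0.
have tv : t *: v != 0 by rewrite scaler_eq0 negb_or t0.
by rewrite addr_gt0//; apply: (asymmetric_norm_gt0 (hN Xx)); rewrite ?oppr_eq0.
Qed.

Hypothesis th_vkernel : forall z, `|z| < 2 * d -> vkernel y / 2 <= vkernel (y - z).

Let Bd t := vaverage x (t *: v + y) + vaverage x (- t *: v + y) - 2 * vaverage x y.

(** The bump is at most 1 and vanishes outside the ball of radius [d] around [a *: v], hence outside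
    that of radius [2 * d] around 0, where the reflected kernel is at least [vkernel y / 2];
    elsewhere the integrand is nonnegative by convexity. *)
Let A_le t a : `|a *: v| <= d -> vkernel y / 2 * A t a <= Bd t.
Proof.
move=> ad; have sA := th_mul_csupp a (@Dl_continuous t).
have ztc b : cont_csupp (fun z => vkernel (y - z) * N (x, z + b)).
  have n1 : (-1 : R) != 0 by rewrite oppr_eq0 oner_eq0.
  have := cont_csupp_mul (N_add_slice (b := b)) (cont_csupp_affine y n1 cont_csupp_vkernel).
  by under eq_fun do rewrite mulrC scaleN1r addrC.
have -> : Bd t = integral_Rn (fun z => vkernel (y - z) * Dl t z).
  pose I b := integral_Rn (fun z => vkernel (y - z) * N (x, z + b)).
  have E b : vaverage x (b + y) = I b by rewrite addrC vaverage_shift.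
  have E0 := E 0; rewrite add0r in E0.
  rewrite /Bd (E (t *: v)) (E (- t *: v)) E0.
  transitivity (1 * (1 * I (t *: v) + 1 * I (- t *: v)) + (- 2) * I 0).
    by rewrite !mul1r mulNr.
  have s2 := cont_csupp_comb 1 1 (ztc (t *: v)) (ztc (- t *: v)).
  rewrite -(integral_Rn_comb 1 1 (ztc _) (ztc _)) -(integral_Rn_comb 1 (- 2) s2 (ztc 0)).
  by apply: (congr1 (@integral_Rn R n)); apply/funext => z; rewrite /Dl addr0 scaleNr; ring.
rewrite -integral_RnZ//; apply: le_integral_Rn.
- have := cont_csupp_comb (vkernel y / 2) 0 sA sA.
  by under eq_fun do rewrite mul0r addr0.
- have n1 : (-1 : R) != 0 by rewrite oppr_eq0 oner_eq0.
  have := cont_csupp_mul (@Dl_continuous t) (cont_csupp_affine y n1 cont_csupp_vkernel).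
  by under eq_fun do rewrite mulrC scaleN1r addrC.
move=> z; rewrite mulrA ler_wpM2r//.
have [dz|zd] := leP d (enorm (z - a *: v)).
  rewrite /th /Defs.bump enormZ gtr0_norm ?invr_gt0// ltr_pdivrMl// mulr1 ltNge dz /=.
  by rewrite mulr0 vkernel_ge0.
have th1 : th (z - a *: v) <= 1.
  rewrite /th /Defs.bump; case: ifP => // h; rewrite -[leRHS]expR0 ler_expR invr_le0.
  by rewrite subr_le0 expr_le1 ?enorm_ge0// ltW.
apply: (@le_trans _ _ (vkernel y / 2)); first by rewrite ler_piMr// ltW// divr_gt0.
apply: th_vkernel; rewrite -(subrK (a *: v) z) mulr2n mulrDl mul1r.
rewrite (le_lt_trans (ler_normD _ _))// ltr_leD// (le_lt_trans _ zd)//.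
exact: norm_le_enorm.
Qed.

Let T0 : R := d / `|v|.

Let T0_gt0 : 0 < T0. Proof. by rewrite divr_gt0// normr_gt0. Qed.

(** Starting from the step [T0 / 2 ^ m], the centres met in [A_iter] stay within [T0] of 0, so
    [A_le] applies to all of them. *)
Let Bd_lower m : vkernel y / 2 * A T0 0 <= 4 ^+ m * Bd (T0 / 2 ^+ m).
Proof.
have p0 : 0 < 2 ^+ m :> R by rewrite exprn_gt0.
have c0 : 0 < vkernel y / 2 by rewrite divr_gt0.
have := @A_iter m (T0 / 2 ^+ m) 0 (Bd (T0 / 2 ^+ m) / (vkernel y / 2)).
have -> : 2 ^+ m * (T0 / 2 ^+ m) = T0 by rewrite mulrCA mulfV ?mulr1// gt_eqF.
move=> H; rewrite mulrC -ler_pdivlMr// -mulrA; apply: H => a'.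
have tm0 : 0 < T0 / 2 ^+ m by rewrite divr_gt0.
rewrite subr0 (gtr0_norm tm0) => a'T; rewrite ler_pdivlMr// mulrC.
apply: A_le; rewrite normrZ -ler_pdivlMr ?normr_gt0//; apply: le_trans a'T _.
rewrite -/T0 mulrBl mul1r mulrCA mulfV ?gt_eqF// mulr1 gerBl.
by rewrite divr_ge0 ?ltW.
Qed.

Lemma vaverage_second_derivative_bound :
  exists2 k : R, 0 < k & forall r : R, 0 < r -> exists2 s : R, `|s| < r &
    k <= 'D_(0, v) ('D_(0, v) (fun q => vaverage q.1 q.2)) (s *: (0, v) + (x, y)).
Proof.
(* The factor 4 ^ m of [Bd_lower] times the squared step is [T0 ^+ 2], so the constant does not
   depend on [m]. *)
exists (vkernel y / 2 * A T0 0 / T0 ^+ 2).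
  by rewrite divr_gt0 ?exprn_gt0// mulr_gt0 ?divr_gt0// A_gt0 ?gt_eqF.
move=> r r0; pose m := Num.bound (T0 / r).
have mP : T0 / r < m%:R by apply: archi_boundP; rewrite divr_ge0 ?ltW.
have p0 : 0 < 2 ^+ m :> R by rewrite exprn_gt0.
pose t := T0 / 2 ^+ m; have t0 : 0 < t by rewrite divr_gt0.
have tr : t < r.
  rewrite /t ltr_pdivrMr// mulrC -ltr_pdivrMr//; apply: lt_le_trans mP _.
  by rewrite -natrX ler_nat ltnW// ltn_expl.
have Ev : vertical (0, v) by [].
have C2 := Ck_along_vaverage 2.
have XD (s : R) : [set q : 'rV[R]_n * 'rV[R]_n | X q.1] (s *: (0, v) + (x, y)).
  by rewrite vertical_shift.
pose f2 (q : 'rV[R]_n * 'rV[R]_n) := vaverage q.1 q.2.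
have df (s : R) : derivable f2 (s *: (0, v) + (x, y)) (0, v).
  by have [] := Ck_along_derivable C2 Ev (XD s).
have ddf (s : R) : derivable ('D_(0, v) f2) (s *: (0, v) + (x, y)) (0, v).
  by have [] := Ck_along_derivable (Ck_along_derive C2 Ev) Ev (XD s).
have [s st sE] := second_difference (fun s (_ : `|s| <= `|t|) => df s) (fun s _ => ddf s).
exists s; first by rewrite (le_lt_trans st)// gtr0_norm.
have Bt : Bd t = t ^+ 2 * 'D_(0, v) ('D_(0, v) (fun q => vaverage q.1 q.2)) (s *: (0, v) + (x, y)).
  by rewrite -sE /Bd (vertical_shift t) (vertical_shift (- t)).
have := Bd_lower m; rewrite -/t Bt /t => le.
rewrite ler_pdivrMr ?exprn_gt0//; apply: le_trans le _.
have -> : 4 = 2 ^+ 2 :> R by rewrite expr2; ring.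
rewrite -exprM mulnC exprM mulrA -exprMn mulrCA mulfV ?gt_eqF// mulr1.
by rewrite mulrC.
Qed.

End StrictConvexity.

Lemma vaverage_strictly_convex x y v : X x -> 0 < vkernel y -> v != 0 ->
  0 < 'D_(0, v) ('D_(0, v) (fun q => vaverage q.1 q.2)) (x, y).
Proof.
move=> Xx zy0 v0.
have [_ cont_z] : True /\ continuous vkernel by split => //; case: cont_csupp_vkernel.
have [r r0 rP] := (continuous_forP _ _).1 (cont_z y) _ (divr_gt0 zy0 (@ltr0n R 2)).
have d0 : 0 < r / 2 by rewrite divr_gt0.
have th_vkernel z : `|z| < 2 * (r / 2) -> vkernel y / 2 <= vkernel (y - z).
  rewrite mulrCA mulfV// mulr1 => zr.
  have /rP : `|(y - z) - y| < r by rewrite addrAC subrr add0r normrN.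
  rewrite ltr_norml => /andP[+ _]; lra.
have [k k0 kP] := vaverage_second_derivative_bound Xx zy0 v0 d0 th_vkernel.
(* A nonpositive value at [(x, y)] would, by continuity, keep the second derivative below [k]
   nearby, against [kP]. *)
rewrite ltNge; apply/negP => le0.
have Ev : vertical (0, v) by [].
have cD : continuous_at (x, y) ('D_(0, v) ('D_(0, v) (fun q => vaverage q.1 q.2))).
  exact: (Ck_along_continuous (Ck_along_derive (Ck_along_derive (Ck_along_vaverage 2) Ev) Ev)).
have [e' e'0 e'P] := (continuous_forP _ _).1 cD k k0.
have v1 : 0 < `|(0, v) : 'rV[R]_n * 'rV[R]_n| + 1 by rewrite ltr_wpDl.
have [s sr] := kP (e' / (`|(0, v) : 'rV[R]_n * 'rV[R]_n| + 1)) (divr_gt0 e'0 v1).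
rewrite ltr_pdivlMr// in sr.
have /e'P : `|s *: (0, v) + (x, y) - (x, y)| < e'.
  by rewrite addrK normrZ (le_lt_trans _ sr)// ler_wpM2l// lerDl.
move=> /(le_lt_trans (ler_norm _)); rewrite ltrBlDr => lt ks.
by have := le_lt_trans ks lt; rewrite ltrDl ltNge le0.
Qed.

Lemma open_neq0 (W : normedModType R) : open [set y : W | y != 0].
Proof.
rewrite (_ : [set y : W | y != 0] = (fun y : W => `|y|) @^-1` [set r : R | 0 < r]).
  by apply: open_comp; [move=> y _; exact: norm_continuous|exact: open_gt].
by apply/seteqP; split => y /=; rewrite normr_gt0.
Qed.

Lemma vaverage_gauge_exists x : O x ->
  exists N', asymmetric_norm N' /\ [set y | N' y = rU] = [set y | vaverage x y = rU].
Proof.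
move=> Ox; apply: (gauge_exists (M := fun y => N (x, y)) (k := kappa)).
- exact/vaverage_continuous/OX.
- exact/vaverage_convex/OX.
- exact/hN/OX.
- by move=> y; exact: vaverage_dist.
- by apply: lt_trans kappa_lt _; rewrite gtr_pMl//; lra.
Qed.

(** * The gauge of the level set as an implicit function *)

Variable G : 'rV[R]_n -> 'rV[R]_n -> R.
Hypotheses (oO : open O) (hG : forall x, O x -> asymmetric_norm (G x))
  (hGs : forall x, O x -> [set y | G x y = rU] = [set y | vaverage x y = rU]).

Let D0 : set ('rV[R]_n * 'rV[R]_n) := [set q | O q.1 /\ q.2 != 0].

Let oD0 : open D0.
Proof.
rewrite (_ : D0 = [set q | O q.1] `&` (snd @^-1` [set y | y != 0])) //.
apply: openI; first exact: open_fst.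
by apply: open_comp => [q _|]; [exact: cvg_snd|exact: open_neq0].
Qed.

(** The multiple of [q.2] that lies on the level set: a scalar unknown along each ray, from which
    [GE] recovers the gauge. *)
Let S (q : 'rV[R]_n * 'rV[R]_n) : R := rU / G q.1 q.2.

Let S_gt0 q : D0 q -> 0 < S q.
Proof. by move=> [Oq q0]; rewrite divr_gt0//; exact: asymmetric_norm_gt0 (hG Oq) q0. Qed.

Let GE q : D0 q -> G q.1 q.2 = rU / S q.
Proof.
move=> [Oq q0]; have := asymmetric_norm_gt0 (hG Oq) q0 => G0.
by rewrite /S invf_div mulrC divfK// gt_eqF.
Qed.

Let vaverageS q : D0 q -> vaverage q.1 (S q *: q.2) = rU.
Proof.
move=> Dq; have [Oq q0] := Dq; have [_ _ GZ _] := hG Oq.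
have G0 := asymmetric_norm_gt0 (hG Oq) q0.
suff : [set y | G q.1 y = rU] (S q *: q.2) by rewrite hGs.
by rewrite /= (GZ _ _ (ltW (S_gt0 Dq))) divfK// gt_eqF.
Qed.

Let vaverage0 x : O x -> vaverage x 0 < rU.
Proof.
move=> Ox; apply: (@le_lt_trans _ _ kappa).
  have := vaverage_dist 0 Ox; rewrite (asymmetric_norm0 (hN (OX Ox))) subr0.
  exact: le_trans (ler_norm _).
by apply: lt_trans kappa_lt _; rewrite gtr_pMl//; lra.
Qed.

(** At the level point [S (x, y) *: y] the average is [rU] and [N] differs from it by at most
    [kappa]; homogeneity carries the comparison back to [y]. *)
Lemma gauge_bounds x y : O x ->
  rU * N (x, y) <= (rU + kappa) * G x y /\ (rU - kappa) * G x y <= rU * N (x, y).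
Proof.
move=> Ox; have hNx := hN (OX Ox); have [_ _ NZ _] := hNx.
have [->|y0] := eqVneq y 0.
  by rewrite (asymmetric_norm0 hNx) (asymmetric_norm0 (hG Ox)) !mulr0.
have Dq : D0 (x, y) by [].
have S0 := S_gt0 Dq; have G0 := asymmetric_norm_gt0 (hG Ox) y0.
have := vaverage_dist (S (x, y) *: y) Ox.
rewrite (vaverageS Dq) (NZ _ _ (ltW S0)) distrC ler_distl => /andP[le1 le2].
have SG : S (x, y) * G x y = rU by rewrite /S divfK// gt_eqF.
split.
  by rewrite -[X in X * N _]SG mulrAC ler_pM2r// -lerBlDr.
by rewrite -[X in X * N _]SG mulrAC ler_pM2r.
Qed.

(** On the level set, ru |y| <= N <= rU + kappa < 2 rU, so the point lies in the open ball of radius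
    [B]. *)
Let vkernel_S q : D0 q -> 0 < vkernel (S q *: q.2).
Proof.
move=> Dq; have [Oq q0] := Dq; apply: vkernel_gt0; rewrite /B ltr_pdivlMr// mulrC.
apply: le_lt_trans (Nlb _ Oq) _.
have := vaverage_dist (S q *: q.2) Oq; rewrite vaverageS// distrC ler_distl => /andP[_].
by have := kappa_lt; have := rU0; lra.
Qed.

Let vaverage2 (q : 'rV[R]_n * 'rV[R]_n) := vaverage q.1 q.2.
Let T (q : 'rV[R]_n * 'rV[R]_n) := (q.1, S q *: q.2).

Let XT q : D0 q -> [set q' : 'rV[R]_n * 'rV[R]_n | X q'.1] (T q). Proof. by move=> [/OX]. Qed.

Let vert v : vertical (0, v). Proof. by []. Qed.

Let oX2 : open [set q : 'rV[R]_n * 'rV[R]_n | X q.1]. Proof. exact: open_fst. Qed.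

Let radial_arith (a c l t r : R) : a <= r - t * c ->
  - (c / 2 * t) <= a - r - - t * l -> t * l <= 0 -> 0 < t * c -> False.
Proof. lra. Qed.

(** The nondegeneracy of the implicit equation. The average at 0 is below [rU] by [g], so by
    convexity stepping back by [t] along the ray lowers it by at least [t * (g / S q)], which a
    nonpositive derivative would forbid. *)
Let radial_gt0 q : D0 q -> 0 < 'D_(0, q.2) vaverage2 (T q).
Proof.
move=> Dq; have [Oq q0] := Dq; have S0 := S_gt0 Dq.
have /is_deriveP dv : is_derive (T q) (0, q.2) vaverage2 ('D_(0, q.2) vaverage2 (T q)).
  have D1 := Ck_along_derivable (Ck_along_vaverage 1) (@vert q.2).
  have D2 := D1 _ (XT Dq); exact: D2.
have vaverageT : vaverage2 (T q) = rU := vaverageS Dq.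
set l := 'D_(0, q.2) vaverage2 (T q).
pose g := rU - vaverage q.1 0; have g0 : 0 < g by rewrite subr_gt0 vaverage0.
have e1 : 0 < g / S q / 2 by apply: divr_gt0 => //; apply: divr_gt0.
have [d d0 dP] := dv _ e1.
pose t := Num.min (d / 2) (S q).
have t0 : 0 < t by rewrite lt_min divr_gt0.
have td : `|- t| < d.
  by rewrite normrN gtr0_norm// gt_min ltr_pdivrMr// ltr_pMr// ltr1n.
have tS : t <= S q by rewrite ge_min lexx orbT.
have := dP _ td.
rewrite vaverageT -/l.
have -> : vaverage2 (- t *: (0, q.2) + T q) = vaverage q.1 ((S q - t) *: q.2).
  by rewrite vertical_shift /vaverage2 /= -scalerDl [- t + _]addrC.
have u01 : 0 <= (S q - t) / S q <= 1.
  apply/andP; split; first by apply: divr_ge0; [rewrite subr_ge0|exact: ltW].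
  by rewrite ler_pdivrMr// mul1r gerBl ltW.
have := vaverage_convex (OX Oq) (S q *: q.2) 0 u01.
rewrite scaler0 addr0 scalerA divfK ?gt_eqF// vaverageS// => le1.
rewrite normrN (gtr0_norm t0) ler_norml => /andP[+ _] => le2.
have c0 : 0 < g / S q by apply: divr_gt0.
have E : (S q - t) / S q * rU + (1 - (S q - t) / S q) * vaverage q.1 0 = rU - t * (g / S q).
  by rewrite /g; field; rewrite gt_eqF.
rewrite E in le1; rewrite ltNge; apply/negP => l0.
have tl : t * l <= 0 by apply: mulr_ge0_le0 => //; exact: ltW.
have tc : 0 < t * (g / S q) by apply: mulr_gt0.
exact: radial_arith le1 le2 tl tc.
Qed.

(** Being below or above the level at a fixed multiple of [q.2] is an open condition on [q], and
    uniqueness on rays turns these conditions into bounds on [S]. *)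
Let S_continuous q : D0 q -> continuous_at q S.
Proof.
move=> Dq; have [Oq q0] := Dq; have S0 := S_gt0 Dq.
have ray_lt q' (t : R) : D0 q' -> 0 <= t -> vaverage q'.1 (t *: q'.2) < rU -> t < S q'.
  move=> Dq' t0 lt; rewrite ltNge; apply/negP; rewrite le_eqVlt => /orP[/eqP St|St].
    by move: lt; rewrite -St (vaverageS Dq') ltxx.
  have := convex_ray_lt (vaverage_convex (OX Dq'.1)) (vaverage0 Dq'.1) (_ : 0 <= S q' < t) (ltW lt).
  by rewrite St ltW ?S_gt0//= => /(_ isT); rewrite (vaverageS Dq') ltxx.
have ray_gt q' (t : R) : D0 q' -> rU < vaverage q'.1 (t *: q'.2) -> 0 <= t -> S q' < t.
  move=> Dq' lt t0; rewrite ltNge; apply/negP; rewrite le_eqVlt => /orP[/eqP St|St].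
    by move: lt; rewrite St (vaverageS Dq') ltxx.
  have SS : vaverage q'.1 (S q' *: q'.2) <= rU by rewrite (vaverageS Dq').
  have := convex_ray_lt (vaverage_convex (OX Dq'.1)) (vaverage0 Dq'.1) (_ : 0 <= t < S q') SS.
  by rewrite St t0 => /(_ isT) lt'; have := lt_trans lt lt'; rewrite ltxx.
have cvt (t : R) : continuous_at q (fun q' => vaverage q'.1 (t *: q'.2)).
  apply: (@continuous_comp _ _ _ (fun q' : 'rV[R]_n * 'rV[R]_n => (q'.1, t *: q'.2)) vaverage2).
    apply/continuous_forP => d d0; have t1 : 0 < `|t| + 1 by rewrite ltr_wpDl.
    exists (Num.min d (d / (`|t| + 1))); first by rewrite lt_min d0 divr_gt0.
    move=> q'; rewrite lt_min ltr_pdivlMr// => /andP[]; rewrite !prod_norm_lt /=.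
    move=> /andP[-> _] qd; rewrite -scalerBr normrZ mulrC.
    apply: le_lt_trans qd; rewrite ler_pM// ?lerDl//.
    by rewrite prod_normE le_max lexx orbT.
  exact: (Ck_along_continuous (Ck_along_vaverage 0) (OX Oq : [set q : 'rV[R]_n * 'rV[R]_n | X q.1] (q.1, t *: q.2))).
have nD : \forall q' \near q, D0 q' by exact: open_nbhs_nbhs.
apply/cvgrPdist_lt => d d0.
(* Truncated at 0 because the comparison on rays concerns nonnegative multiples. *)
pose t1 := Num.max 0 (S q - d / 2); pose t2 := S q + d / 2.
have d2 : 0 < d / 2 by rewrite divr_gt0.
have t10 : 0 <= t1 by rewrite le_max lexx.
have t20 : 0 <= t2 by rewrite addr_ge0 ?ltW.
have t1S : 0 <= t1 < S q by rewrite t10 gt_max S0 ltrBlDr ltrDl.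
have SS : vaverage q.1 (S q *: q.2) <= rU by rewrite (vaverageS Dq).
have v1 := convex_ray_lt (vaverage_convex (OX Oq)) (vaverage0 Oq) t1S SS.
have v2 : rU < vaverage q.1 (t2 *: q.2).
  rewrite ltNge; apply/negP => le.
  have := convex_ray_lt (vaverage_convex (OX Oq)) (vaverage0 Oq) (_ : 0 <= S q < t2) le.
  by rewrite (ltW S0) /t2 ltrDl d2 => /(_ isT); rewrite (vaverageS Dq) ltxx.
have n1 : \forall q' \near q, vaverage q'.1 (t1 *: q'.2) < rU.
  exact: (cvgr_lt _ (cvt t1) _ v1).
have n2 : \forall q' \near q, rU < vaverage q'.1 (t2 *: q'.2).
  exact: (cvgr_gt _ (cvt t2) _ v2).
near=> q'; have Dq' : D0 q' by near: q'.
have lo : t1 < S q' by apply: ray_lt => //; near: q'.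
have hi : S q' < t2 by apply: ray_gt => //; near: q'.
have lo' : S q - d / 2 < S q' by apply: le_lt_trans lo; rewrite le_max lexx orbT.
rewrite distrC ltr_distl; apply/andP; split.
  by apply: lt_trans lo'; rewrite ltrD2l ltrN2 ltr_pdivrMr// ltr_pMr// ltr1n.
by apply: lt_trans hi _; rewrite /t2 ltrD2l ltr_pdivrMr// ltr_pMr// ltr1n.
Unshelve. all: by end_near. Qed.

Implicit Types (p q : 'rV[R]_n * 'rV[R]_n).
Let verticalE (v : 'rV[R]_n * 'rV[R]_n) : vertical v -> v = (0, v.2).
Proof. by case: v => a b; rewrite /vertical /= => ->. Qed.

(** The radial derivative is written over fixed directions, since the radial direction varies with
    [q] and regularity is known for derivatives along fixed vectors. *)
Let A_ q : R := \sum_i q.2 0 i * 'D_(0, delta_mx 0 i) vaverage2 (T q).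

Let vaverage2_derivable v p : X p.1 -> derivable vaverage2 p (0, v).
Proof.
move=> Xp; have D1 := Ck_along_derivable (Ck_along_vaverage 1) (@vert v).
by have [] := D1 p Xp.
Qed.

Let dvc2_continuous v p : X p.1 -> continuous_at p ('D_(0, v) vaverage2).
Proof.
move=> Xp; have C := Ck_along_derive (Ck_along_vaverage 1) (@vert v).
exact: (Ck_along_continuous C Xp).
Qed.

Let dvc2_sum v p : X p.1 ->
  'D_(0, v) vaverage2 p = \sum_i v 0 i * 'D_(0, delta_mx 0 i) vaverage2 p.
Proof.
move=> Xp.
suff [] : is_derive p (0, v) vaverage2 (\sum_i v 0 i * 'D_(0, delta_mx 0 i) vaverage2 p) by [].
rewrite -(vertical_sum v); apply: (is_derive_lincomb (fun i => v 0 i) oX2 Xp).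
  by move=> i y Xy; exact: vaverage2_derivable.
by move=> i; exact: dvc2_continuous.
Qed.

Let A_gt0 q : D0 q -> 0 < A_ q.
Proof. by move=> Dq; rewrite /A_ -dvc2_sum; [exact: radial_gt0|exact: XT]. Qed.

Let S_shift_cvg q v : D0 q -> forall d : R, 0 < d -> exists2 r : R, 0 < r &
  forall h : R, `|h| < r -> D0 (h *: (0, v) + q) /\ `|S (h *: (0, v) + q) - S q| < d.
Proof.
move=> Dq d d0; have [r r0 rP] := (continuous_forP _ _).1 (S_continuous Dq) d d0.
have [r' r'0 r'P] := open_normP oD0 Dq.
have nq : \forall p \near q, D0 p /\ `|S p - S q| < d.
  apply/nbhs_ballP; exists (Num.min r r'); first by rewrite /= lt_min r0.
  move=> p; rewrite -ball_normE /= distrC lt_min => /andP[/rP ? /r'P].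
  by [].
have /nbhs_ballP[r2 /= r20 r2P] := near_line (0, v) nq.
by exists r2 => // h hr; apply: r2P; rewrite -ball_normE /= sub0r normrN.
Qed.

(* [S] solves [vaverage x (S q *: y) = rU], and [A_] is the radial derivative of [vaverage2]. *)
Let is_derive_S q v : D0 q ->
  is_derive q (0, v) S (- (S q * 'D_(0, v) vaverage2 (T q) / A_ q)).
Proof.
move=> Dq; have S0 := S_gt0 Dq; have A0 := A_gt0 Dq.
apply/is_deriveP => e' e'0.
set Bv := 'D_(0, v) vaverage2 (T q).
have [ep ep0 [d d0 dP]] := implicit_estimate Bv A0 S0 e'0.
(* Between [q] and [h *: (0, v) + q] the level point moves by (s - S q) times the radial vector plus
   s h times [v]; these two directions are the ones to expand in. *)
pose a (b : bool) : 'rV[R]_n * 'rV[R]_n := if b then (0, q.2) else (0, v).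
have da b p : [set q : 'rV[R]_n * 'rV[R]_n | X q.1] p -> derivable vaverage2 p (a b).
  by move=> Xy; case: b; exact: vaverage2_derivable.
have ca b : {for T q, continuous ('D_(a b) vaverage2)}.
  by case: b; apply: dvc2_continuous; exact: XT.
have [r r0 rP] := increment_estimate oX2 (XT Dq) da ca ep0.
have S2 : 0 < 2 * S q by rewrite mulr_gt0.
(* A change of [S] below [S q] gives the bound [s <= 2 * S q] required by [implicit_estimate]. *)
have m0 : 0 < Num.min (S q) r by rewrite lt_min S0.
have [r2 r20 r2P] := S_shift_cvg v Dq m0.
exists (Num.min r2 (Num.min d (r / (2 * S q)))).
  by rewrite !lt_min r20 d0 divr_gt0.
move=> h; rewrite !lt_min => /and3P[/r2P[Dh Sh] hd hr].
rewrite ltr_pdivlMr// in hr.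
set s := S (h *: (0, v) + q).
have s_gt0 : 0 < s by exact: S_gt0.
move: Sh; rewrite lt_min -/s => /andP[Sh1 Sh2].
have s2 : s <= 2 * S q.
  move: Sh1; rewrite ltr_distl => /andP[_ /ltW]; rewrite mulr2n mulrDl mul1r.
  by [].
apply: dP => //.
pose t (b : bool) : R := if b then s - S q else s * h.
have tr b : `|t b| < r.
  case: b => //=; rewrite normrM (gtr0_norm s_gt0); apply: le_lt_trans hr.
  by rewrite mulrC ler_wpM2l.
have := rP t tr; rewrite !big_bool /=.
have -> : (s - S q) *: (0, q.2) + (s * h) *: (0, v) + T q = T (h *: (0, v) + q).
  have sE : S (q.1, h *: v + q.2) = s by rewrite /s vertical_shift.
  rewrite -addrA (vertical_shift (s * h)) (vertical_shift (s - S q)) /T (vertical_shift h) /=.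
  rewrite sE; congr (_, _).
  by rewrite scalerBl scalerDr scalerA addrCA subrK.
have -> : vaverage2 (T (h *: (0, v) + q)) = rU := vaverageS Dh.
have -> : vaverage2 (T q) = rU := vaverageS Dq.
have AE : 'D_(0, q.2) vaverage2 (T q) = A_ q := @dvc2_sum q.2 (T q) (XT Dq).
by rewrite subrr sub0r normrN AE.
Qed.

Let Ck_along_coord2 k i : Ck_along vertical k D0 (fun q : 'rV[R]_n * 'rV[R]_n => q.2 0 i).
Proof.
apply: Ck_along_linear => //.
  move=> q; apply: (@continuous_comp _ _ _ (fun q : 'rV[R]_n * 'rV[R]_n => q.2) (fun y : 'rV[R]_n => y 0 i)).
    exact: cvg_snd.
  exact: coord_continuous_at.
by move=> v q h; rewrite -[(h *: v + q).2]/(h *: v.2 + q.2) !mxE.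
Qed.

Let Ck_along_T k (f : 'rV[R]_n * 'rV[R]_n -> R) : Ck_along vertical k D0 S ->
  Ck_along vertical k [set q | X q.1] f -> Ck_along vertical k D0 (f \o T).
Proof.
move=> CS Cf.
apply: (Ck_along_comp (a := fun i => (0, delta_mx 0 i)) (E' := vertical)
  (D' := [set q : 'rV[R]_n * 'rV[R]_n | X q.1])
  (c := fun i (q : 'rV[R]_n * 'rV[R]_n) => S q * q.2 0 i)).
- exact: oD0.
- exact: oX2.
- by move=> q /XT.
- by move=> i; exact: vert.
- move=> q Dq; apply/continuous_forP => e' e'0.
  have cSi : continuous_at q (fun q => S q *: q.2).
    apply: (@cvgZ _ _ _ _ _ S (fun q => q.2)); first exact: S_continuous.
    exact: cvg_snd.
  have [d d0 dP] := (continuous_forP _ _).1 cSi e' e'0.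
  exists (Num.min d e'); first by rewrite lt_min d0.
  move=> p; rewrite lt_min => /andP[/dP pd]; rewrite !prod_norm_lt /=.
  by move=> /andP[-> _].
- move=> v q v1 Dq; rewrite (verticalE v1).
  apply: filterE => h.
  have := vertical_sum (S (h *: (0, v.2) + q) *: (h *: v.2 + q.2) - S q *: q.2).
  rewrite /T !vertical_shift /= => E.
  have -> : \sum_i (S (q.1, h *: v.2 + q.2) * (h *: v.2 + q.2) 0 i - S q * q.2 0 i) *:
     ((0, delta_mx 0 i) : 'rV[R]_n * 'rV[R]_n) =
     (0, S (q.1, h *: v.2 + q.2) *: (h *: v.2 + q.2) - S q *: q.2).
    by rewrite -E; apply: eq_bigr => i _; rewrite !mxE.
  by rewrite -[RHS]/(0 + q.1, _ + _) add0r subrK.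
- by move=> i; apply: (Ck_along_mul oD0 CS); exact: Ck_along_coord2.
- exact: Cf.
Qed.

(** A bootstrap: the derivative of [S] is built from [S], [A_] and derivatives of the average along
    [T], so each order of regularity of [S] yields that of [A_] and then the next order of [S]. *)
Let Ck_along_S_A k : Ck_along vertical k D0 S /\ Ck_along vertical k D0 A_.
Proof.
have CA m : Ck_along vertical m D0 S -> Ck_along vertical m D0 A_.
  move=> CS; apply: Ck_along_sum => // i; apply: Ck_along_mul => //.
  apply: (Ck_along_T (f := 'D_(0, delta_mx 0 i) vaverage2) CS).
  exact: (Ck_along_derive (Ck_along_vaverage m.+1) (@vert _)).
suff CS : Ck_along vertical k D0 S by split=> //; exact: CA.
elim: k => [|k IH]; first by split => // q; exact: S_continuous.
apply: Ck_alongS; [exact: oD0|by move=> q; exact: S_continuous|].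
move=> v v1; rewrite (verticalE v1).
exists (fun q => - (S q * ('D_(0, v.2) vaverage2 \o T) q / A_ q)).
  by move=> q Dq; exact: is_derive_S.
apply: Ck_along_opp => //; apply: Ck_along_mul => //.
  apply: Ck_along_mul => //; apply: (Ck_along_T (f := 'D_(0, v.2) vaverage2) IH).
  exact: (Ck_along_derive (Ck_along_vaverage k.+1) (@vert _)).
apply: Ck_along_inv => //; last exact: CA.
by move=> q Dq; rewrite gt_eqF// A_gt0.
Qed.

Lemma Ck_along_gauge k : Ck_along vertical k D0 (fun q => G q.1 q.2).
Proof.
have [CS _] := Ck_along_S_A k.
apply: (@Ck_along_eq _ _ _ _ _ (fun q => rU * (S q)^-1)) => //.
  by move=> q Dq; rewrite GE.
apply: Ck_along_mul => //; first exact: Ck_along_cst.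
by apply: Ck_along_inv => // q Dq; rewrite gt_eqF// S_gt0.
Qed.

Let g q : R := G q.1 q.2.

Let near_D0 q : D0 q -> \forall p \near q, D0 p.
Proof. by move=> Dq; exact: open_nbhs_nbhs. Qed.

Let derive_zero (f : 'rV[R]_n * 'rV[R]_n -> R) (c : R) q v (l : R) :
  D0 q -> (forall p, D0 p -> f p = c) -> is_derive q (0, v) f l -> l = 0.
Proof.
move=> Dq fc [_ <-]; rewrite (@near_eq_derive _ _ _ f (cst c)); last first.
  by apply: filterS (near_D0 Dq) => p /fc.
exact: derive_cst.
Qed.

Let dg q v : D0 q -> is_derive q (0, v) g ('D_(0, v) g q).
Proof.
move=> Dq; have D1 := Ck_along_derivable (Ck_along_gauge 1) (@vert v).
exact: D1 q Dq.
Qed.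

Let ddg q v : D0 q -> is_derive q (0, v) ('D_(0, v) g) ('D_(0, v) ('D_(0, v) g) q).
Proof.
move=> Dq; have C := Ck_along_derive (Ck_along_gauge 2) (@vert v).
have D1 := Ck_along_derivable C (@vert v).
exact: D1 q Dq.
Qed.

Let dS q v : D0 q -> is_derive q (0, v) S ('D_(0, v) S q).
Proof.
move=> Dq; have D1 := Ck_along_derivable (Ck_along_S_A 1).1 (@vert v).
exact: D1 q Dq.
Qed.

Let ddS q v : D0 q -> is_derive q (0, v) ('D_(0, v) S) ('D_(0, v) ('D_(0, v) S) q).
Proof.
move=> Dq; have C := Ck_along_derive (Ck_along_S_A 2).1 (@vert v).
have D1 := Ck_along_derivable C (@vert v).
exact: D1 q Dq.
Qed.

Let half_arith (a b c : R) : a <= 1 / 2 * b + 1 / 2 * c -> 0 <= b + c - 2 * a.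
Proof. lra. Qed.

Let g_second_ge0 q v : D0 q -> 0 <= 'D_(0, v) ('D_(0, v) g) q.
Proof.
move=> Dq; have [Oq _] := Dq.
apply: (second_derivative_ge oD0 Dq).
- by move=> p /(dg v)[].
- by move=> p /(ddg v)[].
- have C := Ck_along_derive (Ck_along_derive (Ck_along_gauge 2) (@vert v)) (@vert v).
  exact: (Ck_along_continuous C Dq).
move=> r r0; exists (r / 2).
  by rewrite gtr0_norm ?divr_gt0//= ltr_pdivrMr// ltr_pMr// ltr1n.
rewrite mul0r (vertical_shift (r / 2)) (vertical_shift (- (r / 2))) /g /=.
have h12 : 0 <= (1 / 2 : R) <= 1 by lra.
have := asymmetric_norm_convex (hG Oq) (r / 2 *: v + q.2) (- (r / 2) *: v + q.2) h12.
have -> : (1 - 1 / 2) = 1 / 2 :> R by field.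
rewrite -scalerDr addrACA -scalerDl subrr scale0r add0r -mulr2n -[q.2 *+ 2]scaler_nat scalerA.
have -> : 1 / 2 * 2 = 1 :> R by field.
rewrite scale1r.
exact: half_arith.
Qed.

Let product_second_arith (g0 ddS0 dS0 dg0 S0 ddg0 : R) : dS0 = 0 -> dg0 = 0 ->
  g0 * ddS0 + dS0 * dg0 + (S0 * ddg0 + dg0 * dS0) = 0 -> S0 * ddg0 = - (g0 * ddS0).
Proof. by move=> -> ->; rewrite !mul0r !addr0 addrC => /eqP; rewrite addr_eq0 => /eqP. Qed.

Let product_first_arith (g0 dS0 dg0 S0 : R) : dg0 = 0 -> 0 < g0 -> g0 * dS0 + S0 * dg0 = 0 -> dS0 = 0.
Proof.
move=> -> g_gt0; rewrite mulr0 addr0 => /eqP; rewrite mulf_eq0 => /orP[/eqP g0E|/eqP//].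
by rewrite g0E ltxx in g_gt0.
Qed.

Let implicit_first_arith (A0 S0 B0' dS0 : R) : 0 < A0 -> dS0 = - (S0 * B0' / A0) -> A0 * dS0 + S0 * B0' = 0.
Proof. by move=> A_gt0' ->; field; rewrite gt_eqF. Qed.

Let implicit_second_arith (A0 ddS0 dS0 dA0 S0 dB0 B0' c0 : R) : dS0 = 0 -> 0 < A0 -> 0 < S0 -> 0 < c0 ->
  dB0 = S0 * c0 ->
  A0 * ddS0 + dS0 * dA0 + (S0 * dB0 + B0' * dS0) = 0 -> ddS0 < 0.
Proof.
move=> -> Ap Sp cp ->; rewrite mul0r mulr0 !addr0 => /eqP.
rewrite addr_eq0 => /eqP E; rewrite -(pmulr_rlt0 _ Ap) E oppr_lt0.
by apply: mulr_gt0 => //; apply: mulr_gt0.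
Qed.

Let scaled_coord_arith (S0 v0 y0 dS0 : R) : dS0 = 0 -> S0 * v0 + y0 * dS0 = S0 * v0.
Proof. by move=> ->; rewrite mulr0 addr0. Qed.

Let sqr_second_arith (g0 dg0 ddg0 S0 ddS0 : R) : 0 < g0 -> 0 <= ddg0 -> 0 < S0 ->
  (dg0 = 0 -> S0 * ddg0 = - (g0 * ddS0) /\ ddS0 < 0) ->
  0 < g0 * ddg0 + dg0 * dg0 + (g0 * ddg0 + dg0 * dg0).
Proof.
move=> gp ddp Sp H; have [d0|d0] := eqVneq dg0 0.
  have [E ddS_lt0] := H d0; have g3 : 0 < ddg0.
    by rewrite -(pmulr_rgt0 _ Sp) E oppr_gt0 pmulr_rlt0.
  by rewrite d0 mul0r !addr0 addr_gt0// mulr_gt0.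
have g3 : 0 < dg0 * dg0 by rewrite -expr2 exprn_even_gt0.
by rewrite addr_gt0// ltr_wpDl// mulr_ge0// ltW.
Qed.

(** Differentiate the constant product [g * S = rU] once and twice; the cross terms disappear where
    [g] is critical. *)
Let gS_second q v : D0 q -> 'D_(0, v) g q = 0 ->
  'D_(0, v) S q = 0 /\
  S q * 'D_(0, v) ('D_(0, v) g) q = - (g q * 'D_(0, v) ('D_(0, v) S) q).
Proof.
move=> Dq g0.
have E1 p : D0 p -> g p * 'D_(0, v) S p + S p * 'D_(0, v) g p = 0.
  move=> Dp; apply: (derive_zero Dp (_ : forall p, D0 p -> (g * S) p = rU)).
    by move=> p' Dp'; rewrite /= -[(g * S) p']/(g p' * S p') /g GE// divfK// gt_eqF// S_gt0.
  exact: is_deriveM (dg v Dp) (dS v Dp).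
have S0 : 'D_(0, v) S q = 0 := product_first_arith g0 (asymmetric_norm_gt0 (hG Dq.1) Dq.2) (E1 q Dq).
split; first exact: S0.
have E2 : g q * 'D_(0, v) ('D_(0, v) S) q + 'D_(0, v) S q * 'D_(0, v) g q +
    (S q * 'D_(0, v) ('D_(0, v) g) q + 'D_(0, v) g q * 'D_(0, v) S q) = 0.
  exact: derive_zero Dq E1 (is_deriveD (is_deriveM (dg v Dq) (ddS v Dq))
   (is_deriveM (dS v Dq) (ddg v Dq))).
exact: product_second_arith S0 g0 E2.
Qed.

(** Differentiate A_ dS + S Bv = 0 once more along [v]. Where [S] is critical this leaves A_ ddS = -
    S dBv, and dBv is [S q] times the second derivative of the average, positive by strict
    convexity. *)
Let S_second q v : D0 q -> v != 0 -> 'D_(0, v) S q = 0 ->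
  'D_(0, v) ('D_(0, v) S) q < 0.
Proof.
move=> Dq v0 S0; have Sq := S_gt0 Dq; have Aq := A_gt0 Dq.
pose Bv := 'D_(0, v) vaverage2 \o T.
have E1 p : D0 p -> A_ p * 'D_(0, v) S p + S p * Bv p = 0.
  by move=> Dp; have [_ E] := is_derive_S v Dp; exact: implicit_first_arith (A_gt0 Dp) E.
have CB := Ck_along_derive (Ck_along_vaverage 2) (@vert v).
have dB : is_derive q (0, v) Bv ('D_(0, v) Bv q).
  have CBT := Ck_along_T (Ck_along_S_A 1).1 CB.
  have D1 := Ck_along_derivable CBT (@vert v).
  exact: D1 q Dq.
have dA : is_derive q (0, v) A_ ('D_(0, v) A_ q).
  have D1 := Ck_along_derivable (Ck_along_S_A 1).2 (@vert v).
  exact: D1 q Dq.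
have E2 : A_ q * 'D_(0, v) ('D_(0, v) S) q + 'D_(0, v) S q * 'D_(0, v) A_ q +
    (S q * 'D_(0, v) Bv q + Bv q * 'D_(0, v) S q) = 0.
  exact: derive_zero Dq E1 (is_deriveD (is_deriveM dA (ddS v Dq)) (is_deriveM (dS v Dq) dB)).
(* Since [S] is critical along [v], the fibre component of [T] has velocity [S q *: v], and the
   chain rule gives the factor [S q]. *)
have BvE : 'D_(0, v) Bv q = S q * 'D_(0, v) ('D_(0, v) vaverage2) (T q).
  pose c i p : R := S p * p.2 0 i.
  have dc i : is_derive q (0, v) (c i) (S q * v 0 i).
    have d2 : is_derive q (0, v) (fun p => p.2 0 i) (v 0 i).
      apply/is_deriveP => e' e'0; exists 1 => // h _.
      by rewrite (vertical_shift h) /= !mxE addrK subrr normr0 mulr_ge0// ltW.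
    have D3 : is_derive q (0, v) (c i) (S q * v 0 i + q.2 0 i * 'D_(0, v) S q).
      exact: is_deriveM (dS v Dq) d2.
    have E3 := scaled_coord_arith (S q) (v 0 i) (q.2 0 i) S0.
    by apply: (is_derive_eq D3); exact: E3.
  have D1 p i : [set q : 'rV[R]_n * 'rV[R]_n | X q.1] p ->
      derivable ('D_(0, v) vaverage2) p (0, delta_mx 0 i).
    by move=> Xy; have [] := Ck_along_derivable CB (@vert (delta_mx 0 i)) Xy.
  have D2 i : continuous_at (T q) ('D_(0, delta_mx 0 i) ('D_(0, v) vaverage2)).
    have C := Ck_along_derive CB (@vert (delta_mx 0 i)).
    exact: (Ck_along_continuous C (XT Dq)).
  have [_ e1] : is_derive q (0, v) Bv
     (\sum_i 'D_(0, v) (c i) q * 'D_(0, delta_mx 0 i) ('D_(0, v) vaverage2) (T q)).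
    apply: (is_derive_chain (a := fun i => (0, delta_mx 0 i)) oX2 (XT Dq)).
    - by move=> i y; exact: D1.
    - by move=> i; exact: D2.
    - by move=> i; have [] := dc i.
    - apply: filterE => h.
      have := vertical_sum (S (h *: (0, v) + q) *: (h *: v + q.2) - S q *: q.2).
      rewrite /T !vertical_shift /= => E.
      have -> : \sum_i (c i (q.1, h *: v + q.2) - c i q) *:
         ((0, delta_mx 0 i) : 'rV[R]_n * 'rV[R]_n) =
         (0, S (q.1, h *: v + q.2) *: (h *: v + q.2) - S q *: q.2).
        by rewrite -E; apply: eq_bigr => i _; rewrite /c !mxE.
      by rewrite -[RHS]/(0 + q.1, _ + _) add0r subrK.
  have [_ e2] : is_derive (T q) (0, v) ('D_(0, v) vaverage2)
      (\sum_i v 0 i * 'D_(0, delta_mx 0 i) ('D_(0, v) vaverage2) (T q)).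
    have D3 := is_derive_lincomb (fun i => v 0 i) oX2 (XT Dq) (fun i p => @D1 p i) D2.
    by rewrite (vertical_sum v) in D3.
  have e4 : S q * 'D_(0, v) ('D_(0, v) vaverage2) (T q) =
      S q * \sum_i v 0 i * 'D_(0, delta_mx 0 i) ('D_(0, v) vaverage2) (T q).
    exact: (congr1 (fun z : R => S q * z) e2).
  apply: (etrans e1); apply: etrans (esym e4).
  rewrite mulr_sumr; apply: eq_bigr => i _; have [_ e3] := dc i.
  by rewrite e3 mulrA.
have pos : 0 < 'D_(0, v) ('D_(0, v) vaverage2) (T q).
  exact: (vaverage_strictly_convex (OX Dq.1) (vkernel_S Dq) v0).
exact: implicit_second_arith S0 Aq Sq pos BvE E2.
Qed.

(* Either [G] has a nonzero derivative along [v], whose square is positive, or [S]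
   is critical along [v], and then the strict convexity of [vaverage] makes its second
   derivative negative. *)
Lemma gauge_sqr_convex q v : D0 q -> v != 0 ->
  0 < 'D_(0, v) ('D_(0, v) (fun p => G p.1 p.2 ^+ 2)) q.
Proof.
move=> Dq v0; have gq : 0 < g q by exact: asymmetric_norm_gt0 (hG Dq.1) Dq.2.
have -> : 'D_(0, v) ('D_(0, v) (fun p => G p.1 p.2 ^+ 2)) q =
    'D_(0, v) (fun p => g p * 'D_(0, v) g p + g p * 'D_(0, v) g p) q.
  apply: near_eq_derive; apply: filterS (near_D0 Dq) => p Dp.
  have [_ <-] : is_derive p (0, v) (fun p => g p ^+ 2)
      (g p * 'D_(0, v) g p + g p * 'D_(0, v) g p).
    exact: is_deriveM (dg v Dp) (dg v Dp).
  by [].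
have d1 := is_deriveM (dg v Dq) (ddg v Dq).
have [_ ->] : is_derive q (0, v) (fun p => g p * 'D_(0, v) g p + g p * 'D_(0, v) g p)
    (g q * 'D_(0, v) ('D_(0, v) g) q + 'D_(0, v) g q * 'D_(0, v) g q +
     (g q * 'D_(0, v) ('D_(0, v) g) q + 'D_(0, v) g q * 'D_(0, v) g q)).
  exact: (is_deriveD d1 d1).
apply: (sqr_second_arith gq (g_second_ge0 v Dq) (S_gt0 Dq)) => g0.
have [S0 SE] := gS_second Dq g0.
split; [exact: SE|exact: S_second Dq v0 S0].
Qed.

End Vertical.

(** * Horizontal smoothing *)

Section EnormTriangle.
Context {R : realType} {n : nat}.
Implicit Types (x y : 'rV[R]_n).

Lemma enorm_cauchy_schwarz x y : \sum_i x 0 i * y 0 i <= enorm x * enorm y.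
Proof.
set b := \sum_i _.
have [x0|x0] := eqVneq x 0.
  rewrite /b big1 ?mulr_ge0 ?enorm_ge0// => i _.
  by rewrite x0 mxE mul0r.
have a0 : 0 < enorm x ^+ 2 by rewrite exprn_gt0// enorm_gt0.
(* This is the squared length of b x - |x|^2 y, equal to |x|^2 (|x|^2 |y|^2 - b^2). *)
have H : 0 <= \sum_i (b * x 0 i - enorm x ^+ 2 * y 0 i) ^+ 2.
  by rewrite sumr_ge0// => i _; rewrite sqr_ge0.
have E : \sum_i (b * x 0 i - enorm x ^+ 2 * y 0 i) ^+ 2 =
   enorm x ^+ 2 * ((enorm x * enorm y) ^+ 2 - b ^+ 2).
  have E' c d : \sum_i (c * x 0 i - d * y 0 i) ^+ 2 =
      c ^+ 2 * \sum_i x 0 i ^+ 2 - 2 * c * d * \sum_i x 0 i * y 0 i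
      + d ^+ 2 * \sum_i y 0 i ^+ 2.
    by rewrite !mulr_sumr -sumrB -big_split /=; apply: eq_bigr => i _; ring.
  by rewrite E' -!sqr_enorm -/b; ring.
rewrite E pmulr_rge0// subr_ge0 in H.
have xy0 : 0 <= enorm x * enorm y by rewrite mulr_ge0// enorm_ge0.
apply: le_trans (ler_norm _) _.
by rewrite -(ger0_norm xy0) -ler_sqr ?nnegrE// !real_normK ?num_real.
Qed.

Lemma enorm_triangle x y : enorm (x + y) <= enorm x + enorm y.
Proof.
have s0 : 0 <= enorm x + enorm y by rewrite addr_ge0// enorm_ge0.
rewrite -ler_sqr ?nnegrE ?enorm_ge0//.
have -> : (enorm x + enorm y) ^+ 2 = enorm x ^+ 2 + 2 * (enorm x * enorm y) + enorm y ^+ 2.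
  by ring.
rewrite !sqr_enorm.
have -> : \sum_i (x + y) 0 i ^+ 2 =
    \sum_i x 0 i ^+ 2 + 2 * \sum_i x 0 i * y 0 i + \sum_i y 0 i ^+ 2.
  by rewrite mulr_sumr -!big_split /=; apply: eq_bigr => i _; rewrite mxE; ring.
by rewrite lerD2r lerD2l ler_pM2l// enorm_cauchy_schwarz.
Qed.

End EnormTriangle.

Section LocalSmoothing.
Context {R : realType} {n : nat}.
Variables (O : set 'rV[R]_n) (G : 'rV[R]_n -> 'rV[R]_n -> R) (p : R).
Implicit Types (x y z v : 'rV[R]_n) (q : 'rV[R]_n * 'rV[R]_n).

Let D0 : set ('rV[R]_n * 'rV[R]_n) := [set q | O q.1 /\ q.2 != 0].

Hypotheses (oO : open O) (p0 : 0 < p) (hG : forall z, O z -> asymmetric_norm (G z))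
  (CG : forall k, Ck_along (@vertical R n) k D0 (fun q => G q.1 q.2))
  (DDG : forall q v, D0 q -> v != 0 ->
     0 < 'D_(0, v) ('D_(0, v) (fun q => G q.1 q.2 ^+ 2)) q).

(* The points around which the closed ball of radius [p] stays in [O]. *)
Definition deep : set 'rV[R]_n :=
  [set x | \forall x' \near x, forall z, enorm (x' - z) <= p -> O z].

Definition hsmooth x y : R :=
  integral_Rn (fun z => eta_scaled p (x - z) * G z y ^+ 2).

Let DW : set ('rV[R]_n * 'rV[R]_n) := [set q | deep q.1 /\ q.2 != 0].

Lemma open_deep : open deep.
Proof. by rewrite openE => x /near_join. Qed.

Let deepP x z : deep x -> enorm (x - z) <= p -> O z.
Proof. by move=> /nbhs_singleton; apply. Qed.

Let deep_self x : deep x -> O x.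
Proof.
move=> dx; apply: (deepP dx); rewrite subrr.
by rewrite (_ : enorm 0 = 0) ?(ltW p0)//; apply/eqP; rewrite enorm_eq0.
Qed.

Let oDW : open DW.
Proof.
rewrite (_ : DW = [set q | deep q.1] `&` (snd @^-1` [set y | y != 0])) //.
apply: openI; first by apply: open_fst; exact: open_deep.
by apply: open_comp => [q _|]; [exact: cvg_snd|exact: open_neq0].
Qed.

Let oD0 : open D0.
Proof.
rewrite (_ : D0 = [set q | O q.1] `&` (snd @^-1` [set y | y != 0])) //.
apply: openI; first exact: open_fst.
by apply: open_comp => [q _|]; [exact: cvg_snd|exact: open_neq0].
Qed.

Let H q : R := G q.1 q.2 ^+ 2.

Let CH k : Ck_along (@vertical R n) k D0 H.
Proof.
apply: (@Ck_along_eq _ _ _ _ _ (fun q => G q.1 q.2 * G q.1 q.2)) => //.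
by apply: Ck_along_mul => //; exact: CG.
Qed.

Let K (r : ('rV[R]_n * 'rV[R]_n) * 'rV[R]_n) : R :=
  eta_scaled p (r.1.1 - r.2) * H (r.2, r.1.2).

Let dirs : set (('rV[R]_n * 'rV[R]_n) * 'rV[R]_n) := [set w | setT w.1 /\ w.2 = 0].

Let oin : open [set r : ('rV[R]_n * 'rV[R]_n) * 'rV[R]_n | D0 (r.2, r.1.2)].
Proof.
apply: (@open_comp _ _ (fun r : ('rV[R]_n * 'rV[R]_n) * 'rV[R]_n => (r.2, r.1.2)) D0) => // r _.
apply/continuous_forP => d d0; exists d => // r'.
by rewrite !prod_norm_lt /= => /andP[/andP[_ ->] ->].
Qed.

Let oout : open [set r : ('rV[R]_n * 'rV[R]_n) * 'rV[R]_n | p < enorm (r.1.1 - r.2)].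
Proof.
apply: (@open_comp _ _ (fun r : ('rV[R]_n * 'rV[R]_n) * 'rV[R]_n => enorm (r.1.1 - r.2))
   [set s | p < s]); last exact: open_gt.
move=> r _; apply: (@continuous_comp _ _ _
   (fun r : ('rV[R]_n * 'rV[R]_n) * 'rV[R]_n => r.1.1 - r.2) (@enorm R n)).
  apply: cvgB; last exact: cvg_snd.
  exact: (cvg_comp _ _ cvg_fst cvg_fst).
exact: enorm_continuous.
Qed.

Let K_out r : p < enorm (r.1.1 - r.2) -> K r = 0.
Proof. by move=> pr; rewrite /K eta_scaled_eq0// ?mul0r// ltW. Qed.

Let Ck_eta k : Ck_along dirs k [set r | D0 (r.2, r.1.2)] (fun r => eta_scaled p (r.1.1 - r.2)).
Proof.
apply: (@Ck_along_sub _ _ setT ((fun r => r.1.1 - r.2) @^-1` setT)) => //.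
apply: (Ck_along_affine (E' := setT)
  (l := fun v : ('rV[R]_n * 'rV[R]_n) * 'rV[R]_n => v.1.1 - v.2)) => //.
- exact: openT.
- move=> r; apply: cvgB; last exact: cvg_snd.
  exact: (cvg_comp _ _ cvg_fst cvg_fst).
- move=> v r h _; rewrite -[(h *: v + r).1.1]/(h *: v.1.1 + r.1.1).
  by rewrite -[(h *: v + r).2]/(h *: v.2 + r.2) opprD addrACA scalerBr.
- exact: Ck_along_eta_scaled.
Qed.

(** With [z] fixed, moving [(x, y)] moves [(z, y)] only vertically; the vertical regularity of [G]
    therefore suffices in all directions of [dirs]. *)
Let Ck_H k : Ck_along dirs k [set r | D0 (r.2, r.1.2)] (fun r => H (r.2, r.1.2)).
Proof.
apply: (Ck_along_affine (E' := @vertical R n) (D' := D0)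
  (L := fun r : ('rV[R]_n * 'rV[R]_n) * 'rV[R]_n => (r.2, r.1.2))
  (l := fun v : ('rV[R]_n * 'rV[R]_n) * 'rV[R]_n => (v.2, v.1.2))) => //.
- move=> r; apply/continuous_forP => d d0; exists d => // r'.
  by rewrite !prod_norm_lt /= => /andP[/andP[_ ->] ->].
- by move=> v [_ v2].
Qed.

(** [G z] is arbitrary for [z] outside [O]. Either [z] lies in the closed ball around [x], hence in
    [O], and the product rule applies, or [K] vanishes identically around the point. *)
Let Ck_K k : Ck_along dirs k [set r | DW r.1] K.
Proof.
apply: Ck_along_local => -[[x y] z] [/= dx y0].
have [xz|zx] := leP (enorm (x - z)) p.
  exists [set r | D0 (r.2, r.1.2)]; first by split => //=; exact: deepP xz.
  exact: (Ck_along_mul oin (Ck_eta k) (Ck_H k)).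
exists [set r : ('rV[R]_n * 'rV[R]_n) * 'rV[R]_n | p < enorm (r.1.1 - r.2)] => //.
apply: (@Ck_along_eq _ _ _ _ _ (fun=> 0)) => //; last exact: Ck_along_cst.
by move=> r /K_out.
Qed.

Let supp_K : locally_csupp DW K.
Proof.
move=> q Dq; exists (`|q.1| + 1 + p); first by rewrite ltr_wpDl// addr_ge0.
near=> q' => z rz; apply: K_out => /=.
have qq : `|q' - q| < 1.
  near: q'; apply/nbhs_ballP; exists 1 => //= q'.
  by rewrite -ball_normE /= distrC.
have q1 : `|q'.1| <= `|q.1| + 1.
  rewrite -[q'.1](subrK q.1) addrC (le_trans (ler_normD _ _))// lerD2l.
  by move: qq; rewrite prod_norm_lt => /andP[/ltW].
apply: lt_le_trans (norm_le_enorm _); rewrite distrC.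
apply: lt_le_trans (lerB_dist _ _).
by rewrite ltrBrDl (le_lt_trans _ rz)// addrC [leRHS]addrC lerD2l.
Unshelve. all: by end_near. Qed.

Lemma Ck_along_hsmooth k : Ck_along setT k DW (fun q => hsmooth q.1 q.2).
Proof. exact: (Ck_along_integral_Rn oDW (Ck_K k) supp_K). Qed.

Let Kslice q : DW q -> cont_csupp (fun z => K (q, z)).
Proof.
move=> Dq; have [r r0 rP] := supp_K Dq; split.
  move=> z; apply: continuous_pair_slice.
  exact: (Ck_along_continuous (Ck_K 0)).
by exists r; exact: (nbhs_singleton rP).
Qed.

Let eta0 : 0 < eta_scaled p (0 : 'rV[R]_n).
Proof.
apply: eta_scaled_gt0 => //.
by rewrite (_ : enorm 0 = 0)//; apply/eqP; rewrite enorm_eq0.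
Qed.

Lemma hsmooth_ge0 x y : 0 <= hsmooth x y.
Proof. by apply: integral_Rn_ge0 => z; rewrite mulr_ge0 ?sqr_ge0// eta_scaled_ge0. Qed.

Lemma hsmooth_gt0 x y : deep x -> y != 0 -> 0 < hsmooth x y.
Proof.
move=> dx y0; apply: (integral_Rn_gt0 (z0 := x)).
- exact: (@Kslice (x, y)).
- by move=> z; rewrite mulr_ge0 ?sqr_ge0// eta_scaled_ge0.
by rewrite subrr mulr_gt0// exprn_gt0// (asymmetric_norm_gt0 (hG (deep_self dx))).
Qed.

Lemma hsmoothZ x y (a : R) : deep x -> 0 < a -> hsmooth x (a *: y) = a ^+ 2 * hsmooth x y.
Proof.
(* [Kslice] gives integrability off zero only. At zero the integrand vanishes and is written as a
   multiple of the bump, whose integral is under control. *)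
move=> dx a0; have [->|y0] := eqVneq y 0.
  have z0 : hsmooth x 0 = integral_Rn (fun z : 'rV[R]_n => 0 * Defs.bump z).
    apply: (congr1 (@integral_Rn R n)); apply/funext => z; rewrite mul0r.
    have [xz|zx] := ltP (enorm (x - z)) p.
      by rewrite (asymmetric_norm0 (hG (deepP dx (ltW xz)))) expr0n mulr0.
    by rewrite eta_scaled_eq0// mul0r.
  by rewrite scaler0 z0 integral_RnZ ?mul0r ?mulr0//; exact: cont_csupp_bump.
rewrite -integral_RnZ; last exact: (@Kslice (x, y)).
apply: (congr1 (@integral_Rn R n)); apply/funext => z.
have [xz|zx] := ltP (enorm (x - z)) p; last by rewrite eta_scaled_eq0// !mul0r mulr0.
have [_ _ GZ _] := hG (deepP dx (ltW xz)).
by rewrite (GZ _ _ (ltW a0)) exprMn mulrCA.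
Qed.

Lemma hsmooth0 x : deep x -> hsmooth x 0 = 0.
Proof.
(* Scaling by 2 fixes the zero vector, so the value is four times itself. *)
move=> dx; have := hsmoothZ 0 dx (ltr0Sn R 1); rewrite scaler0.
by move: (hsmooth x 0) => a; lra.
Qed.

Lemma hsmooth_near x y (c d : R) : deep x -> y != 0 ->
  (forall z, enorm (x - z) < p -> `|G z y ^+ 2 - c| <= d) -> `|hsmooth x y - c| <= d.
Proof.
move=> dx y0 Hd.
have n1 : (-1 : R) != 0 by rewrite oppr_eq0 oner_eq0.
have se := cont_csupp_affine x n1 (cont_csupp_eta_scaled (n := n) p0).
have ie : integral_Rn (fun z => eta_scaled p (-1 *: z + x)) = 1.
  have := integral_Rn_affine x n1 (cont_csupp_eta_scaled (n := n) p0).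
  by rewrite integral_eta_scaled// normrN1 expr1n mul1r.
have eE z : eta_scaled p (-1 *: z + x) = eta_scaled p (x - z) by rewrite scaleN1r addrC.
have Ks := @Kslice (x, y) (conj dx y0).
have cE (a : R) : a = integral_Rn (fun z => a * eta_scaled p (-1 *: z + x)).
  by rewrite integral_RnZ// ie mulr1.
have sa (a : R) : cont_csupp (fun z => a * eta_scaled p (-1 *: z + x)).
  have := cont_csupp_comb a 0 se se.
  by under eq_fun do rewrite mul0r addr0.
rewrite ler_distl; apply/andP; split.
  rewrite [leLHS]cE; apply: le_integral_Rn => // z; rewrite eE mulrC.
  have [xz|zx] := ltP (enorm (x - z)) p; last by rewrite eta_scaled_eq0// !mul0r.
  by rewrite ler_wpM2l ?eta_scaled_ge0//; have := Hd z xz; rewrite ler_distl => /andP[].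
rewrite [leRHS]cE; apply: le_integral_Rn => // z; rewrite eE [leRHS]mulrC.
have [xz|zx] := ltP (enorm (x - z)) p; last by rewrite eta_scaled_eq0// !mul0r.
by rewrite ler_wpM2l ?eta_scaled_ge0//; have := Hd z xz; rewrite ler_distl => /andP[].
Qed.

(** Both vertical derivatives pass under the integral and fall on the square of [G]; the integrand
    is then nonnegative, and positive at [z = x]. *)
Lemma hsmooth_convex x y v : deep x -> y != 0 -> v != 0 ->
  0 < 'D_(0, v) ('D_(0, v) (fun q => hsmooth q.1 q.2)) (x, y).
Proof.
move=> dx y0 v0; have Dq : DW (x, y) by [].
have Ev : dirs ((0, v), 0) by [].
have CK1 := Ck_along_derive (Ck_K 2) Ev.
have sK1 : locally_csupp DW ('D_((0, v), 0) K) by exact: locally_csupp_derive supp_K.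
have -> : 'D_(0, v) ('D_(0, v) (fun q => hsmooth q.1 q.2)) (x, y) =
   'D_(0, v) (fun q => integral_Rn (fun z => 'D_((0, v), 0) K (q, z))) (x, y).
  apply: near_eq_derive.
  have : \forall q \near ((x, y) : 'rV[R]_n * 'rV[R]_n), DW q by exact: open_nbhs_nbhs.
  apply: filterS => q Dq'.
  by have [_ <-] := is_derive_integral_Rn oDW (Ck_K 1) supp_K (I : setT (0, v)) Dq'.
have [_ ->] := is_derive_integral_Rn oDW CK1 sK1 (I : setT (0, v)) Dq.
have CK2 := Ck_along_derive CK1 Ev.
have sK2 := locally_csupp_derive (0, v) sK1.
have E_out z : p < enorm (x - z) -> 'D_((0, v), 0) ('D_((0, v), 0) K) ((x, y), z) = 0.
  move=> pz; have C0 : Ck_along dirs 2 [set r | p < enorm (r.1.1 - r.2)] (fun=> 0 : R).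
    exact: Ck_along_cst.
  have n0 r : p < enorm (r.1.1 - r.2) -> 'D_((0, v), 0) K r = 0.
    move=> pr; rewrite (@near_eq_derive _ _ _ K (cst 0)); first exact: derive_cst.
    have : \forall r' \near r, p < enorm (r'.1.1 - r'.2) by exact: (open_nbhs_nbhs (conj oout pr)).
    by apply: filterS => r' /K_out.
  rewrite (@near_eq_derive _ _ _ ('D_((0, v), 0) K) (cst 0)); first exact: derive_cst.
  have := open_nbhs_nbhs (conj oout (pz : _ (((x, y), z) : ('rV[R]_n * 'rV[R]_n) * 'rV[R]_n))).
  by apply: filterS => r' /n0.
have E_in z : O z -> 'D_((0, v), 0) ('D_((0, v), 0) K) ((x, y), z) =
    eta_scaled p (x - z) * 'D_(0, v) ('D_(0, v) H) (z, y).
  move=> Oz; have Dzy : D0 (z, y) by [].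
  have shift (h : R) (r : ('rV[R]_n * 'rV[R]_n) * 'rV[R]_n) :
      h *: ((0, v), 0) + r = ((r.1.1, h *: v + r.1.2), r.2).
    rewrite -[LHS]/((h *: 0 + r.1.1, h *: v + r.1.2), h *: 0 + r.2).
    by rewrite !scaler0 !add0r.
  have vert : vertical ((0, v) : 'rV[R]_n * 'rV[R]_n) by [].
  have step (F : 'rV[R]_n * 'rV[R]_n -> R) (r : ('rV[R]_n * 'rV[R]_n) * 'rV[R]_n) :
      Ck_along (@vertical R n) 1 D0 F -> D0 (r.2, r.1.2) ->
      is_derive r ((0, v), 0) (fun r => eta_scaled p (r.1.1 - r.2) * F (r.2, r.1.2))
        (eta_scaled p (r.1.1 - r.2) * 'D_(0, v) F (r.2, r.1.2)).
    move=> CF Dr.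
    have dF : is_derive (r.2, r.1.2) (0, v) F ('D_(0, v) F (r.2, r.1.2)).
      have D1 := Ck_along_derivable CF vert; exact: D1 _ Dr.
    have dF' : is_derive r ((0, v), 0) (F \o (fun r => (r.2, r.1.2)))
        ('D_(0, v) F (r.2, r.1.2)).
      apply: (is_derive_affine (w := (0, v))) => //.
    apply/is_deriveP => e e0.
    have n1 : 0 < `|eta_scaled p (r.1.1 - r.2)| + 1 by rewrite ltr_wpDl.
    have [d d0 dP] := (is_deriveP _ _ _ _).1 dF' _ (divr_gt0 e0 n1).
    exists d => // h hd; have := dP h hd; rewrite shift /= => le.
    rewrite mulrCA -!mulrBr normrM mulrC.
    apply: le_trans (ler_wpM2r (normr_ge0 _) le) _.
    rewrite mulrAC ler_wpM2r// mulrAC ler_pdivrMr// ler_pM2l// lerDl//.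
  have [_ <-] := step ('D_(0, v) H) ((x, y), z) (Ck_along_derive (CH 2) vert) Dzy.
  apply: near_eq_derive.
  have := open_nbhs_nbhs (conj oin (Dzy : _ (((x, y), z) : ('rV[R]_n * 'rV[R]_n) * 'rV[R]_n))).
  apply: filterS => r Dr; have [_ <-] := step H r (CH 1) Dr.
  by [].
apply: (integral_Rn_gt0 (z0 := x)).
- have [r r0 rP] := sK2 _ Dq; split.
    move=> z; apply: (continuous_pair_slice (K := 'D_((0, v), 0) ('D_((0, v), 0) K))).
    exact: (Ck_along_continuous CK2).
  by exists r; exact: (nbhs_singleton rP).
- move=> z; have [xz|zx] := leP (enorm (x - z)) p; last by rewrite E_out.
  have Oz := deepP dx xz.
  rewrite E_in// mulr_ge0 ?eta_scaled_ge0//.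
  exact: ltW (@DDG (z, y) v (conj Oz y0) v0).
have Ox := deep_self dx; rewrite E_in// subrr.
apply: mulr_gt0; [exact: eta0|exact: (@DDG (x, y) v (conj Ox y0) v0)].
Qed.

End LocalSmoothing.

(** * Tangent maps and charts *)

Section SmoothMaps.
Context {R : realType} {n m : nat}.
Implicit Types (A : set 'rV[R]_n) (T : 'rV[R]_n -> 'rV[R]_m) (x v : 'rV[R]_n).

Lemma smooth_on_coord A T (i : 'I_m) k : open A ->
  smooth_on A T -> Ck_along setT k A (fun x => T x 0 i).
Proof.
move=> oA; elim: k T => [|k IH] T sT.
  split=> // x Ax; apply: (@continuous_comp _ _ _ T (fun z : 'rV[R]_m => z 0 i)).
    exact: (sT 0%N).
  exact: coord_continuous.
split=> [x Ax|v _].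
  apply: (@continuous_comp _ _ _ T (fun z : 'rV[R]_m => z 0 i)).
    exact: (sT 0%N).
  exact: coord_continuous.
have dT x : A x -> derivable T x v by move=> Ax; have [+ _] := sT 1%N v; apply.
split=> [x Ax|]; first by have /derivable_mxP := dT x Ax; apply.
apply: (@Ck_along_eq _ _ _ _ _ (fun x => 'D_v T x 0 i)) => // [x Ax|].
  by rewrite derive_mx ?mxE//; exact: dT.
by apply: IH => k'; have [_] := sT k'.+1 v.
Qed.

Definition jacobian T x : 'M[R]_(n, m) :=
  \matrix_(j, i) 'D_(delta_mx 0 j : 'rV[R]_n) (fun x => T x 0 i) x.

Lemma mulmxr_continuous (J : 'M[R]_(n, m)) :
  continuous (mulmxr J : 'rV[R]_n -> 'rV[R]_m).
Proof.
move=> x; apply/continuous_forP => e e0.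
pose C := 1 + \sum_j \sum_i `|J j i|.
have C0 : 0 < C by rewrite ltr_pwDl// sumr_ge0// => j _; rewrite sumr_ge0.
exists (e / C) => [|y xy]; first by rewrite divr_gt0.
rewrite /= -mulmxBl; apply: (@le_lt_trans _ _ (`|y - x| * C)).
  apply/rV_norm_leP => [|i]; first by rewrite mulr_ge0// ltW.
  rewrite mxE (le_trans (ler_norm_sum _ _ _))//.
  apply: (@le_trans _ _ (\sum_j `|y - x| * `|J j i|)).
    by apply: ler_sum => j _; rewrite normrM ler_wpM2r// rV_norm_coord.
  rewrite -mulr_sumr ler_wpM2l// -[leLHS]add0r lerD//; apply: ler_sum => j _.
  by rewrite (bigD1 i)//= lerDl sumr_ge0.
by rewrite -ltr_pdivlMr.
Qed.

(** [smooth_on] speaks of directional derivatives, whereas tangent vectors are transformed by ['d],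
    which is informative only for a differentiable map. The increment estimate on each component
    bridges the two. *)
Lemma smooth_on_diff A T x : open A -> smooth_on A T -> A x ->
  differentiable T x /\ 'd T x = mulmxr (jacobian T x) :> ('rV[R]_n -> 'rV[R]_m).
Proof.
move=> oA sT Ax.
have cJ : continuous (mulmxr (jacobian T x) : 'rV[R]_n -> 'rV[R]_m).
  exact: mulmxr_continuous.
have oJ : T \o shift x = cst (T x) + mulmxr (jacobian T x) +o_ (0 : 'rV[R]_n) id.
  apply/eqaddoP => e e0.
  (* There are [n] directions; the successor keeps the quotient positive for [n = 0]. *)
  pose e' := e / n.+1%:R.
  have e'0 : 0 < e' by rewrite divr_gt0.
  have inc (i : 'I_m) : \forall h \near (0 : 'rV[R]_n),
      `|T (h + x) 0 i - T x 0 i - \sum_j h 0 j * jacobian T x j i| <= e * `|h|.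
    have C := smooth_on_coord i 1 oA sT.
    have [|j|d d0 dP] := @increment_estimate _ _ _ (fun j : 'I_n => delta_mx 0 j : 'rV[R]_n) A
        (fun x => T x 0 i) x oA Ax _ _ e' e'0.
    - by move=> j y Ay; have [+ _] := Ck_along_derivable C (I : setT (delta_mx 0 j)) Ay.
    - exact: (Ck_along_continuous (Ck_along_derive C (I : setT (delta_mx 0 j))) Ax).
    apply/nbhs_ballP; exists d => //= h; rewrite -ball_normE /= sub0r normrN => hd.
    have := dP (fun j => h 0 j) (fun j => le_lt_trans (rV_norm_coord h j) hd).
    rewrite -row_sum_delta => le.
    under eq_bigr do rewrite mxE.
    apply: le_trans le _; rewrite /e' -mulrA ler_pM2l// mulrC ler_pdivrMr//.
    apply: (@le_trans _ _ (\sum_(j < n) `|h|)).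
      by apply: ler_sum => j _; exact: rV_norm_coord.
    by rewrite sumr_const card_ord -[X in X <= _]mulr_natr ler_wpM2l// ler_nat.
  have /filter_forall : forall i : 'I_m, \forall h \near (0 : 'rV[R]_n),
      `|T (h + x) 0 i - T x 0 i - \sum_j h 0 j * jacobian T x j i| <= e * `|h| by [].
  apply: filterS => h hP; apply/rV_norm_leP => [|i]; first by rewrite mulr_ge0// ltW.
  by have := hP i; rewrite !mxE opprD addrA /=.
have dE := diff_unique cJ oJ.
by split=> //; apply/diff_locallyP; rewrite dE.
Qed.

Lemma diff_coord A T x v i : open A -> smooth_on A T -> A x ->
  'd T x v 0 i = \sum_j v 0 j * 'D_(delta_mx 0 j : 'rV[R]_n) (fun x => T x 0 i) x.
Proof.
move=> oA sT Ax; have [_ ->] := smooth_on_diff oA sT Ax.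
by rewrite /= mxE; apply: eq_bigr => j _; rewrite mxE.
Qed.

Lemma Ck_along_diff A T (i : 'I_m) k : open A -> smooth_on A T ->
  Ck_along setT k [set q : 'rV[R]_n * 'rV[R]_n | A q.1]
    (fun q : 'rV[R]_n * 'rV[R]_n => 'd T (q.1) (q.2) 0 i).
Proof.
move=> oA sT.
have oA1 : open [set q : 'rV[R]_n * 'rV[R]_n | A q.1] by exact: open_fst.
apply: (@Ck_along_eq _ _ _ _ _ (fun q : 'rV[R]_n * 'rV[R]_n => \sum_j q.2 0 j *
    'D_(delta_mx 0 j : 'rV[R]_n) (fun x => T x 0 i) q.1)) => // [q Aq|].
  by rewrite (diff_coord _ _ oA sT).
apply: Ck_along_sum => // j; apply: Ck_along_mul => //.
  apply: Ck_along_linear => // [q|v q h].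
    apply: (@continuous_comp _ _ _ snd (fun z : 'rV[R]_n => z 0 j)); first exact: cvg_snd.
    exact: coord_continuous.
  by rewrite -[(h *: v + q).2]/(h *: v.2 + q.2) !mxE.
have C := Ck_along_derive (smooth_on_coord i k.+1 oA sT) (I : setT (delta_mx 0 j)).
apply: (@Ck_along_affine _ _ _ setT setT A fst fst _ _ _ _ _ _ C) => //.
by move=> q; exact: cvg_fst.
Qed.

End SmoothMaps.

Lemma pair_sum_delta (R : realType) (n : nat) (p p' : 'rV[R]_n * 'rV[R]_n) :
  p = \sum_i (p.1 0 i - p'.1 0 i) *: (delta_mx 0 i : 'rV[R]_n, 0 : 'rV[R]_n) +
      \sum_i (p.2 0 i - p'.2 0 i) *: (0 : 'rV[R]_n, delta_mx 0 i : 'rV[R]_n) + p'.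
Proof.
have sum_pair (f g : 'I_n -> 'rV[R]_n) :
    \sum_i (f i, g i) = (\sum_i f i, \sum_i g i) :> 'rV[R]_n * 'rV[R]_n.
  by elim/big_rec3: _ => // i x y z _ ->.
have -> : \sum_i (p.1 0 i - p'.1 0 i) *: (delta_mx 0 i : 'rV[R]_n, 0 : 'rV[R]_n) =
    (p.1 - p'.1, 0) :> 'rV[R]_n * 'rV[R]_n.
  rewrite [RHS](_ : _ = \sum_i ((p.1 - p'.1) 0 i *: delta_mx 0 i, 0)).
    by apply: eq_bigr => i _; rewrite !mxE; congr pair; rewrite scaler0.
  by rewrite sum_pair -row_sum_delta big1.
have -> : \sum_i (p.2 0 i - p'.2 0 i) *: (0 : 'rV[R]_n, delta_mx 0 i : 'rV[R]_n) =
    (0, p.2 - p'.2) :> 'rV[R]_n * 'rV[R]_n.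
  rewrite [RHS](_ : _ = \sum_i (0, (p.2 - p'.2) 0 i *: delta_mx 0 i)).
    by apply: eq_bigr => i _; rewrite !mxE; congr pair; rewrite scaler0.
  by rewrite sum_pair -row_sum_delta big1.
case: p p' => [x y] [x' y'].
by congr pair; rewrite /= ?addr0 ?add0r subrK.
Qed.

Section SmoothFibrewise.
Context {R : realType} {n : nat}.
Variables (A : set 'rV[R]_n) (T : 'rV[R]_n -> 'rV[R]_n).
Hypotheses (oA : open A) (sT : smooth_on A T).

Let TT (q : 'rV[R]_n * 'rV[R]_n) := (T q.1, 'd T (q.1) (q.2)).

Lemma tangent_map_continuous q : A q.1 -> continuous_at q TT.
Proof.
move=> Aq; apply/continuous_forP => e e0.
have [d d0 dP] := (continuous_forP _ _).1 (sT 0%N _ Aq) e e0.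
have : forall i : 'I_n, \forall q' \near q, `|'d T (q'.1) (q'.2) 0 i - 'd T (q.1) (q.2) 0 i| < e / 2.
  move=> i; have e2 : 0 < e / 2 by rewrite divr_gt0.
  have C := Ck_along_diff i 0%N oA sT.
  have [d' d'0 d'P] := (continuous_forP _ _).1 (Ck_along_continuous C (x := q) Aq) _ e2.
  by apply/nbhs_ballP; exists d' => //= q'; rewrite -ball_normE /= distrC; exact: d'P.
move=> /filter_forall /nbhs_ballP[d' /= d'0 d'P].
exists (Num.min d d'); first by rewrite lt_min d0.
move=> q'; rewrite lt_min => /andP[qd qd']; rewrite prod_norm_lt /=; apply/andP; split.
  by apply: dP; move: qd; rewrite prod_norm_lt => /andP[].
apply: (@le_lt_trans _ _ (e / 2)); last by rewrite ltr_pdivrMr// ltr_pMr// ltrDl.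
apply/rV_norm_leP => [|i]; first by rewrite divr_ge0// ltW.
by rewrite !mxE ltW//; apply: d'P; rewrite -ball_normE /= distrC.
Qed.

Lemma open_tangent_preimage (D' : set ('rV[R]_n * 'rV[R]_n)) : open D' ->
  open [set q | A q.1 /\ D' (TT q)].
Proof.
move=> oD'; rewrite openE => q [Aq Dq].
have : \forall q' \near q, A q'.1 by exact: (open_nbhs_nbhs (conj (open_fst oA) Aq)).
have : \forall q' \near q, D' (TT q').
  exact: (tangent_map_continuous Aq (open_nbhs_nbhs (conj oD' Dq))).
by apply: filterS2.
Qed.

Lemma Ck_along_tangent_map (D' : set ('rV[R]_n * 'rV[R]_n)) f k : open D' ->
  Ck_along setT k D' f ->
  Ck_along setT k [set q | A q.1 /\ D' (TT q)] (fun q => f (TT q)).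
Proof.
move=> oD' Cf.
have oD := open_tangent_preimage oD'.
pose a (i : 'I_n + 'I_n) : 'rV[R]_n * 'rV[R]_n :=
  match i with inl i => (delta_mx 0 i, 0) | inr i => (0, delta_mx 0 i) end.
pose c (i : 'I_n + 'I_n) (q : 'rV[R]_n * 'rV[R]_n) : R :=
  match i with inl i => T q.1 0 i | inr i => 'd T (q.1) (q.2) 0 i end.
apply: (Ck_along_comp (a := a) (c := c) (E' := setT) oD oD' _ _ _ _ _ Cf) => //.
- by move=> q [].
- by move=> q [Aq _]; exact: tangent_map_continuous.
- move=> v q _ _; apply: filterE => h.
  rewrite big_sumType; exact: (pair_sum_delta (TT _) (TT q)).
- case=> i /=.
    apply: (@Ck_along_sub _ _ setT (fst @^-1` A)) => [//|q [] //|].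
    have C := smooth_on_coord i k oA sT.
    apply: (@Ck_along_affine _ _ _ setT setT A fst fst _ _ _ _ _ _ C) => //.
    by move=> q; exact: cvg_fst.
  by apply: (Ck_along_sub _ _ (Ck_along_diff i k oA sT)) => // q [].
Qed.

End SmoothFibrewise.

(* [coord] of the vector library shadows the one of [Defs]. *)
Local Notation coord := Defs.coord.

Section ChartCalculus.
Context {R : realType} {n : nat} {M : smooth_manifold R n}.
Implicit Types (c d : chart R n M) (m : M) (v x y : 'rV[R]_n).

Lemma param_continuous_at c x : (coord c @` dom c) x -> {for x, continuous (param c)}.
Proof.
move=> cx; have := @param_continuous _ _ _ c.
by rewrite continuous_open_subspace; [apply; rewrite inE|exact: coord_open].
Qed.

Lemma coord_continuous_at_dom c m : dom c m -> {for m, continuous (coord c)}.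
Proof.
move=> cm; have := @Defs.coord_continuous _ _ _ c.
by rewrite continuous_open_subspace; [apply; rewrite inE|exact: dom_open].
Qed.

Lemma chart_image_open c (B : set M) : open B -> open (coord c @` (dom c `&` B)).
Proof.
move=> oB; rewrite openE => _ [m [cm Bm] <-].
have cx : (coord c @` dom c) (coord c m) by exists m.
have : \forall x \near coord c m, B (param c x).
  by apply: (param_continuous_at cx); rewrite coordK//; exact: open_nbhs_nbhs.
have : \forall x \near coord c m, (coord c @` dom c) x.
  exact: (open_nbhs_nbhs (conj (@coord_open _ _ _ c) cx)).
apply: filterS2 => x [m' cm' <-]; rewrite coordK// => Bm'.
by exists m'.
Qed.

Lemma coord_inj c m m' : dom c m -> dom c m' -> coord c m = coord c m' -> m = m'.
Proof. by move=> cm cm' E; rewrite -(coordK cm) E coordK. Qed.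

Lemma transition_coord c d m : dom c m -> transition c d (coord c m) = coord d m.
Proof. by move=> cm; rewrite /transition /= coordK. Qed.

Definition overlap c d : set 'rV[R]_n := coord c @` (dom c `&` dom d).

Lemma overlap_open c d : open (overlap c d).
Proof. by apply: chart_image_open; exact: dom_open. Qed.

Lemma transition_smooth c d : @atlas R n M c -> @atlas R n M d ->
  smooth_on (overlap c d) (transition c d).
Proof. by move=> Ac Ad; have [] := atlas_compatible Ac Ad. Qed.

Lemma transition_differentiable c d m : @atlas R n M c -> @atlas R n M d ->
  dom c m -> dom d m -> differentiable (transition c d) (coord c m).
Proof.
move=> Ac Ad cm dm.
have om : overlap c d (coord c m) by exists m.
by have [] := smooth_on_diff (@overlap_open c d) (transition_smooth Ac Ad) om.
Qed.

(** The cocycle rule behind every change of chart on TM. The composite transition agrees with the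
    direct one only on the overlap, a neighbourhood of the point, so the comparison is local. *)
Lemma diff_transition_comp c d e m v :
  @atlas R n M c -> @atlas R n M d -> @atlas R n M e ->
  dom c m -> dom d m -> dom e m ->
  'd (transition d e) (coord d m) ('d (transition c d) (coord c m) v) =
  'd (transition c e) (coord c m) v.
Proof.
move=> Ac Ad Ae cm dm em.
have D1 := transition_differentiable Ac Ad cm dm.
have D2 : differentiable (transition d e) (transition c d (coord c m)).
  by rewrite transition_coord//; exact: transition_differentiable.
rewrite -[in RHS]deriveE; last exact: transition_differentiable.
rewrite (@near_eq_derive _ _ _ _ (transition d e \o transition c d)).
  rewrite deriveE; last exact: differentiable_comp.
  rewrite -(transition_coord d cm).
  exact/esym/(congr1 (fun f => f v) (diff_comp D1 D2)).
have : overlap c d (coord c m) by exists m.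
move=> /(conj (@overlap_open c d)) /open_nbhs_nbhs; apply: filterS => _ [m' [cm' dm'] <-].
by rewrite /= !transition_coord.
Qed.

Lemma diff_transition_id c m v : @atlas R n M c -> dom c m ->
  'd (transition c c) (coord c m) v = v.
Proof.
move=> Ac cm; rewrite -deriveE; last exact: transition_differentiable.
rewrite (@near_eq_derive _ _ _ _ id) ?derive_id//.
have : (coord c @` dom c) (coord c m) by exists m.
move=> /(conj (@coord_open _ _ _ c)) /open_nbhs_nbhs; apply: filterS => _ [m' cm' <-].
by rewrite transition_coord.
Qed.

Lemma chart_at_atlas m : @atlas R n M (chart_at m).
Proof. by rewrite /chart_at; case: cid2. Qed.

Lemma chart_at_dom m : dom (chart_at m) m.
Proof. by rewrite /chart_at; case: cid2. Qed.

Lemma tcoord_tparam c d m y : @atlas R n M c -> @atlas R n M d -> dom c m -> dom d m ->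
  tcoord d (tparam c (coord c m, y)) = (coord d m, 'd (transition c d) (coord c m) y).
Proof.
move=> Ac Ad cm dm; rewrite /tcoord /tparam /= coordK//.
by congr pair; exact: (diff_transition_comp y Ac (chart_at_atlas m) Ad cm (chart_at_dom m) dm).
Qed.

Lemma tparam_tcoord c (p : tangent_bundle M) : @atlas R n M c -> dom c (base p) ->
  tparam c (tcoord c p) = p.
Proof.
case: p => m v Ac /= cm; rewrite /tcoord /tparam /= coordK//.
have Aa := chart_at_atlas m; have am := chart_at_dom m.
congr Tangent; rewrite -[RHS](diff_transition_id v Aa am).
exact: (diff_transition_comp v Aa Ac Aa am cm am).
Qed.

Lemma tparam_chart_at m v : tparam (chart_at m) (coord (chart_at m) m, v) = Tangent m v.
Proof.
have Aa := chart_at_atlas m; have am := chart_at_dom m.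
by rewrite /tparam /= coordK// diff_transition_id.
Qed.

Lemma base_tparam c m y : dom c m -> base (tparam c (coord c m, y)) = m.
Proof. by move=> cm; rewrite /tparam /= coordK. Qed.

Definition ttransition c d (q : 'rV[R]_n * 'rV[R]_n) : 'rV[R]_n * 'rV[R]_n :=
  (transition c d q.1, 'd (transition c d) (q.1) (q.2)).

Lemma tcoord_tparamE c d q : @atlas R n M c -> @atlas R n M d -> overlap c d q.1 ->
  tcoord d (tparam c q) = ttransition c d q.
Proof.
case: q => _ y Ac Ad [m [cm dm] /= <-].
by rewrite tcoord_tparam// /ttransition /= transition_coord.
Qed.

Lemma diff_transition_eq0 c d m y : @atlas R n M c -> @atlas R n M d ->
  dom c m -> dom d m -> 'd (transition c d) (coord c m) y = 0 -> y = 0.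
Proof.
move=> Ac Ad cm dm E.
have E1 := diff_transition_comp y Ac Ad Ac cm dm cm.
pose L : {linear 'rV[R]_n -> 'rV[R]_n} := 'd (transition d c) (coord d m).
have E2 : y = L ('d (transition c d) (coord c m) y).
  exact: etrans (esym (diff_transition_id y Ac cm)) (esym E1).
exact: (etrans E2 (etrans (congr1 L E) (linear0 L))).
Qed.

Lemma tparam_continuous c q (P : set (tangent_bundle M)) : @atlas R n M c -> tdom c q ->
  nbhs (tparam c q) P -> \forall q' \near q, P (tparam c q').
Proof.
move=> Ac cq; rewrite nbhsE => -[B [oB Bq] BP].
have := oB; rewrite /open /= => /(_ c Ac) oB'.
have : nbhs q (tdom c `&` tparam c @^-1` B) by exact: open_nbhs_nbhs.
by apply: filterS => q' [_ Bq']; exact: BP.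
Qed.

(** The topology of TM is declared through the [tparam]; this is the opposite direction, continuity
    of [tcoord c], tested in an arbitrary chart [d] through the tangent map of the transition. *)
Lemma nbhs_tcoord c p (P : set ('rV[R]_n * 'rV[R]_n)) : @atlas R n M c -> dom c (base p) ->
  nbhs (tcoord c p) P -> \forall p' \near p, dom c (base p') /\ P (tcoord c p').
Proof.
move=> Ac cp; rewrite nbhsE => -[B [oB Bp] BP].
have : nbhs p [set p' : tangent_bundle M | dom c (base p') /\ B (tcoord c p')].
  apply: open_nbhs_nbhs; split; last by [].
  rewrite /open /= => d Ad.
  rewrite openE => q [[m dm mq] [cq Bq]].
  have oq : overlap d c q.1.
    by exists m => //; split => //; move: cq; rewrite /tparam /= -mq coordK.
  have : \forall q' \near q, overlap d c q'.1.
    exact: (open_nbhs_nbhs (conj (open_fst (@overlap_open d c)) oq)).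
  have : \forall q' \near q, B (ttransition d c q').
    apply: (tangent_map_continuous (@overlap_open d c) (transition_smooth Ad Ac) oq).
    by apply: open_nbhs_nbhs; split => //; move: Bq; rewrite (tcoord_tparamE Ad Ac oq).
  apply: filterS2 => q' Bq' oq'; split.
    by have [m' [dm' _] E] := oq'; exists m'.
  split; last by rewrite /= (tcoord_tparamE Ad Ac oq').
  by have [m' [dm' cm'] E] := oq'; rewrite /= -E coordK.
by apply: filterS => p' [? /BP].
Qed.

End ChartCalculus.

Section FinslerCoordinates.
Context {R : realType} {n : nat} {M : smooth_manifold R n}.
Variables (F : tangent_bundle M -> R) (hF : C0_Finsler F).
Variables (c : chart R n M) (Ac : @atlas R n M c).

Lemma C0_Finsler_continuous_at (q : 'rV[R]_n * 'rV[R]_n) : (coord c @` dom c) q.1 ->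
  continuous_at q (fun q => F (tparam c q)).
Proof.
move=> cq P FP; have [cF _] := hF.
exact: (tparam_continuous Ac cq (cF _ _ FP)).
Qed.

Lemma C0_Finsler_asymmetric_norm (x : 'rV[R]_n) : (coord c @` dom c) x ->
  asymmetric_norm (fun y => F (tparam c (x, y))).
Proof.
move=> [m cm <-]; have [_ /(_ m)[N0 N_eq0 NZ ND]] := hF.
have Aa := chart_at_atlas m; have am := chart_at_dom m.
rewrite /tparam /= coordK//; split => [y|y /N_eq0|a y a0|y z].
- exact: N0.
- exact: diff_transition_eq0.
- exact: (etrans (congr1 (fun v => F (Tangent m v)) (linearZ _ _)) (NZ _ _ a0)).
- by apply: le_trans (ND _ _); rewrite -[leRHS]/(F (Tangent m (_ + _))) -linearD.
Qed.

End FinslerCoordinates.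

(** * The data of one coordinate neighbourhood *)

Section SegmentExit.
Context {R : realType} {W : normedModType R}.

(** Take the infimum of the parameters outside [P]: openness keeps its point outside, and the
    earlier points, all in [P], put it in the closure. *)
Lemma segment_exit (P : set W) x z : open P -> P x -> ~ P z ->
  exists t : R, [/\ 0 <= t, t <= 1, ~ P (x + t *: (z - x)) & closure P (x + t *: (z - x))].
Proof.
move=> oP Px Pz; pose g (t : R) := x + t *: (z - x).
have cg (t : R) B : nbhs (g t) B -> exists2 d, 0 < d & forall s, `|s - t| < d -> B (g s).
  move=> /nbhs_ballP[e /= e0 eB].
  have n0 : 0 < `|z - x| + 1 by rewrite ltr_wpDl.
  exists (e / (`|z - x| + 1)) => [|s st]; first exact: divr_gt0.
  apply: eB; rewrite -ball_normE /= /g opprD addrACA subrr add0r -scalerBl normrZ distrC.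
  apply: (@le_lt_trans _ _ (`|s - t| * (`|z - x| + 1))); first by rewrite ler_wpM2l// lerDl.
  by rewrite -ltr_pdivlMr.
pose S := [set t | 0 <= t <= 1 /\ ~ P (g t)].
have S1 : S 1 by split; rewrite ?ler01 ?lexx// /g scale1r addrC subrK.
have iS : has_inf S by split; [exists 1|exists 0 => t [/andP[]]].
have t0 : 0 <= inf S by apply: lb_le_inf; [exists 1|move=> t [/andP[]]].
have t1 : inf S <= 1 by apply: ge_inf => //; case: iS.
have nP : ~ P (g (inf S)).
  move=> Pt; have [d d0 dP] := cg _ _ (open_nbhs_nbhs (conj oP Pt)).
  have [t St ti] := inf_adherent d0 iS; have [_] := St; apply; apply: dP.
  have it : inf S <= t by apply: ge_inf => //; case: iS.
  by rewrite ger0_norm ?subr_ge0// ltrBlDl.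
exists (inf S); split=> // B /cg[d d0 dB].
have tp : 0 < inf S.
  rewrite lt_def t0 andbT; apply/eqP => E.
  by apply: nP; rewrite E /g scale0r addr0.
pose t := Num.max 0 (inf S - d / 2).
have tt : t < inf S by rewrite gt_max tp ltrBlDr ltrDl divr_gt0.
have t00 : 0 <= t by rewrite le_max lexx.
exists (g t); split.
  apply: contrapT => nPt; have : S t by split=> //; rewrite t00 ltW// (lt_le_trans tt).
  by move=> /(ge_inf iS.2); rewrite leNgt tt.
apply: dB; rewrite distrC ger0_norm ?subr_ge0 ?(ltW tt)//.
rewrite ltrBlDr -ltrBlDl lt_max; apply/orP; right.
by rewrite ltrD2l ltrN2 ltr_pdivrMr// ltr_pMr// ltrDl.
Qed.

Lemma compact_closed_separated (A B : set W) : compact A -> closed B -> A `&` B = set0 ->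
  exists2 r : R, 0 < r & forall a b, A a -> `|a - b| < r -> ~ B b.
Proof.
move=> cA cB AB.
have /compact_near_coveringP/(_ R (0 : R)^'+ (fun r a => forall b, `|a - b| < r -> ~ B b)) := cA.
case.
  move=> a Aa; have : \forall b \near a, ~ B b.
    apply: open_nbhs_nbhs; split; first exact: closed_openC.
    by move=> Ba; have : (A `&` B) a by []; rewrite AB.
  move=> /nbhs_ballP[r /= r0 rB].
  exists (ball a (r / 2), [set s | 0 < s < r / 2]) => /=.
    split; first exact: nbhsx_ballx (divr_gt0 _ _).
    by apply: filterS2 (nbhs_right_gt 0) (nbhs_right_lt (divr_gt0 r0 (ltr0Sn R 1))) => s /= s0 sr;
       apply/andP.
  move=> [a' s] [/= aa /andP[_ sr]] b ab; apply: rB; rewrite -ball_normE /=.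
  rewrite -(subrKA a') (le_lt_trans (ler_normD _ _))// (splitr r) ltrD//.
    by move: aa; rewrite -ball_normE.
  exact: lt_trans sr.
move=> r /= r0 rP; have r2 : 0 < r / 2 by rewrite divr_gt0.
exists (r / 2) => // a b Aa ab; apply: (rP (r / 2) _ r2 a Aa b ab) => /=.
by rewrite sub0r normrN gtr0_norm// ltr_pdivrMr// ltr_pMr// ltrDl.
Qed.

End SegmentExit.

(** The set where [f] is nonzero is open, hence inside the interior of its closure. Points of the
    support are thus in the closure of [V l]. *)
Lemma supp_closure_interior (R : realType) (T : topologicalType) (f : T -> R) :
  continuous f -> supp f `<=` closure (interior (supp f)).
Proof.
move=> cf; apply: closureS; rewrite -open_subsetE; first exact: subset_closure.
by apply: (@open_comp _ _ f [set r | r != 0]) => [x _|]; [exact: cf|exact: open_neq].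
Qed.

Section LocalData.
Context {R : realType} {n : nat} {M : smooth_manifold R n}.
Context {F : tangent_bundle M -> R} (hF : C0_Finsler F) (S : smoothing_data F).
Variable l : indices S.

Let c := chart_of l.
Let Ac : @atlas R n M c := chart_of_atlas l.
Let X : set 'rV[R]_n := coord c @` dom c.
Let O : set 'rV[R]_n := coord c @` U l.
Let N (q : 'rV[R]_n * 'rV[R]_n) := F (tparam c q).
Let rU := r_max F c (U l).
Let ru := r_min F c (U l).
Let vals := unit_sphere_values F c (U l).

Let Ud : U l `<=` dom c.
Proof. by move=> m Um; apply: (@U_dom _ _ _ _ S l); exact: subset_closure. Qed.

Lemma U_image_sub : O `<=` X.
Proof. by move=> _ [m /Ud cm <-]; exists m. Qed.

Lemma U_image_open : open O.
Proof.
rewrite /O (_ : U l = dom c `&` U l); first exact: chart_image_open (@U_open _ _ _ _ S l).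
by apply/esym/setIidPr.
Qed.

Let vals_ge0 r : vals r -> 0 <= r.
Proof.
move=> [m [y [/(@U_dom _ _ _ _ S l) cm _ ->]]].
by have [N0 _ _ _] := C0_Finsler_asymmetric_norm hF Ac (ex_intro2 _ _ m cm erefl); exact: N0.
Qed.

(** [tau l] lies strictly between 0 and this bound. As division by 0 gives 0, positivity excludes at
    once [n = 0], [rU = 0] and [ru = 0]. *)
Let b_gt0 : 0 < ru / (16 * n%:R * rU).
Proof. by have [_ _ _ /andP[t0 tb] _] := @u_tau _ _ _ _ S l; exact: lt_trans tb. Qed.

Let n_gt0 : (0 < n)%N.
Proof. by move: b_gt0; case: n ru rU => // a b; rewrite mulr0 mul0r invr0 mulr0 ltxx. Qed.

(* [sup] and [inf] would be 0 on a set without bounds, contradicting [b_gt0]; the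
   compactness of [closure (U l)] is not used. *)
Let has_sup_vals : has_sup vals.
Proof.
apply: contrapT => /sup_out E; move: b_gt0.
by rewrite (_ : rU = 0)// mulr0 invr0 mulr0 ltxx.
Qed.

Let has_inf_vals : has_inf vals.
Proof.
apply: contrapT => /inf_out E; move: b_gt0.
by rewrite (_ : ru = 0)// mul0r ltxx.
Qed.

Lemma r_min_gt0 : 0 < ru.
Proof.
rewrite lt_def; apply/andP; split.
  by apply/eqP => E; move: b_gt0; rewrite E mul0r ltxx.
by apply: lb_le_inf => [|r /vals_ge0//]; case: has_inf_vals.
Qed.

Lemma r_min_le_max : ru <= rU.
Proof.
have [[r vr] ub] := has_sup_vals; have [_ lb] := has_inf_vals.
by apply: (@le_trans _ _ r); [exact: ge_inf|exact: ub_le_sup].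
Qed.

Let rU0 : 0 < rU := lt_le_trans r_min_gt0 r_min_le_max.

Lemma r_bounds (x y : 'rV[R]_n) : O x -> ru * enorm y <= N (x, y) <= rU * enorm y.
Proof.
move=> [m Um <-]; have cm := Ud Um.
have [_ _ NZ _] := C0_Finsler_asymmetric_norm hF Ac (ex_intro2 _ _ m cm erefl).
have [->|y0] := eqVneq y 0.
  rewrite (_ : enorm 0 = 0); last by apply/eqP; rewrite enorm_eq0.
  have /= := NZ 0 0 (lexx 0); rewrite scale0r mul0r !mulr0 /N => ->.
  by rewrite lexx.
have e0 : 0 < enorm y by rewrite enorm_gt0.
have ie0 : 0 <= (enorm y)^-1 by rewrite invr_ge0 ltW.
have vy : vals (N (coord c m, (enorm y)^-1 *: y)).
  exists m, ((enorm y)^-1 *: y); split=> //; first exact: subset_closure.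
  by rewrite enormZ ger0_norm// mulVf// gt_eqF.
have E : N (coord c m, y) = N (coord c m, (enorm y)^-1 *: y) * enorm y.
  by rewrite /N NZ// mulrAC mulVf ?gt_eqF// mul1r.
have [_ ub] := has_sup_vals; have [_ lb] := has_inf_vals.
rewrite E !ler_pM2r//; apply/andP; split; first exact: ge_inf.
exact: ub_le_sup.
Qed.

Let b_le : ru / (16 * n%:R * rU) <= ru / (16 * rU) /\ ru / (16 * rU) <= 1 / 16.
Proof.
have n1 : (1 : R) <= n%:R by rewrite ler1n.
split.
  rewrite ler_pM2l ?r_min_gt0// lef_pV2 ?posrE ?mulr_gt0//.
    by rewrite ler_pM2r// ler_pMr.
  by rewrite (lt_le_trans ltr01).
rewrite ler_pdivrMr ?mulr_gt0// mulrA mulfVK ?mul1r//.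
exact: r_min_le_max.
Qed.

Lemma tau_gt0 : 0 < tau l.
Proof. by have [_ _ _ /andP[]] := @u_tau _ _ _ _ S l. Qed.

Lemma tau_params e : 0 < e < tau l ->
  [/\ e < 1 / 16, 0 < u l e & u l e < ru / (16 * rU)].
Proof.
move=> /andP[e0 et]; have [_ _ _ /andP[t0 tb]] := @u_tau _ _ _ _ S l.
have [b1 b2] := b_le.
move=> /(_ e); rewrite e0 et => /(_ isT) /andP[ue0 ueb]; split=> //.
  exact: lt_le_trans (lt_trans et tb) (le_trans b1 b2).
exact: lt_le_trans ueb b1.
Qed.

End LocalData.

Lemma closure_min (T : topologicalType) (A B : set T) :
  A `<=` B -> closed B -> closure A `<=` B.
Proof. by move=> AB /closure_id ->; exact: closureS. Qed.

Section PhiContinuous.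
Context {R : realType} {n : nat} {M : smooth_manifold R n}.

Lemma smooth_function_continuous (f : M -> R) : smooth_function f -> continuous f.
Proof.
move=> sf m; have Aa := chart_at_atlas m; have am := chart_at_dom m.
set a := chart_at m in Aa am *.
have ax : (coord a @` dom a) (coord a m) by exists m.
have C1 : {for coord a m, continuous (f \o param a)} := sf a Aa 0%N _ ax.
have C2 : {for m, continuous (f \o param a \o coord a)}.
  exact: continuous_comp (coord_continuous_at_dom am) C1.
have E : \forall m' \near m, (f \o param a \o coord a) m' = f m'.
  have := open_nbhs_nbhs (conj (@dom_open _ _ _ a) am).
  by apply: filterS => m' am'; rewrite /= coordK.
move=> P; rewrite -{1}(coordK am) => /C2 H.
have H' : nbhs m ((f \o param a \o coord a) @^-1` P) by [].
apply: filterS (filterI H' E) => m' [+ E'].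
by rewrite /preimage /= -E'.
Qed.

Lemma coord_compact (c : chart R n M) (A : set M) : compact A -> A `<=` dom c ->
  compact (coord c @` A).
Proof.
move=> cA Ac; apply: continuous_compact => //.
exact: continuous_subspaceW Ac (@Defs.coord_continuous _ _ _ c).
Qed.

Lemma coord_compact_closed (c : chart R n M) (A : set M) : compact A -> A `<=` dom c ->
  closed (coord c @` A).
Proof.
by move=> cA Ac; exact: (compact_closed (@norm_hausdorff _ _) (coord_compact cA Ac)).
Qed.

End PhiContinuous.

(** * Room between the support of a partition function and the boundary of its domain *)

Section Delta.
Context {R : realType} {n : nat} {M : smooth_manifold R n}.
Context {F : tangent_bundle M -> R} (S : smoothing_data F).
Variable l : indices S.

Let c := chart_of l.
Let O : set 'rV[R]_n := coord c @` U l.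
Let C : set 'rV[R]_n := coord c @` closure (V l).

Let oU : open (U l) := @U_open _ _ _ _ S l.
Let cU : compact (closure (U l)) := @U_compact _ _ _ _ S l.
Let Ud : closure (U l) `<=` dom c := @U_dom _ _ _ _ S l.

Lemma supp_phi_sub : supp (phi l) `<=` closure (V l).
Proof.
apply: supp_closure_interior; apply: smooth_function_continuous.
exact: (@phi_smooth _ _ _ _ S l).
Qed.

Lemma closure_V_sub : closure (V l) `<=` U l.
Proof.
apply: subset_trans (@phi_support _ _ _ _ S l).
by apply: closure_min; [exact: interior_subset|exact: closed_closure].
Qed.

Let UcU : U l `<=` closure (U l) := @subset_closure _ _.

Let cV : compact (closure (V l)).
Proof.
apply: subclosed_compact cU _; first exact: closed_closure.
exact: subset_trans closure_V_sub UcU.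
Qed.

Let Vd : closure (V l) `<=` dom c.
Proof. exact: subset_trans (subset_trans closure_V_sub UcU) Ud. Qed.

Let boundary_closed (A : set M) : closed (boundary A).
Proof.
by apply: closedI; [exact: closed_closure|exact/open_closedC/open_interior].
Qed.

(** The two boundaries are disjoint, since the closure of [V l] lies in the open set [U l]; one
    image is compact and the other closed. A real lower bound is given because [nu l] may be
    infinite. *)
Lemma nu_gt0 : exists2 r : R, 0 < r & (r%:E <= nu l)%E.
Proof.
have sV : boundary (V l) `<=` closure (V l) by move=> m [].
have sU : boundary (U l) `<=` closure (U l) by move=> m [].
have cbV : compact (coord c @` boundary (V l)).
  by apply: coord_compact; [exact: subclosed_compact cV sV|exact: subset_trans Vd].
have cbU : closed (coord c @` boundary (U l)).
  by apply: coord_compact_closed; [exact: subclosed_compact cU sU|exact: subset_trans Ud].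
have [|r r0 rP] := compact_closed_separated cbV cbU.
  apply/seteqP; split=> // _ [[m mV <-] [m' m'U E]].
  have mm : m' = m by apply: coord_inj E; [exact/Ud/sU|exact/Vd/sV].
  have [_] := m'U; rewrite mm; apply.
  by rewrite ((interior_id _).1 oU); exact: closure_V_sub (sV _ mV).
exists r => //; apply: le_ereal_inf_tmp => _ [a [b [Aa Bb ->]]].
rewrite lee_fin leNgt; apply/negP => ab.
by apply: (rP a b) => //; exact: le_lt_trans (norm_le_enorm _) ab.
Qed.

Lemma deltaP : 0 < tau l -> [/\ 0 < delta l, delta l <= tau l & ((delta l)%:E <= nu l)%E].
Proof.
move=> t0; have [r r0] := nu_gt0; rewrite /delta; case: (nu l) => [s||] rs.
- rewrite -EFin_min /= !lee_fin; split.
  + by rewrite lt_min t0 (lt_le_trans r0).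
  + by rewrite ge_min lexx.
  + by rewrite ge_min lexx orbT.
(* With [nu l] infinite the minimum is [tau l], so [fine] does not return its default value. *)
- by rewrite (@min_l _ _ _ +oo%E) ?leey//= lexx.
- by [].
Qed.

(* The segment from [x] to [z] would leave the image of [U l] at a point [b] of its
   boundary, and its part from [b] back to [x] would enter the image of
   [closure (V l)] at a point [a] of the boundary of [V l]. *)
Lemma closure_V_ball x z : 0 < tau l -> C x -> enorm (x - z) < delta l -> O z.
Proof.
move=> t0 Cx xz; have [_ _ dn] := deltaP t0; apply: contrapT => Oz.
have CO : C `<=` O by move=> _ [m /closure_V_sub Um <-]; exists m.
have oO : open O by exact: U_image_open.
have [t [t00 t1 nb Ob]] := segment_exit oO (CO _ Cx) Oz.
set b := x + t *: (z - x) in nb Ob.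
have bU : (coord c @` boundary (U l)) b.
  have : (coord c @` closure (U l)) b.
    have cK : closed (coord c @` closure (U l)) by exact: coord_compact_closed.
    by apply: closure_min Ob => // _ [m /UcU Um <-]; exists m.
  move=> [m mU mb]; exists m => //; split=> // /interior_subset Um.
  by apply: nb; exists m.
have cC : closed C by exact: coord_compact_closed.
have [s [s0 s1 na Ca]] := segment_exit (closed_openC cC) (fun Cb => nb (CO _ Cb))
  (fun H : (~` C) x => H Cx).
set a := b + s *: (x - b) in na Ca.
have aV : (coord c @` boundary (V l)) a.
  have [m mV ma] := contrapT na.
  exists m => //; split=> // iV.
  have oI : open (coord c @` (dom c `&` interior (V l))).
    by apply: chart_image_open; exact: open_interior.
  have : (coord c @` (dom c `&` interior (V l))) a by exists m => //; split=> //; exact: Vd.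
  move=> /(conj oI)/open_nbhs_nbhs/Ca[b' [nC [m' [_ m'V] E]]].
  by apply: nC; exists m' => //; apply: subset_closure; exact: interior_subset.
have : (nu l <= (enorm (a - b))%:E)%E by apply: ereal_inf_lbound; exists a, b.
move=> /(le_trans dn); rewrite lee_fin leNgt; apply/negP; rewrite negbK.
have -> : a - b = (s * t) *: (x - z).
  by rewrite /a addrC addKr /b opprD addNKr -scalerN opprB scalerA.
rewrite enormZ ger0_norm ?mulr_ge0//; apply: le_lt_trans xz.
by rewrite ler_piMl ?enorm_ge0// mulr_ile1.
Qed.

(** The slack [delta l - p] pays for replacing [x] by nearby points, as [deep] demands. *)
Lemma closure_V_deep x p : 0 < tau l -> p < delta l -> C x -> deep O p x.
Proof.
move=> t0 pd Cx; have d0 : 0 < delta l - p by rewrite subr_gt0.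
have := @enorm_continuous R n 0.
move=> /continuous_forP/(_ _ d0)[r r0 rP].
apply/nbhs_ballP; exists r => //= x' xx' z x'z.
apply: (closure_V_ball t0 Cx).
rewrite -(subrKA x') (le_lt_trans (enorm_triangle _ _))//.
rewrite -(subrK p (delta l)) ltr_leD//.
have := rP (x - x'); rewrite subr0 (_ : enorm 0 = 0); last by apply/eqP; rewrite enorm_eq0.
by rewrite subr0 ger0_norm ?enorm_ge0//; apply; move: xx'; rewrite -ball_normE.
Qed.

End Delta.

(** With t = k / r < 3/16, the hypotheses give (1 - t) N <= G <= (1 + 2 t) N, so the squares differ
    by at most 6 t N^2, and N^2 <= c + d. *)
Lemma sqr_ratio_estimate (R : realType) (r k N G c d : R) :
  0 < r -> 0 <= k -> k < 3 / 16 * r -> 0 <= N -> 0 <= G ->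
  r * N <= (r + k) * G -> (r - k) * G <= r * N ->
  `|N ^+ 2 - c| <= d -> `|G ^+ 2 - c| <= d + 6 * (k / r) * (c + d).
Proof.
move=> r0 k0 kr N0 G0 NG GN Nc.
pose t := k / r; rewrite -/t.
have kE : k = t * r by rewrite /t mulfVK// gt_eqF.
have t0 : 0 <= t by rewrite divr_ge0// ltW.
have t1 : t < 3 / 16 by rewrite ltr_pdivrMr.
move: t t0 t1 kE => t t0 t1 kE.
have {NG} NG : N <= (1 + t) * G.
  by rewrite -(ler_pM2l r0); apply: le_trans NG _; rewrite kE; rewrite le_eqVlt; apply/orP; left; apply/eqP; ring.
have {GN} GN : (1 - t) * G <= N.
  by rewrite -(ler_pM2l r0); apply: le_trans _ GN; rewrite kE; rewrite le_eqVlt; apply/orP; left; apply/eqP; ring.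
have G1 : G <= (1 + 2 * t) * N.
  have h0 : 0 <= 1 + 2 * t by nra.
  by apply: le_trans (ler_wpM2l h0 GN); nra.
have G2 : (1 - t) * N <= G.
  have h0 : 0 <= 1 - t by nra.
  by apply: le_trans (ler_wpM2l h0 NG) _; nra.
have S1 : G ^+ 2 <= (1 + 6 * t) * N ^+ 2.
  apply: (@le_trans _ _ (((1 + 2 * t) * N) ^+ 2)); first by rewrite lerXn2r ?nnegrE//; nra.
  by rewrite exprMn ler_wpM2r ?sqr_ge0//; nra.
have S2 : (1 - 6 * t) * N ^+ 2 <= G ^+ 2.
  apply: (@le_trans _ _ (((1 - t) * N) ^+ 2)); last by rewrite lerXn2r ?nnegrE//; nra.
  by rewrite exprMn ler_wpM2r ?sqr_ge0//; nra.
move: Nc; rewrite !ler_distl => /andP[N1 N2].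
have tN : t * N ^+ 2 <= t * (c + d) by rewrite ler_wpM2l.
apply/andP; split.
  by move: (N ^+ 2) (G ^+ 2) S1 S2 N1 N2 tN => a b *; nra.
by move: (N ^+ 2) (G ^+ 2) S1 S2 N1 N2 tN => a b *; nra.
Qed.

Lemma half_div (R : realFieldType) (h k : R) : 0 < k -> h / (2 * k) * k = h / 2.
Proof. by move=> k0; field; rewrite gt_eqF. Qed.

Lemma dist_two (R : realFieldType) (a b c h : R) :
  `|a - c| < h / 4 -> `|b - c| < h / 4 -> `|a - b| <= h / 2.
Proof. by rewrite !ltr_distl ler_distl => /andP[? ?] /andP[? ?]; apply/andP; split; lra. Qed.

(** As a + h / 2 <= b + h, the bound on [t] makes the relative error 6 t (a + h / 2) at most
    [h / 2]; this is the origin of 12. *)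
Lemma error_le (R : realFieldType) (t h a b : R) : 0 < h -> 0 <= a -> 0 <= b -> 0 <= t ->
  t < h / (12 * (b + h)) -> `|a - b| < h / 4 -> h / 2 + 6 * t * (a + h / 2) <= h.
Proof.
move=> h0 a0 b0 t0; have B0 : 0 < b + h by lra.
rewrite ltr_pdivlMr ?mulr_gt0// ltr_distl => tB /andP[_ ab].
have : t * (a + h / 2) <= t * (b + h) by rewrite ler_wpM2l//; lra.
lra.
Qed.

Section LocalSmoothingData.
Context {R : realType} {n : nat} {M : smooth_manifold R n}.
Context {F : tangent_bundle M -> R} (hF : C0_Finsler F) (S : smoothing_data F).
Variable l : indices S.

Let c := chart_of l.
Let Ac : @atlas R n M c := chart_of_atlas l.
Let X : set 'rV[R]_n := coord c @` dom c.
Let O : set 'rV[R]_n := coord c @` U l.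
Let N (q : 'rV[R]_n * 'rV[R]_n) := F (tparam c q).
Let rU := r_max F c (U l).
Let ru := r_min F c (U l).
Let t0 : 0 < tau l := tau_gt0 l.

Let cN := C0_Finsler_continuous_at hF Ac.
Let hN := C0_Finsler_asymmetric_norm hF Ac.
Let ru0 : 0 < ru := r_min_gt0 hF l.
Let ruU : ru <= rU := r_min_le_max l.
Let rU0 : 0 < rU := lt_le_trans ru0 ruU.
Let oX : open X := @coord_open _ _ _ c.
Let oO : open O := @U_image_open _ _ _ _ S l.
Let OX : O `<=` X := @U_image_sub _ _ _ _ S l.

Let Nlb x y : O x -> ru * enorm y <= N (x, y).
Proof. by move=> Ox; have /andP[] := r_bounds hF y Ox. Qed.

Let Nub x y : O x -> N (x, y) <= rU * enorm y.
Proof. by move=> Ox; have /andP[] := r_bounds hF y Ox. Qed.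

Definition smoothing_domain (e : R) : set 'rV[R]_n := deep O (psi l e).

Lemma psi_bounds e : 0 < e < 1 -> 0 < psi l e /\ psi l e < delta l.
Proof.
move=> /andP[e0 e1]; have [d0 _ _] := deltaP t0.
by rewrite /psi mulr_gt0//; split=> //; rewrite gtr_pMl.
Qed.

Lemma closure_V_domain e x : 0 < e < 1 -> (coord c @` closure (V l)) x ->
  smoothing_domain e x.
Proof. by move=> /psi_bounds[_ pd]; exact: closure_V_deep. Qed.

Section FixedScale.
Variables (e : R) (e01 : 0 < e < 1).

Let p := psi l e.
Let w := u l p.
Let G := vsmooth F c (U l) (u l) p.

Let p0 : 0 < p. Proof. by have [] := psi_bounds e01. Qed.

Let params : [/\ p < 1 / 16, 0 < w & w < ru / (16 * rU)].
Proof.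
apply: (tau_params hF) => //; rewrite p0 /=; have [_ pd] := psi_bounds e01.
by have [_ dt _] := deltaP t0; exact: lt_le_trans dt.
Qed.

Let p16 : p < 1 / 16. Proof. by case: params. Qed.
Let w0 : 0 < w. Proof. by case: params. Qed.
Let w16 : w < ru / (16 * rU). Proof. by case: params. Qed.

(** The set from which [vsmooth] picks a norm is nonempty on [O], so its defining properties hold
    there. *)
Let vsmoothP x : O x -> asymmetric_norm (G x) /\
  [set y | G x y = rU] = [set y | vaverage N rU ru p w x y = rU].
Proof.
move=> Ox; have ex := vaverage_gauge_exists oX OX cN hN Nub ru0 ruU p0 p16 w0 w16 Ox.
exact: (getPex ex).
Qed.

Let hG x (Ox : O x) := (vsmoothP Ox).1.
Let hGs x (Ox : O x) := (vsmoothP Ox).2.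

Let CG k := Ck_along_gauge oX OX cN hN Nub ru0 ruU p0 p16 w0 w16 oO hG hGs k.

Definition local_energy (q : 'rV[R]_n * 'rV[R]_n) : R := local_smoothing l e q.1 q.2 ^+ 2.

Lemma local_energyE : local_energy = (fun q => hsmooth G p q.1 q.2).
Proof. by apply/funext => q; rewrite /local_energy sqr_sqrtr//; exact: hsmooth_ge0. Qed.

Let D := smoothing_domain e.

Lemma Ck_along_local_energy k :
  Ck_along setT k [set q | D q.1 /\ q.2 != 0] local_energy.
Proof. by rewrite local_energyE; exact: (Ck_along_hsmooth oO p0 CG k). Qed.

Lemma local_energy_ge0 q : 0 <= local_energy q.
Proof. exact: sqr_ge0. Qed.

Lemma local_energy_gt0 x y : D x -> y != 0 -> 0 < local_energy (x, y).
Proof. by rewrite local_energyE; exact: (hsmooth_gt0 oO p0 hG CG). Qed.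

Lemma local_energyZ x y a : D x -> 0 < a ->
  local_energy (x, a *: y) = a ^+ 2 * local_energy (x, y).
Proof. by rewrite local_energyE; exact: (hsmoothZ oO p0 hG CG). Qed.

Lemma local_energy0 x : D x -> local_energy (x, 0) = 0.
Proof. by rewrite local_energyE; exact: (hsmooth0 oO p0 hG CG). Qed.

Lemma local_energy_convex x y v : D x -> y != 0 -> v != 0 ->
  0 < 'D_(0, v) ('D_(0, v) local_energy) (x, y).
Proof.
rewrite local_energyE; apply: (hsmooth_convex oO p0 CG) => q v' Dq v'0.
exact: (gauge_sqr_convex oX OX cN hN Nlb Nub ru0 ruU p0 p16 w0 w16 oO hG hGs Dq v'0).
Qed.

Lemma local_energy_near x y (b d : R) : D x -> y != 0 ->
  (forall z, enorm (x - z) < p -> `|N (z, y) ^+ 2 - b| <= d) ->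
  `|local_energy (x, y) - b| <= d + 6 * (kappa rU ru p w / rU) * (b + d).
Proof.
move=> Dx y0 Nb; rewrite local_energyE.
apply: (hsmooth_near oO p0 CG Dx y0) => z xz.
have Oz : O z.
  by have := nbhs_singleton Dx; apply; exact: ltW.
have [b1 b2] := gauge_bounds OX cN hN Nub ru0 ruU p0 w0 w16 hG hGs y Oz.
apply: sqr_ratio_estimate b1 b2 (Nb z xz) => //.
- exact: kappa_ge0.
- exact: kappa_lt.
- by have [+ _ _ _] := hN (OX Oz); exact.
- by have [+ _ _ _] := hG Oz; exact.
Qed.

End FixedScale.

(** kappa / rU equals psi + u(psi) k with k = 2 rU / ru, and each summand is made smaller than
    [h / 2]. *)
Lemma kappa_cvg (h : R) : 0 < h -> \forall e \near 0^'+,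
  [/\ 0 < e < 1, psi l e < h & kappa rU ru (psi l e) (u l (psi l e)) / rU < h].
Proof.
move=> h0; have [d0 dt _] := deltaP t0.
pose k := 2 * rU / ru; have k0 : 0 < k by rewrite divr_gt0// mulr_gt0.
have [_ _ + _ _] := @u_tau _ _ _ _ S l.
have hk0 : 0 < h / (2 * k) by rewrite divr_gt0// mulr_gt0.
move=> /cvgr0Pnorm_lt /(_ _ hk0) /nbhs_ballP[r /= r0 rP].
near=> e.
have e0 : 0 < e by near: e; exact: nbhs_right_gt.
have e1 : e < 1 by near: e; exact: nbhs_right_lt.
have eh : e < h / delta l by near: e; apply: nbhs_right_lt; exact: divr_gt0.
have eh2 : e < h / 2 / delta l by near: e; apply: nbhs_right_lt; rewrite !divr_gt0.
have er : e < r / delta l by near: e; apply: nbhs_right_lt; exact: divr_gt0.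
have p0 : 0 < psi l e by rewrite mulr_gt0.
split; first by rewrite e0.
  by rewrite /psi -ltr_pdivlMr.
have uh : u l (psi l e) < h / (2 * k).
  have br : ball (0 : R) r (psi l e).
    by rewrite -ball_normE /= sub0r normrN gtr0_norm// /psi -ltr_pdivlMr.
  exact: le_lt_trans (ler_norm _) (rP _ br p0).
rewrite /kappa mulrAC mulfV ?gt_eqF// mul1r -/k [ltRHS]splitr ltrD//.
  by rewrite /psi -ltr_pdivlMr.
by apply: lt_le_trans (_ : h / (2 * k) * k <= _); [rewrite ltr_pM2r|rewrite half_div].
Unshelve. all: by end_near. Qed.

Lemma local_energy_cvg q1 (h : R) : O q1.1 -> 0 < h ->
  exists2 d, 0 < d & \forall e \near 0^'+, forall q, `|q - q1| < d ->
    smoothing_domain e q.1 -> `|local_energy e q - N q ^+ 2| <= h.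
Proof.
move=> Oq h0.
have cN2 : {for q1, continuous (fun q => N q ^+ 2)}.
  by have := cont_mul (cN (OX Oq)) (cN (OX Oq)).
have h4 : 0 < h / 4 by rewrite divr_gt0.
have [d d0 dP] := (continuous_forP _ _).1 cN2 _ h4.
pose B := N q1 ^+ 2 + h; have B0 : 0 < B by rewrite ltr_wpDl// sqr_ge0.
(* One half of [d] is for the distance from [q] to [q1], the other for the horizontal shift, which
   is smaller than [psi l e]. *)
exists (d / 2); first by rewrite divr_gt0.
have d2 : 0 < d / 2 by rewrite divr_gt0.
have h12 : 0 < h / (12 * B) by rewrite divr_gt0// mulr_gt0.
apply: filterS2 (kappa_cvg d2) (kappa_cvg h12) => e [e01 pd _] [_ _ kh] q qd Dq.
case: q qd Dq => x y qd /= Dx.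
have Nq (z : 'rV[R]_n) : `|z - x| < d / 2 -> `|N (z, y) ^+ 2 - N q1 ^+ 2| < h / 4.
  move=> zx; apply: dP; move: qd; rewrite !prod_norm_lt /= => /andP[xd yd].
  rewrite (lt_trans yd) ?gtr_pMr// ?invf_lt1 ?ltr1n// andbT.
  by rewrite -(subrKA x) (le_lt_trans (ler_normD _ _))// (splitr d) ltrD.
have Nx : `|N (x, y) ^+ 2 - N q1 ^+ 2| < h / 4 by apply: Nq; rewrite subrr normr0.
(* [local_energy_near] concerns nonzero vectors; on the zero section both quantities vanish. *)
have [y0|y0] := eqVneq y 0.
  rewrite y0 local_energy0// (_ : N (x, 0) = 0) ?expr0n/= ?subrr ?normr0 ?ltW//.
  have Ox : O x by have := nbhs_singleton Dx; apply; rewrite subrr (_ : enorm 0 = 0) ?ltW //;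
    [have [] := psi_bounds e01|apply/eqP; rewrite enorm_eq0].
  have [_ _ NZ _] := hN (OX Ox).
  by have := NZ 0 0 (lexx 0); rewrite scale0r mul0r.
have kap0 : 0 <= kappa rU ru (psi l e) (u l (psi l e)) / rU.
  have [p0 pd'] := psi_bounds e01.
  have [_ dt _] := deltaP t0.
  have pt : 0 < psi l e < tau l by rewrite p0 (lt_le_trans pd').
  have [_ w0 _] := tau_params hF pt.
  by rewrite divr_ge0 ?(ltW rU0)// kappa_ge0.
apply: le_trans (local_energy_near e01 Dx y0 (b := N (x, y) ^+ 2) (d := h / 2) _) _.
  move=> z xz; have zx : `|z - x| < d / 2.
    by rewrite distrC (le_lt_trans (norm_le_enorm _))// (lt_trans xz).
  by move: (Nq z zx) Nx; exact: dist_two.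
exact: error_le h0 (sqr_ge0 _) (sqr_ge0 _) kap0 kh Nx.
Qed.

End LocalSmoothingData.

(** * The smoothing on the manifold *)

Lemma open_snd_neq0 (R : realType) (n : nat) :
  open [set q : 'rV[R]_n * 'rV[R]_n | q.2 != 0].
Proof.
rewrite (_ : [set q | _] = snd @^-1` [set y : 'rV[R]_n | y != 0]) //.
by apply: open_comp => [q _|]; [exact: cvg_snd|exact: open_neq0].
Qed.

Section Energy.
Context {R : realType} {n : nat} {M : smooth_manifold R n}.
Context {F : tangent_bundle M -> R} (hF : C0_Finsler F) (S : smoothing_data F).
Implicit Types (l : indices S) (m : M) (p : tangent_bundle M) (c : chart R n M).

Definition energy_term (e : R) l p : R :=
  phi l (base p) * local_energy l e (tcoord (chart_of l) p).

Definition energy (e : R) p : R := \sum_(l \in [set: indices S]) energy_term e l p.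

Lemma mollifier_smoothingE e p : mollifier_smoothing S e p = Num.sqrt (energy e p).
Proof. by []. Qed.

(** Local finiteness turns the sum over all indices into a sum over one sequence, fixed near [m],
    which can be differentiated termwise. *)
Lemma local_indices m : exists2 r : seq (indices S), uniq r &
  \forall m' \near m, forall l, l \notin r -> phi l m' = 0.
Proof.
have [W mW fW] := @U_locally_finite _ _ _ _ S m.
have [s sE] := (finite_seqP _).1 fW.
exists (undup s); first exact: undup_uniq.
apply: filterS mW => m' Wm' l; rewrite mem_undup => /negP ls.
apply/eqP/negPn/negP => ph; apply: ls.
suff : [set l | U l `&` W !=set0] l by rewrite sE.
exists m'; split=> //.
by apply: (@phi_support _ _ _ _ S l); exact: subset_closure.
Qed.

Lemma phi_closure_V l m : phi l m != 0 -> closure (V l) m.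
Proof. by move=> ph; apply: supp_phi_sub; exact: subset_closure. Qed.

Lemma closure_V_dom l m : closure (V l) m -> dom (chart_of l) m.
Proof.
by move=> /closure_V_sub Um; apply: (@U_dom _ _ _ _ S l); exact: subset_closure.
Qed.

Lemma fsum_phi (r : seq (indices S)) m (f : indices S -> R) :
  uniq r -> (forall l, l \notin r -> phi l m = 0) ->
  \sum_(l \in [set: indices S]) phi l m * f l = \sum_(l <- r) phi l m * f l.
Proof.
move=> ur r0; rewrite (fsbigE r)// => [|l _ /r0 ->]; last by rewrite mul0r.
by apply: eq_bigl => l; rewrite in_setT.
Qed.

Lemma sum_phi (r : seq (indices S)) m :
  uniq r -> (forall l, l \notin r -> phi l m = 0) -> \sum_(l <- r) phi l m = 1.
Proof.
move=> ur r0; rewrite -(@phi_sum _ _ _ _ S m) (fsbigE r)// => [|l _ /r0 //].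
by apply: eq_bigl => l; rewrite in_setT.
Qed.

(** The weights sum to 1, so one of them is positive. Positivity of [f] is asked only at nonzero
    weights because [f] has no meaning where the chart does not reach. *)
Lemma sum_phi_gt0 m (r : seq (indices S)) (f : indices S -> R) :
  uniq r -> (forall l, l \notin r -> phi l m = 0) ->
  (forall l, phi l m != 0 -> 0 < f l) -> 0 < \sum_(l <- r) phi l m * f l.
Proof.
move=> ur r0 f0; have t0 l : 0 <= phi l m * f l.
  have [->|ph] := eqVneq (phi l m) 0; first by rewrite mul0r.
  by rewrite mulr_ge0 ?(@phi_ge0 _ _ _ _ S l)// ltW// f0.
rewrite lt_def sumr_ge0// andbT psumr_eq0//; apply/negP => /allP a0.
have : \sum_(l <- r) phi l m = 0.
  rewrite big_seq big1// => l lr; apply/eqP/negPn/negP => ph.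
  by have := a0 l lr; rewrite /= mulf_eq0 (negbTE ph)/= gt_eqF// f0.
by rewrite sum_phi// => /eqP; rewrite oner_eq0.
Qed.

Lemma tcoord_vec_neq0 c p : @atlas R n M c -> dom c (base p) -> vec p != 0 ->
  (tcoord c p).2 != 0.
Proof.
move=> Ac cp; apply: contra => /eqP E; apply/eqP.
exact: (diff_transition_eq0 (chart_at_atlas _) Ac (chart_at_dom _) cp E).
Qed.

Lemma tparam_vec_neq0 c m y : @atlas R n M c -> dom c m -> y != 0 ->
  vec (tparam c (coord c m, y)) != 0.
Proof.
move=> Ac cm; apply: contra => /eqP; rewrite /tparam /= coordK// => E; apply/eqP.
exact: (diff_transition_eq0 Ac (chart_at_atlas _) cm (chart_at_dom _) E).
Qed.

Section FixedScale.
Variables (e : R) (e01 : 0 < e < 1).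

Lemma local_energy_tcoord_gt0 l p : phi l (base p) != 0 -> vec p != 0 ->
  0 < local_energy l e (tcoord (chart_of l) p).
Proof.
move=> /phi_closure_V Vp v0; have dp := closure_V_dom Vp.
apply: (local_energy_gt0 hF e01); last exact: tcoord_vec_neq0 (chart_of_atlas l) dp v0.
by apply: closure_V_domain => //; exists (base p).
Qed.

Lemma energy_gt0 p : vec p != 0 -> 0 < energy e p.
Proof.
move=> v0; have [r ur /nbhs_singleton r0] := local_indices (base p).
rewrite /energy (fsum_phi _ ur r0); apply: sum_phi_gt0 => // l ph.
exact: local_energy_tcoord_gt0.
Qed.

(** Off the support of [phi l] the term vanishes locally. On it the base point lies in the closure
    of [V l], where the local energy is smooth, and the tangent map of the transition carries it to
    the chart [c]. *)
Lemma Ck_along_energy_term l c k : @atlas R n M c ->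
  Ck_along setT k (tdom c `&` [set q | q.2 != 0]) (fun q => energy_term e l (tparam c q)).
Proof.
move=> Ac; have Ad := chart_of_atlas l; set d := chart_of l in Ad.
apply: Ck_along_local => -[x y] [/= [m cm /= <-] y0].
have [sm|sm] := pselect (supp (phi l) m); last first.
  exists [set q | (coord c @` (dom c `&` ~` supp (phi l))) q.1]; first by exists m.
  have oD : open [set q : 'rV[R]_n * 'rV[R]_n | (coord c @` (dom c `&` ~` supp (phi l))) q.1].
    apply: (@open_fst _ _ (coord c @` (dom c `&` ~` supp (phi l)))).
    by apply: chart_image_open; apply: closed_openC; exact: closed_closure.
  apply: (@Ck_along_eq _ _ _ _ _ (fun=> 0)) => //; last exact: Ck_along_cst.
  move=> [_ z] [m' [cm' nm'] /= <-]; rewrite /energy_term base_tparam//.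
  rewrite (_ : phi l m' = 0) ?mul0r//; apply/eqP/negPn/negP => ph.
  by apply: nm'; exact: subset_closure.
have Vm := supp_phi_sub sm; have dm := closure_V_dom Vm.
pose DD := [set q : 'rV[R]_n * 'rV[R]_n | smoothing_domain l e q.1 /\ q.2 != 0].
have oDD : open DD.
  by apply: openI; [apply: open_fst; exact: open_deep|exact: open_snd_neq0].
pose D' := [set q | overlap c d q.1 /\ DD (ttransition c d q)].
have sT := transition_smooth Ac Ad.
have oD' : open D' by exact: (open_tangent_preimage (@overlap_open _ _ _ c d) sT oDD).
exists D'.
  split; first by exists m.
  rewrite /DD /ttransition /= transition_coord//; split.
    by apply: closure_V_domain => //; exists m.
  by apply: contra y0 => /eqP /diff_transition_eq0 ->.
apply: (@Ck_along_eq _ _ _ _ _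
   (fun q => phi l (param c q.1) * local_energy l e (ttransition c d q))) => //.
  by move=> q [oq _]; rewrite /energy_term -/d tcoord_tparamE.
apply: Ck_along_mul => //.
  have C := smooth_on_Ck_along setT k (@phi_smooth _ _ _ _ S l c Ac).
  apply: (@Ck_along_sub _ _ setT (fst @^-1` (coord c @` dom c))) => //.
    by move=> q [[m' [cm' _] E] _]; exists m'.
  apply: (@Ck_along_affine _ _ _ setT setT (coord c @` dom c) fst fst _ _ _ _ _ _ C) => //.
    exact: coord_open.
  by move=> q; exact: cvg_fst.
exact: (Ck_along_tangent_map (@overlap_open _ _ _ c d) sT oDD (Ck_along_local_energy hF l e01 k)).
Qed.

Lemma Ck_along_energy c k : @atlas R n M c ->
  Ck_along setT k (tdom c `&` [set q | q.2 != 0]) (fun q => energy e (tparam c q)).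
Proof.
move=> Ac; apply: Ck_along_local => -[x y] [/= [m cm /= <-] y0].
have [r ur mr] := local_indices m.
have : nbhs m [set m' | forall l, l \notin r -> phi l m' = 0] := mr.
rewrite nbhsE => -[B [oB Bm] Br].
pose D' := [set q : 'rV[R]_n * 'rV[R]_n | (coord c @` (dom c `&` B)) q.1 /\ q.2 != 0].
have oD' : open D'.
  by apply: openI; [apply: open_fst; exact: chart_image_open|exact: open_snd_neq0].
exists D'; first by split=> //; exists m.
apply: (@Ck_along_eq _ _ _ _ _ (fun q => \sum_(l <- r) energy_term e l (tparam c q))) => //.
  move=> [_ z] [[m' [cm' Bm'] /= <-] z0]; rewrite /energy /energy_term base_tparam//.
  by rewrite (fsum_phi _ ur (Br _ Bm')).
apply: Ck_along_sum => // l; apply: Ck_along_sub (Ck_along_energy_term l k Ac) => //.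
by move=> q [[m' [cm' _] E] q0]; split=> //; exists m'.
Qed.

Lemma smoothing_smooth_on c : @atlas R n M c ->
  smooth_on (tdom c `&` [set q | q.2 != 0]) (mollifier_smoothing S e \o tparam c).
Proof.
move=> Ac; apply: Ck_along_smooth_on => k.
have oD : open (tdom c `&` [set q : 'rV[R]_n * 'rV[R]_n | q.2 != 0]).
  by apply: openI; [exact: tdom_open|exact: open_snd_neq0].
apply: (@Ck_along_eq _ _ _ _ _ (fun q => Num.sqrt (energy e (tparam c q)))) => //.
apply: Ck_along_sqrt => //; last exact: Ck_along_energy.
move=> [_ y] [[m cm /= <-] /= y0]; apply: energy_gt0.
exact: tparam_vec_neq0.
Qed.

End FixedScale.

End Energy.

(** * Positive definiteness of the Hessian on a fibre *)

Section DeriveSum.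
Context {R : realType} {W : normedModType R} {I : eqType}.
Implicit Types (r : seq I) (b : I -> R) (f : I -> W -> R).

Lemma is_derive_sum_seq r b f x v : (forall i, i \in r -> derivable (f i) x v) ->
  is_derive x v (fun y => \sum_(i <- r) b i * f i y) (\sum_(i <- r) b i * 'D_v (f i) x).
Proof.
elim: r => [|i r IH] df.
  rewrite (_ : (fun _ => _) = cst 0); last by apply/funext => y; rewrite big_nil.
  by rewrite big_nil; exact: is_derive_cst.
rewrite (_ : (fun _ => _) = (b i *: f i) + (fun y => \sum_(j <- r) b j * f j y)); last first.
  by apply/funext => y; rewrite big_cons.
rewrite big_cons.
have d1 : is_derive x v (b i *: f i) (b i *: 'D_v (f i) x).
  by apply: is_deriveZ; split => //; apply: df; rewrite mem_head.
have d2 := IH (fun j jr => df j (mem_behead (s := i :: r) jr)).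
exact: is_deriveD.
Qed.

Lemma derive2_sum_seq r b f (D : set W) x v : open D -> D x ->
  (forall i, i \in r -> forall y, D y -> derivable (f i) y v) ->
  (forall i, i \in r -> derivable ('D_v (f i)) x v) ->
  'D_v ('D_v (fun y => \sum_(i <- r) b i * f i y)) x =
  \sum_(i <- r) b i * 'D_v ('D_v (f i)) x.
Proof.
move=> oD Dx d1 d2.
rewrite (@near_eq_derive _ _ _ _ (fun y => \sum_(i <- r) b i * 'D_v (f i) y)).
  by have [_ ->] := is_derive_sum_seq b d2.
apply: filterS (open_nbhs_nbhs (conj oD Dx)) => y Dy.
by have [_ ->] := is_derive_sum_seq b (fun i ir => d1 i ir y Dy).
Qed.

End DeriveSum.

Section Hessian.
Context {R : realType} {n : nat}.
Implicit Types (f : 'rV[R]_n -> R) (D : set 'rV[R]_n) (x y v : 'rV[R]_n).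

Lemma derive_row_sum f D x v : open D -> D x -> Ck_along setT 1 D f ->
  'D_v f x = \sum_j v 0 j * 'D_(delta_mx 0 j : 'rV[R]_n) f x.
Proof.
move=> oD Dx Cf; rewrite {1}(row_sum_delta v).
have d1 (j : 'I_n) y : D y -> derivable f y (delta_mx 0 j).
  by move=> Dy; have [] := Ck_along_derivable Cf (I : setT (delta_mx 0 j)) Dy.
have d2 (j : 'I_n) : {for x, continuous ('D_(delta_mx 0 j : 'rV[R]_n) f)}.
  exact: (Ck_along_continuous (Ck_along_derive Cf (I : setT (delta_mx 0 j))) Dx).
by have [_ ->] := is_derive_lincomb (fun j => v 0 j) oD Dx d1 d2.
Qed.

(** All convexity so far concerns second derivatives along one vector; this converts it into the
    quadratic form of the Hessian. *)
Lemma hessian_quadratic f D y v : open D -> D y -> Ck_along setT 2 D f ->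
  (v *m hessian f y *m v^T) 0 0 = 'D_v ('D_v f) y.
Proof.
move=> oD Dy Cf.
have C1 w : Ck_along setT 1 D ('D_w f) by exact: (Ck_along_derive Cf).
have C0 : Ck_along setT 1 D f by exact: Ck_along_pred.
rewrite (derive_row_sum v oD Dy (C1 v)) mxE.
under eq_bigr do rewrite !mxE mulr_suml.
rewrite exchange_big /=; apply: eq_bigr => i _.
rewrite (@near_eq_derive _ _ _ _ (fun x => \sum_(j <- index_enum 'I_n) v 0 j * 'D_(delta_mx 0 j : 'rV[R]_n) f x)).
  have d1 (j : 'I_n) : j \in index_enum 'I_n ->
      derivable ('D_(delta_mx 0 j : 'rV[R]_n) f) y (delta_mx 0 i).
    by move=> _; have [] := Ck_along_derivable (C1 (delta_mx 0 j)) (I : setT (delta_mx 0 i)) Dy.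
  have [_ ->] := is_derive_sum_seq (fun j => v 0 j) d1.
  rewrite mulr_sumr; apply: eq_bigr => j _.
  by rewrite mxE [LHS]mulrAC mulrA.
apply: filterS (open_nbhs_nbhs (conj oD Dy)) => x Dx.
exact: (derive_row_sum v oD Dx C0).
Qed.

(** On a fibre, passing to another chart is the linear map [L], so vertical derivatives along [L v]
    become derivatives along [v] with no first-order term. *)
Lemma derive2_slice (h : 'rV[R]_n * 'rV[R]_n -> R) (D : set ('rV[R]_n * 'rV[R]_n))
    (L : {linear 'rV[R]_n -> 'rV[R]_n}) x v (B : set 'rV[R]_n) :
  (forall y, B y -> D (x, L y)) -> open B -> open D -> Ck_along setT 2 D h ->
  forall y, B y ->
  [/\ derivable (fun y => h (x, L y)) y v,
      derivable ('D_v (fun y => h (x, L y))) y v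
    & 'D_v ('D_v (fun y => h (x, L y))) y =
      'D_(0, L v) ('D_(0, L v) h) (x, L y)].
Proof.
move=> BD oB oD Ch y By; pose T z := (x, L z).
have TE z (t : R) : T (t *: v + z) = t *: (0, L v) + T z.
  by rewrite vertical_shift /T /= linearP.
have d1 z : B z -> is_derive z v (h \o T) ('D_(0, L v) h (T z)).
  move=> /BD Dz; apply: is_derive_affine (TE z) _.
  exact: (Ck_along_derivable (Ck_along_pred Ch) (I : setT (0, L v)) Dz).
have d2 : is_derive y v ('D_(0, L v) h \o T) ('D_(0, L v) ('D_(0, L v) h) (T y)).
  apply: is_derive_affine (TE y) _; have Dy := BD _ By.
  exact: (Ck_along_derivable (Ck_along_derive Ch (I : setT (0, L v))) (I : setT (0, L v)) Dy).
have E : \forall z \near y, ('D_(0, L v) h \o T) z = 'D_v (h \o T) z.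
  by apply: filterS (open_nbhs_nbhs (conj oB By)) => z Bz; have [_ ->] := d1 z Bz.
have [d3 e3] := near_eq_is_derive E d2; have [d4 _] := d1 y By.
by split; [exact: d4|exact: d3|exact: e3].
Qed.

End Hessian.

Section Minkowski.
Context {R : realType} {n : nat} {M : smooth_manifold R n}.
Context {F : tangent_bundle M -> R} (hF : C0_Finsler F) (S : smoothing_data F).
Variables (e : R) (e01 : 0 < e < 1) (m : M).

Let a := chart_at m.
Let Aa : @atlas R n M a := chart_at_atlas m.
Let am : dom a m := chart_at_dom m.
Let E (v : 'rV[R]_n) : R := energy S e (Tangent m v).

Let oD : open (~` [set (0 : 'rV[R]_n)]).
Proof.
by rewrite (_ : ~` _ = [set y | y != 0]); [exact: open_neq0|apply/seteqP; split=> y /eqP].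
Qed.

Let Ck_slice k (f : tangent_bundle M -> R) :
  Ck_along setT k (tdom a `&` [set q | q.2 != 0]) (f \o tparam a) ->
  Ck_along setT k (~` [set 0]) (fun v => f (Tangent m v)).
Proof.
move=> Cf.
rewrite (_ : (fun _ => _) = (f \o tparam a) \o (fun v => (coord a m, v))); last first.
  by apply/funext => v; rewrite /= tparam_chart_at.
apply: (@Ck_along_sub _ _ setT
   ((fun v => (coord a m, v)) @^-1` (tdom a `&` [set q | q.2 != 0]))) => //.
  by move=> v v0; split; [exists m|apply/eqP].
apply: (@Ck_along_affine _ _ _ setT setT _ _ (fun v => (0, v)) _ _ _ _ _ _ Cf) => //.
- by apply: openI; [exact: tdom_open|exact: open_snd_neq0].
- move=> v; apply/continuous_forP => d d0; exists d => // z zv.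
  by rewrite prod_norm_lt /= subrr normr0 d0 zv.
- by move=> v x h _; rewrite vertical_shift.
Qed.

Let CE k : Ck_along setT k (~` [set 0]) E.
Proof. by apply: Ck_slice; exact: (Ck_along_energy hF). Qed.

Let energy_ge0 v : 0 <= E v.
Proof.
have [r ur /nbhs_singleton r0] := local_indices S m.
rewrite /E /energy (fsum_phi (m := m) _ ur r0) sumr_ge0// => l _.
by rewrite mulr_ge0 ?local_energy_ge0// (@phi_ge0 _ _ _ _ S l).
Qed.

Let L (l : indices S) : {linear 'rV[R]_n -> 'rV[R]_n} :=
  'd (transition a (chart_of l)) (coord a m).

(** Indices of zero weight are filtered out, since nothing is known about the derivatives of their
    local energies. *)
Let EE r : uniq r -> (forall l, l \notin r -> phi l m = 0) -> forall v,
  E v = \sum_(l <- [seq l <- r | phi l m != 0])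
     phi l m * local_energy l e (coord (chart_of l) m, L l v).
Proof.
move=> ur r0 v; rewrite /E /energy (fsum_phi (m := m) _ ur r0) big_filter [RHS]big_mkcond.
apply: eq_bigr => l _; case: eqVneq => [->|//].
by rewrite mul0r.
Qed.

Let EZ (mu : R) v : 0 < mu -> E (mu *: v) = mu ^+ 2 * E v.
Proof.
move=> mu0; have [r ur /nbhs_singleton r0] := local_indices S m.
rewrite !(EE ur r0) mulr_sumr [LHS]big_seq [RHS]big_seq; apply: eq_bigr => l.
rewrite mem_filter => /andP[ph _].
have dV : smoothing_domain l e (coord (chart_of l) m).
  by apply: closure_V_domain => //; exists m => //; exact: phi_closure_V.
have LZ : L l (mu *: v) = mu *: L l v by exact: linearZ.
rewrite LZ (local_energyZ hF e01 (L l v) dV mu0); exact: mulrCA.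
Qed.

Let E_convex y v : y != 0 -> v != 0 -> 0 < 'D_v ('D_v E) y.
Proof.
move=> y0 v0; have [r ur /nbhs_singleton r0] := local_indices S m.
have -> : E = (fun v => \sum_(l <- [seq l <- r | phi l m != 0])
     phi l m * local_energy l e (coord (chart_of l) m, L l v)).
  by apply/funext => w; exact: EE.
pose DD (l : indices S) := [set q : 'rV[R]_n * 'rV[R]_n | smoothing_domain l e q.1 /\ q.2 != 0].
have oDD (l : indices S) : open (DD l).
  by apply: openI; [apply: open_fst; exact: open_deep|exact: open_snd_neq0].
have dV (l : indices S) : phi l m != 0 -> smoothing_domain l e (coord (chart_of l) m).
  by move=> ph; apply: closure_V_domain => //; exists m => //; exact: phi_closure_V.
have L0 (l : indices S) w : phi l m != 0 -> w != 0 -> L l w != 0.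
  move=> /phi_closure_V/closure_V_dom dm; apply: contra => /eqP w0; apply/eqP.
  exact: (diff_transition_eq0 Aa (chart_of_atlas l) am dm w0).
have BD (l : indices S) : phi l m != 0 -> forall y, [set y | y != 0] y -> DD l (coord (chart_of l) m, L l y).
  by move=> ph w w0; split; [exact: dV|exact: L0].
have H (l : indices S) (ph : phi l m != 0) w (w0 : w != 0) :=
  derive2_slice v (BD l ph) (@open_neq0 R 'rV[R]_n) (oDD l) (Ck_along_local_energy hF l e01 2) w0.
rewrite (derive2_sum_seq (fun l => phi l m) (@open_neq0 R 'rV[R]_n) y0).
- rewrite big_filter.
  rewrite (_ : \sum_(l <- r | _) _ =
     \sum_(l <- r) phi l m * 'D_(0, L l v) ('D_(0, L l v) (local_energy l e))
       (coord (chart_of l) m, L l y)).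
    apply: sum_phi_gt0 => // l ph.
    by apply: (local_energy_convex hF e01); [exact: dV|exact: L0|exact: L0].
  rewrite [LHS]big_mkcond; apply: eq_bigr => l _.
  case: ifPn => [ph|/negPn/eqP E0]; last by rewrite E0 mul0r.
  have [_ _ H3] := H l ph y y0; exact: (congr1 ( *%R (phi l m)) H3).
- by move=> l; rewrite mem_filter => /andP[ph _] w w0; have [] := H l ph w w0.
- by move=> l; rewrite mem_filter => /andP[ph _]; have [] := H l ph y y0.
Qed.

Lemma smoothing_minkowski_norm : minkowski_norm (fun v => mollifier_smoothing S e (Tangent m v)).
Proof.
split=> [|mu v mu0|y y0 v v0].
- apply: Ck_along_smooth_on => k; apply: Ck_slice.
  exact: (smooth_on_Ck_along setT k (smoothing_smooth_on hF S e01 Aa)).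
- rewrite !mollifier_smoothingE -/(E _) -/(E v) EZ// sqrtrM ?sqr_ge0//.
  by rewrite sqrtr_sqr gtr0_norm.
rewrite (_ : (fun _ => _) = E); last first.
  by apply/funext => w; rewrite mollifier_smoothingE sqr_sqrtr ?(energy_ge0 w).
rewrite -scalemxAr -scalemxAl mxE mulr_gt0 ?invr_gt0//.
rewrite (hessian_quadratic v oD _ (CE 2)); last exact/eqP.
exact: E_convex.
Qed.

End Minkowski.

(** * Uniform convergence on compact sets *)

Lemma filter_all_seq (T : Type) (I : eqType) (G : set_system T) (r : seq I) (P : I -> T -> Prop) :
  Filter G -> (forall i, i \in r -> \forall x \near G, P i x) ->
  \forall x \near G, forall i, i \in r -> P i x.
Proof.
move=> FG; elim: r => [|i r IH] H; first by apply: filterE.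
have H1 := H i (mem_head i r).
have H2 : \forall x \near G, forall i, i \in r -> P i x.
  by apply: IH => j jr; apply: H; rewrite inE jr orbT.
by apply: filterS2 H1 H2 => x Pi Pr j; rewrite inE => /predU1P[->|/Pr].
Qed.

(** From (a - b)^2 <= |a^2 - b^2| for nonnegative a and b. The bound stays valid at a = 0, where the
    root is not Lipschitz, as compact sets may meet the zero section. *)
Lemma sqrt_dist (R : rcfType) (a E h : R) : 0 <= a -> 0 <= E -> 0 < h ->
  `|E - a ^+ 2| <= h ^+ 2 / 2 -> `|a - Num.sqrt E| < h.
Proof.
move=> a0 E0 h0; rewrite -{1}(sqr_sqrtr E0).
move: (Num.sqrt E) (sqrtr_ge0 E) => b b0.
rewrite !ltr_distl ler_distl => /andP[l1 l2]; apply/andP; split.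
  by rewrite ltNge; apply/negP => le; nra.
by rewrite ltNge; apply/negP => le; nra.
Qed.

Section Convergence.
Context {R : realType} {n : nat} {M : smooth_manifold R n}.
Context {F : tangent_bundle M -> R} (hF : C0_Finsler F) (S : smoothing_data F).
Implicit Types (l : indices S) (p : tangent_bundle M).

Lemma base_near p (B : set M) : nbhs (base p) B -> \forall p' \near p, B (base p').
Proof.
move=> pB; have Aa := chart_at_atlas (base p); have am := chart_at_dom (base p).
set a := chart_at (base p) in Aa am.
have cB : nbhs (tcoord a p) [set q | B (param a q.1)].
  have c1 : {for (tcoord a p).1, continuous (param a)}.
    by apply: param_continuous_at; exists (base p).
  have c2 : {for tcoord a p, continuous (param a \o fst)}.
    by apply: continuous_comp c1; exact: cvg_fst.
  by apply: (c2 B); rewrite /= coordK.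
by apply: filterS (nbhs_tcoord Aa am cB) => p' [ap']; rewrite /= coordK.
Qed.

(** With the weight on both sides the estimate also covers base points outside the chart, where both
    sides are 0, and it can be summed. *)
Lemma energy_term_near l p (h : R) : 0 < h ->
  \forall p' \near p & e \near 0^'+, phi l (base p') *
    `|local_energy l e (tcoord (chart_of l) p') - F p' ^+ 2| <= phi l (base p') * h.
Proof.
move=> h0; have [sm|sm] := pselect (supp (phi l) (base p)); last first.
  have sB : nbhs (base p) (~` supp (phi l)).
    by apply: open_nbhs_nbhs; split=> //; apply: closed_openC; exact: closed_closure.
  exists ([set p' | (~` supp (phi l)) (base p')], setT).
    by split; [exact: base_near|exact: filterT].
  move=> [p' e] [/= np' _]; rewrite (_ : phi l (base p') = 0) ?mul0r//.
  by apply/eqP/negPn/negP => ph; apply: np'; exact: subset_closure.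
have Vm := supp_phi_sub sm; have dm := closure_V_dom Vm; have Ad := chart_of_atlas l.
have Oq : (coord (chart_of l) @` U l) (tcoord (chart_of l) p).1.
  by exists (base p) => //; exact: closure_V_sub.
have [d d0 dP] := local_energy_cvg hF Oq h0.
have e01 : \forall e \near (0 : R)^'+, 0 < e < 1.
  by apply: filterS2 (nbhs_right_gt 0) (nbhs_right_lt ltr01) => e /= -> ->.
exists ([set p' | dom (chart_of l) (base p') /\
           ball (tcoord (chart_of l) p) d (tcoord (chart_of l) p')],
        [set e | (0 < e < 1) /\ forall q, `|q - tcoord (chart_of l) p| < d ->
           smoothing_domain l e q.1 ->
           `|local_energy l e q - F (tparam (chart_of l) q) ^+ 2| <= h]).
  split; last exact: filterI e01 dP.
  by apply: nbhs_tcoord => //; exact: nbhsx_ballx.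
move=> [p' e] [/= [dp' bp'] [e1 eP]].
have [->|ph] := eqVneq (phi l (base p')) 0; first by rewrite !mul0r.
apply: ler_wpM2l; first exact: (@phi_ge0 _ _ _ _ S l).
have := eP (tcoord (chart_of l) p'); rewrite tparam_tcoord//; apply.
  by move: bp'; rewrite -ball_normE /= distrC.
by apply: closure_V_domain => //; exists (base p') => //; exact: phi_closure_V.
Qed.

Lemma energy_ge0 e p : 0 <= energy S e p.
Proof.
have [r ur /nbhs_singleton r0] := local_indices S (base p).
rewrite /energy (fsum_phi _ ur r0) sumr_ge0// => l _.
by rewrite mulr_ge0 ?local_energy_ge0// (@phi_ge0 _ _ _ _ S l).
Qed.

Lemma energy_near p (h : R) : 0 < h ->
  \forall p' \near p & e \near 0^'+, `|energy S e p' - F p' ^+ 2| <= h.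
Proof.
move=> h0; have [r ur mr] := local_indices S (base p).
have N1 : \forall p' \near p & e \near (0 : R)^'+, forall l, l \notin r -> phi l (base p') = 0.
  exists ([set p' | forall l, l \notin r -> phi l (base p') = 0], setT).
    by split; [exact: base_near mr|exact: filterT].
  by move=> [p' e] [].
have N2 : \forall p' \near p & e \near 0^'+, forall l, l \in r -> phi l (base p') *
    `|local_energy l e (tcoord (chart_of l) p') - F p' ^+ 2| <= phi l (base p') * h.
  pose Q l (z : tangent_bundle M * R) := phi l (base z.1) *
    `|local_energy l z.2 (tcoord (chart_of l) z.1) - F z.1 ^+ 2| <= phi l (base z.1) * h.
  exact: (@filter_all_seq _ _ _ r Q _ (fun l _ => energy_term_near l p h0)).
apply: filterS2 N1 N2 => -[p' e] /= r0 le.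
have -> : F p' ^+ 2 = \sum_(l <- r) phi l (base p') * F p' ^+ 2.
  by rewrite -mulr_suml sum_phi// mul1r.
rewrite /energy (fsum_phi _ ur r0) -sumrB (le_trans (ler_norm_sum _ _ _))//.
have hE : h = \sum_(l <- r) phi l (base p') * h by rewrite -mulr_suml sum_phi// mul1r.
rewrite [leRHS]hE big_seq [leRHS]big_seq; apply: ler_sum => l lr.
rewrite -mulrBr normrM ger0_norm; last exact: (@phi_ge0 _ _ _ _ S l).
exact: le.
Qed.

(** [energy_near] holds jointly near each point and near [e = 0]; near covering by compactness makes
    the range of [e] common to the whole compact set. *)
Lemma smoothing_cvg : {family compact, mollifier_smoothing S e @[e --> 0^'+] --> F}.
Proof.
apply/fam_cvgP => A cA P; rewrite uniform_nbhs => -[B [entB BP]].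
have [h h0 hB] : exists2 h : R, 0 < h & forall x y : R, `|x - y| < h -> B (x, y).
  move: entB; rewrite -entourage_ballE => -[h /= h0 hB]; exists h => // x y xy.
  by apply: hB => /=; rewrite -ball_normE.
have h2 : 0 < h ^+ 2 / 2 by rewrite divr_gt0// exprn_gt0.
have /compact_near_coveringP/(_ R (0 : R)^'+ (fun e p => `|energy S e p - F p ^+ 2| <= h ^+ 2 / 2)) := cA.
have near_e p : A p -> \forall p' \near p & e \near (0 : R)^'+,
   `|energy S e p' - F p' ^+ 2| <= h ^+ 2 / 2 by move=> _; exact: energy_near.
move=> /(_ _ near_e) H.
apply: filterS H => e eA; apply: BP => p Ap; apply: hB.
rewrite mollifier_smoothingE; apply: sqrt_dist => //.
- by case: p Ap => m v _; have [_ /(_ m) [N0 _ _ _]] := hF; exact: N0.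
- exact: energy_ge0.
- exact: eA.
Qed.

Lemma smoothing_Finsler (e : R) : 0 < e < 1 -> Finsler (mollifier_smoothing S e).
Proof.
move=> e01; split=> [c Ac|m]; first exact: smoothing_smooth_on.
exact: smoothing_minkowski_norm.
Qed.

End Convergence.

Theorem theorem6p3 (R : realType) (n : nat) (M : smooth_manifold R n)
    (F : tangent_bundle M -> R) (hF : C0_Finsler F) (S : smoothing_data F) :
  (forall e : R, 0 < e < 1 -> Finsler (mollifier_smoothing S e)) /\
  {family compact, mollifier_smoothing S e @[e --> 0^'+] --> F}.
Proof.
split=> [e|]; first exact: smoothing_Finsler.
exact: smoothing_cvg.
Qed.
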